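(* Let $k, d$ be natural numbers with $0 \leq k \leq d$, and suppose $k$ is even or $d$ is odd. Let $G$ be a $d$-regular bipartite Borel graph on a standard Borel space $X$. \begin{itemize} \item If $\tau$ is a Polish topology on $X$ compatible with its Borel structure, then there is a Borel $G$-invariant $\tau$-meager set $A \subseteq X$ such that $G \upharpoonright (X \setminus A)$ admits a Borel $k$-factor. \item If $\mu$ is a Borel probability measure on $X$ such that $G$ is $\mu$-hyperfinite, then there is a Borel $G$-invariant $\mu$-null set $A \subseteq X$ such that $G \upharpoonright (X \setminus A)$ admits a Borel $k$-factor. \end{itemize}
   Context: A Borel graph on a standard Borel space $X$ is a graph with vertex set $X$ whose (symmetric, irreflexive) edge set is a Borel subset of $X^2$. A set $A \subseteq X$ is $G$-invariant if it is a union of connected components of $G$. A $k$-factor of a graph is a $k$-regular spanning subgraph; a Borel $k$-factor is one whose edge set is Borel. $G$ is $\mu$-hyperfinite if there is a $G$-invariant Borel $\mu$-conull set on which $G$ is hyperfinite, i.e. its restriction is the increasing union of a sequence of Borel graphs all of whose connected components are finite. *)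

(* Defs.v *)
From Stdlib Require Export Relations.Relation_Operators.
From mathcomp Require Export all_boot all_order all_algebra.
From mathcomp Require Export all_classical all_reals all_analysis.

Set Implicit Arguments.
Unset Strict Implicit.
Unset Printing Implicit Defensive.

Local Open Scope classical_set_scope.

(* A topology on a fixed carrier T is an element of the class of topologicalType
   over T; [space tau] is T equipped with tau. *)
Definition topology_on (T : Type) : Type := Topological.axioms_ T.

Definition space (T : Type) (tau : topology_on T) : topologicalType :=
  Topological.Pack tau.

Definition complete_metric (R : realType) (M : metricType R) : Prop :=
  forall u : nat -> M, cauchy (u @ \oo) -> exists l : M, u @ \oo --> l.

Definition completely_metrizable (R : realType) (T : topologicalType) : Prop :=
  exists m : Metric.axioms_ R T, let M : metricType R := Metric.Pack m in
    (forall U : set T, open U <-> open (U : set M)) /\ complete_metric M.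

Definition separable (T : topologicalType) : Prop :=
  exists2 D : set T, countable D & dense D.

(* The choice of R is immaterial: any two realTypes are isomorphic. *)
Definition polish (R : realType) (T : topologicalType) : Prop :=
  separable T /\ completely_metrizable R T.

Definition compatible (disp : measure_display) (X : measurableType disp)
    (tau : topology_on X) : Prop :=
  forall A : set X, measurable A <-> <<s @open (space tau) >> A.

Definition standard_borel (R : realType) (disp : measure_display)
    (X : measurableType disp) : Prop :=
  exists tau : topology_on X, polish R (space tau) /\ compatible tau.

Definition nowhere_dense (T : topologicalType) (A : set T) : Prop :=
  interior (closure A) = set0.

Definition meager (T : topologicalType) (A : set T) : Prop :=
  exists2 F : nat -> set T, (forall n, nowhere_dense (F n)) & A = \bigcup_n F n.

(* A graph is given by its edge set, a symmetric irreflexive set of ordered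
   pairs; its vertex set is all of X, or a subset V of X passed separately. *)
Section Graphs.
Variable X : Type.
Implicit Types (E F : set (X * X)) (A V : set X) (x y : X) (n : nat).

Definition graph E : Prop :=
  (forall x y, E (x, y) -> E (y, x)) /\ (forall x, ~ E (x, x)).

Definition neighbors E x : set X := [set y | E (x, y)].

Definition regular_on V n E : Prop := forall x, V x -> (neighbors E x #= `I_n)%card.

(* The parts are not required to be Borel. *)
Definition bipartite E : Prop :=
  exists S : set X, forall x y, E (x, y) -> (S x <-> ~ S y).

Definition component E x : set X :=
  [set y | clos_refl_sym_trans X (fun u v => E (u, v)) x y].

Definition invariant E A : Prop :=
  exists S : set X, A = \bigcup_(x in S) component E x.

Definition restrict_graph E V : set (X * X) := E `&` (V `*` V).

(* F is a k-factor of the graph with vertex set V and edge set E. *)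
Definition factor k V E F : Prop := [/\ graph F, F `<=` E & regular_on V k F].

End Graphs.

Section BorelGraphs.
Variables (disp : measure_display) (X : measurableType disp).
Implicit Types (E : set (X * X)) (V : set X).

Definition borel_graph E : Prop := graph E /\ measurable E.

Definition admits_borel_factor k V E : Prop :=
  exists F : set (X * X), factor k V E F /\ measurable F.

Definition hyperfinite E : Prop :=
  exists F : nat -> set (X * X),
    [/\ forall n, borel_graph (F n),
        forall n x, finite_set (component (F n) x),
        forall n, F n `<=` F n.+1
      & E = \bigcup_n F n].

Definition mu_hyperfinite (R : realType) (mu : probability X R) E : Prop :=
  exists B : set X,
    [/\ measurable B, invariant E B, mu (~` B) = 0%E
      & hyperfinite (restrict_graph E B)].

End BorelGraphs.

(* Main.v *)
(** Enumerate the neighbours of a vertex by Borel functions and start from the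
    constant fractional factor [k / d], written with a common denominator [N].
    Inside a conull (comeager) invariant set it is rounded in two passes, until
    at every vertex either no edge or exactly two edges carry a fractional value.

    First pass: pushing one unit alternately along an (even) cycle of fractional
    edges keeps the vertex sums.  Generically, finitely many pushes take a given
    edge off all cycles; for a measure, choosing the sign of each push so as to
    decrease [f (N - f)] in mean makes the changes summable.  The fractional
    edges then form a forest in which no vertex has degree one.

    Second pass, measure case: a witness of hyperfiniteness gives directions
    [D_n] towards a point of the finite class of a vertex.  Convex combinations of
    the [D_n] of almost minimal [L^2] norm converge almost everywhere, and the
    limit points each vertex of the forest to an end, to a vertex, or to a line.
    Rounding from the parents to the children is then unambiguous, except along
    chains of children whose value is always dictated by the parent; these chains
    are lines, whose edges are rounded to the nearest multiple of [N], or to [N / 2]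
    if [N] is even.

    Second pass, Baire case: rounded values are committed on finite connected sets
    which are far apart, where the distance counts branch vertices only.  Along a
    path with enough branch vertices a prescribed value can always be reached,
    because the distance of [f] from the alternating rounding decreases at each
    branch vertex that does not allow to break the alternation.  Hence every
    partial commitment extends, and generically every vertex which is not on a
    line of the forest gets committed.

    What is left are lines.  If [N] is odd, rounding their edges to the nearest
    multiple of [N] preserves the sums.  If [k] is even, rounding [k / (2 d)] and
    doubling gives values [x] in {0, 1, 2} with vertex sums [k], and then
    [(2 k + x) / (2 d + 1)] is a fractional factor with an odd denominator. *)
From HB Require Import structures.
Require Import Defs.
From mathcomp Require Import lra zify ring measurable_realfun.

Set Implicit Arguments.
Unset Strict Implicit.
Unset Printing Implicit Defensive.
Import Order.TTheory GRing.Theory Num.Theory.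
Import numFieldNormedType.Exports.

Local Open Scope classical_set_scope.

(** * Polish metrics *)

Section PolishMetrics.
Local Open Scope ring_scope.

(** The parts of the bipartition need not be Borel. They make cycles even, but they give no Borel
    2-colouring of the edges of a line, and this is the obstacle behind the parity hypothesis: on a
    line all of whose edges have the value [N / 2], rounding means choosing one of its two perfect
    matchings, which can be impossible on every conull or comeager invariant set. With [N] odd no
    value is halfway, and at a vertex with two fractional edges the two rounding errors, each below
    [N / 2], add up to a multiple of [N], hence to 0. So the passes work for every [N], reaching
    fractional degree 0 or 2, and parity enters only through the choice of [N]. Values are kept as
    integer numerators: a fractional edge can be moved by one unit in either direction, and only
    finitely often in the same direction; and the fractional values at a vertex sum to a multiple of
    [N], which is why the forest has no vertex of degree one. *)

Record polish_metric (R : realType) (X : Type) (tau : topology_on X)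
    (rho : X -> X -> R) (q : nat -> X) : Prop := PolishMetric {
  rhoxx : forall x, rho x x = 0;
  rho_eq : forall x y, rho x y = 0 -> x = y;
  rhoC : forall x y, rho x y = rho y x;
  rho_tri : forall y x z, rho x z <= rho x y + rho y z;
  rho_openP : forall U : set X, @open (space tau) U <->
    forall x, U x -> exists2 e : R, 0 < e & forall y, rho x y < e -> U y;
  rho_complete : forall u : nat -> X,
    (forall e : R, 0 < e -> exists n, forall i, (n <= i)%N -> rho (u n) (u i) < e) ->
    exists l, forall e : R, 0 < e -> exists n, forall i, (n <= i)%N -> rho l (u i) < e;
  rho_dense : forall x (e : R), 0 < e -> exists n, rho x (q n) < e }.

Lemma polish_metric_exists (R : realType) (X : pointedType) (tau : topology_on X) :
  polish R (space tau) ->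
  exists (rho : X -> X -> R) (q : nat -> X), polish_metric tau rho q.
Proof.
move=> [[D cD dD] [m [oE cM]]].
pose M : metricType R := Metric.Pack m.
pose rho : X -> X -> R := @mdist R M.
have opP (U : set X) : @open (space tau) U <->
    forall x, U x -> exists2 e : R, 0 < e & forall y, rho x y < e -> U y.
  split.
    move=> /oE; rewrite openE => oU x Ux.
    have /nbhs_ballP[e /= e0 eU] := oU x Ux.
    by exists e => // y xy; apply: eU; rewrite ballEmdist.
  move=> H; apply/oE; rewrite openE => x Ux; apply/nbhs_ballP.
  have [e e0 eU] := H x Ux; exists e => // y; rewrite ballEmdist; exact: eU.
have rxx x : rho x x = 0 by exact: mdistxx.
have rtri y x z : rho x z <= rho x y + rho y z by exact: metric_triangle.
have rC x y : rho x y = rho y x by exact: metric_sym.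
(* [X] is pointed, so [D] is nonempty; [d0] fills the indices that the injection [h] misses. *)
have [/eqP D0|/set0P[d0 Dd0]] := boolP (D == set0).
  exfalso; case: (dD setT) => [||x [_]]; [|exact: openT|by rewrite D0].
  by exists (point : X).
have [q qD] : exists q : nat -> X, forall x, D x -> exists n, q n = x.
  have /countable_injP[h hinj] := cD.
  exists (fun n => if pselect (exists2 x, D x & h x = n) is left e then
                   sval (cid2 e) else d0) => x Dx.
  exists (h x); case: pselect => [e|[]]; last by exists x.
  by case: (cid2 e) => y Dy /= hy; apply: hinj; rewrite ?inE.
exists rho, q; split => //.
- by move=> x y; exact: mdist_positivity.
- move=> u uC; have [l ul] : exists l : M, (u : nat -> M) @ \oo --> l.
    apply: cM; apply: cauchy_exP => e e0.
    have [n nu] := uC e e0; exists (u n); exists n => // i /= ni.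
    by rewrite /= ballEmdist; exact: nu.
  exists l => e e0; have := ul (ball (l : M) e) (nbhsx_ballx _ _ e0).
  by move=> [n _ nu]; exists n => i ni; have : ball (l : M) e (u i) := nu i ni;
     rewrite ballEmdist.
- move=> x e e0; have [||y [xy /qD[n qn]]] := dD [set y | rho x y < e].
  + by exists x; rewrite /= rxx.
  + apply/opP => y /= xy; exists (e - rho x y); first by rewrite subr_gt0.
    by move=> z yz; apply: le_lt_trans (rtri y x z) _; rewrite addrC -ltrBrDr.
  + by exists n; rewrite qn.
Qed.

End PolishMetrics.

Section MetricFacts.
Local Open Scope ring_scope.
Variables (R : realType) (X : Type) (tau : topology_on X).
Variables (rho : X -> X -> R) (q : nat -> X).
Hypothesis pm : polish_metric tau rho q.

Lemma rho_ge0 x y : 0 <= rho x y.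
Proof.
have := rho_tri pm y x x; rewrite (rhoxx pm) [rho y x](rhoC pm).
by rewrite -mulr2n pmulrn_lge0.
Qed.

Lemma open_rball x (e : R) : @open (space tau) [set y | rho x y < e].
Proof.
apply/(rho_openP pm) => y /= xy; exists (e - rho x y); first by rewrite subr_gt0.
move=> z yz; apply: le_lt_trans (rho_tri pm y x z) _.
by rewrite addrC -ltrBrDr.
Qed.

Lemma rho_neq x y : x <> y -> 0 < rho x y.
Proof.
move=> xy; rewrite lt_neqAle rho_ge0 andbT eq_sym.
by apply/eqP => /(rho_eq pm).
Qed.

(* A countable family of open sets such that every point is separated by a
   member from every finite set avoiding it. *)
Definition obase (n : nat) : set X :=
  if unpickle n is Some (i, j) then [set y | rho (q i) y < (j.+1%:R^-1 : R)] else set0.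

Lemma open_obase n : @open (space tau) (obase n).
Proof.
rewrite /obase; case: (unpickle n) => [[i j]|]; last exact: open0.
exact: open_rball.
Qed.

Lemma inv_natS_lt (e : R) : 0 < e -> exists j : nat, (j.+1%:R^-1 : R) < e.
Proof.
move=> e0; exists (Num.truncn e^-1); rewrite invf_plt ?posrE //.
exact: truncnS_gt.
Qed.

Lemma obase_small x (e : R) : 0 < e ->
  exists n, obase n x /\ obase n `<=` [set y | rho x y < e].
Proof.
move=> e0; have [j je] : exists j : nat, (j.+1%:R^-1 : R) < e / 2.
  by apply: inv_natS_lt; rewrite divr_gt0.
have j0 : 0 < (j.+1%:R^-1 : R) by rewrite invr_gt0.
have [i ij] := rho_dense pm x j0.
exists (pickle (i, j)); rewrite /obase pickleK; split.
  by rewrite /= (rhoC pm).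
move=> y /= ijy; apply: le_lt_trans (rho_tri pm (q i) x y) _.
by move: ij ijy je; set r := _^-1; set a := rho x _; set b := rho _ y => *; lra.
Qed.

Lemma obase_open x (U : set X) : @open (space tau) U -> U x ->
  exists n, obase n x /\ obase n `<=` U.
Proof.
move=> /(rho_openP pm) oU /oU[e e0 eU].
have [n [nx nU]] := obase_small x e0; exists n; split => // y /nU; exact: eU.
Qed.

Lemma obase_isolate x (s : seq X) : exists n, obase n x /\
  forall y, List.In y s -> obase n y -> y = x.
Proof.
have [e e0 se] : exists2 e : R, 0 < e & forall y, List.In y s -> rho x y < e -> y = x.
  elim: s => [|z s [e e0 se]]; first by exists 1.
  have [->|zx] := pselect (z = x).
    by exists e => // y [<-//|/se].
  have zx0 : 0 < rho x z by apply: rho_neq => xz; apply: zx.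
  exists (Num.min e (rho x z)); first by rewrite lt_min e0.
  by move=> y [<-|ys]; rewrite lt_min ?ltxx ?andbF // => /andP[/(se _ ys)].
have [n [nx ns]] := obase_small x e0.
by exists n; split => // y ys /ns; exact: se.
Qed.

End MetricFacts.

(** * Souslin schemes and Borel sets *)

Section Souslin.
Local Open Scope ring_scope.
Variables (R : realType) (disp : measure_display) (X : measurableType disp).
Variables (tau : topology_on X) (rho : X -> X -> R) (q : nat -> X).
Hypothesis pm : polish_metric tau rho q.
Hypothesis cmp : compatible tau.

Let Z := nat -> X.

Definition cvgZ (u : nat -> Z) (z : Z) := forall i (e : R), 0 < e ->
  exists n0, forall n, (n0 <= n)%N -> rho (z i) (u n i) < e.

Definition closedZ (C : set Z) := forall u z, (forall n, C (u n)) -> cvgZ u z -> C z.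

(** The Souslin operation on closed subsets of the product. Analytic subsets of [X] appear below as
    projections of such sets to coordinate 0; the other coordinates hold the witnesses. *)
Definition sous (B : set Z) := exists P : seq nat -> set Z,
  (forall s, closedZ (P s)) /\
  forall z, B z <-> exists a : nat -> nat, forall n, P (mkseq a n) z.

Lemma sous_ext (A B : set Z) : (forall z, A z <-> B z) -> sous A -> sous B.
Proof. by move=> AB [P [cP hP]]; exists P; split => // z; rewrite -AB. Qed.

Lemma sous_closed C : closedZ C -> sous C.
Proof.
move=> cC; exists (fun=> C); split => // z.
by split => [Cz|[a /(_ 0)]//]; exists (fun=> 0%N).
Qed.

Lemma mkseq_cons (T : Type) (a : nat -> T) n :
  mkseq a n.+1 = a 0%N :: mkseq (fun k => a k.+1) n.
Proof. by rewrite /mkseq /= (iotaDl 1 0) -map_comp. Qed.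

(** The first entry of a branch selects [j], the rest is a branch for [B j]. *)
Lemma sous_bigcup (B : nat -> set Z) : (forall j, sous (B j)) ->
  sous [set z | exists j, B j z].
Proof.
move=> /choice[P hP].
exists (fun s => if s is j :: s' then P j s' else setT); split.
  by case=> [|j s]; [|exact: (hP j).1].
move=> z; split=> [[j /(hP j).2[a az]]|[a az]].
  exists (fun n => if n is n'.+1 then a n' else j) => n.
  by case: n => [|n] //; rewrite (mkseq_cons _ n).
exists (a 0%N); apply/(hP _).2; exists (fun n => a n.+1) => n.
have E := mkseq_cons a n; move: (az n.+1); case: (mkseq a n.+1) E => [//|j s'].
by case=> -> ->.
Qed.

(** One branch encodes a branch for every [j]: its entry at [pickle (j, m)] is entry [m] of branch
    [j]. A finite piece [s] imposes only the constraints whose entries all lie below [size s]. *)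
Lemma sous_bigcap (B : nat -> set Z) : (forall j, sous (B j)) ->
  sous [set z | forall j, B j z].
Proof.
move=> /choice[P hP].
pose code (j m : nat) := pickle (j, m).
exists (fun s => [set z | forall j n, (forall m, (m < n)%N -> (code j m < size s)%N) ->
   P j (mkseq (fun m => nth 0%N s (code j m)) n) z]); split.
  move=> s u z hu uz j n hs; apply: ((hP j).1 _ u z _ uz) => k.
  exact: hu.
move=> z; split=> [Bz|[a az] j].
  have /choice[a ha] : forall j, exists a : nat -> nat, forall n, P j (mkseq a n) z.
    by move=> j; apply/(hP j).2.
  exists (fun k => if unpickle k is Some (j, m) then a j m else 0%N) => N j n hs.
  have := ha j n; congr (P j _ z); apply/eq_in_map => m; rewrite mem_iota /= add0n => mn.
  have := hs m mn; rewrite size_mkseq => cN.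
  by rewrite nth_mkseq // /code pickleK.
apply/(hP j).2; exists (fun m => a (code j m)) => n.
pose N := (\max_(m < n) (code j m).+1)%N.
have := az N j n; rewrite size_mkseq.
have hm m : (m < n)%N -> (code j m < N)%N.
  by move=> mn; rewrite /N (bigD1 (Ordinal mn)) //= leq_max leqnn.
move=> /(_ hm); congr (P j _ z); apply/eq_in_map => m; rewrite mem_iota /= add0n => mn.
by rewrite nth_mkseq // hm.
Qed.

(** Souslin sets are closed under countable unions and intersections, so those whose complement is
    Souslin too form a sigma-algebra. It contains the preimages of all Borel sets under coordinates
    and pairs of coordinates. *)
Definition bisous (B : set Z) := sous B /\ sous (~` B).

Lemma bisous_ext (A B : set Z) : (forall z, A z <-> B z) -> bisous A -> bisous B.
Proof.
move=> AB [sA sA']; split; first exact: sous_ext sA.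
by apply: sous_ext sA' => z; rewrite /setC /= AB.
Qed.

Lemma bisousC B : bisous B -> bisous (~` B).
Proof. by move=> [? ?]; split => //; rewrite setCK. Qed.

Lemma bisous_ex (B : nat -> set Z) : (forall j, bisous (B j)) ->
  bisous [set z | exists j, B j z].
Proof.
move=> hB; split; first by apply: sous_bigcup => j; case: (hB j).
apply: (@sous_ext [set z | forall j, (~` B j) z]).
  by move=> z; split => [h [j /h]|h j Bj] //; apply: h; exists j.
by apply: sous_bigcap => j; case: (hB j).
Qed.

Lemma bisous_all (B : nat -> set Z) : (forall j, bisous (B j)) ->
  bisous [set z | forall j, B j z].
Proof.
move=> hB; have := bisousC (bisous_ex (fun j => bisousC (hB j))).
apply: bisous_ext => z; split => [h j|h [j]]; last by apply; exact: h.
by apply: contrapT => nB; apply: h; exists j.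
Qed.

Lemma bisous_and A B : bisous A -> bisous B -> bisous [set z | A z /\ B z].
Proof.
move=> hA hB; have := @bisous_all (fun j => if j is 0%N then A else B) _.
move=> /(_ _)/bisous_ext; apply; last by case.
by move=> z; split => [h|[? ?] []//]; split; [exact: (h 0%N)|exact: (h 1%N)].
Qed.

Lemma bisous_sigma (T : Type) (phi : Z -> T) :
  sigma_algebra setT [set A : set T | bisous [set z | A (phi z)]].
Proof.
split => /=.
- have c0 : closedZ set0 by move=> u z /(_ 0%N).
  split; first exact: sous_closed.
  by apply: sous_closed => u z _ _ [].
- move=> A /bisousC; apply: bisous_ext => z; split => [?|[]//]; split => //.
- move=> F hF; apply: bisous_ext (bisous_ex hF) => z; split => -[j].
    by exists j.
  by move=> _ ?; exists j.
Qed.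

Lemma bisous_coord i (A : set X) : measurable A -> bisous [set z | A (z i)].
Proof.
move=> /cmp; move: A; apply: smallest_sub; first exact: bisous_sigma.
move=> O oO /=; split.
  (* An open set is the union of the closed sets of points at distance at least [1 / (j + 1)] from
     its complement. *)
  pose C j := [set z : Z | forall y, ~ O y -> j.+1%:R^-1 <= rho (z i) y].
  apply: (@sous_ext [set z | exists j, C j z]).
    move=> z; split=> [[j Cj]|Oz].
      apply: contrapT => nO; have := Cj _ nO; rewrite (rhoxx pm) leNgt.
      by rewrite invr_gt0 ltr0Sn.
    have [e e0 eO] := (rho_openP pm O).1 oO _ Oz.
    have [j je] := inv_natS_lt e0.
    exists j => y nO; rewrite leNgt; apply/negP => zy; apply: nO; apply: eO.
    exact: lt_trans je.
  apply: sous_bigcup => j; apply: sous_closed => u z Cu uz y nO.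
  apply/ler_addgt0Pr => e e0; have [n nz] := uz i e e0.
  apply: le_trans (Cu n y nO) _; apply: le_trans (rho_tri pm (z i) (u n i) y) _.
  by rewrite addrC lerD2l (rhoC pm) ltW // nz.
apply: sous_closed => u z nu uz /= Oz.
have [e e0 eO] := (rho_openP pm O).1 oO _ Oz.
have [n nz] := uz i e e0; apply: (nu n); apply: eO; exact: nz.
Qed.

Lemma bisous_pair i j (M : set (X * X)) : measurable M ->
  bisous [set z | M (z i, z j)].
Proof.
rewrite measurable_prod_measurableType; move: M; apply: smallest_sub.
  exact: (bisous_sigma (fun z => (z i, z j))).
move=> _ [A mA [B mB <-]] /=.
exact: bisous_and (bisous_coord i mA) (bisous_coord j mB).
Qed.

Definition bsep (A B : set X) := exists D, [/\ measurable D, A `<=` D & B `&` D = set0].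

(** Used in contrapositive form: if two countable unions cannot be separated, then some piece of one
    cannot be separated from some piece of the other. *)
Lemma bsep_bigcup (A B : nat -> set X) : (forall i j, bsep (A i) (B j)) ->
  bsep [set x | exists i, A i x] [set x | exists j, B j x].
Proof.
move=> h; have /choice[D hD] : forall ij : nat * nat, exists D,
  [/\ measurable D, A ij.1 `<=` D & B ij.2 `&` D = set0] by move=> ij; exact: h.
exists (\bigcup_i \bigcap_j D (i, j)); split.
- by apply: bigcupT_measurable => i; apply: bigcapT_measurable => j; case: (hD (i, j)).
- move=> x [i Ax]; exists i => // j _; case: (hD (i, j)) => _ h' _; exact: h'.
- rewrite -subset0 => x [[j Bx] [i _ /(_ j I) Dx]].
  by case: (hD (i, j)) => _ _ <-; split.
Qed.

End Souslin.

(** * Lusin separation of disjoint analytic sets *)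

Section Separation.
Local Open Scope ring_scope.
Variables (R : realType) (disp : measure_display) (X : measurableType disp).
Variables (tau : topology_on X) (rho : X -> X -> R) (q : nat -> X).
Hypothesis pm : polish_metric tau rho q.
Hypothesis cmp : compatible tau.

Let Z := nat -> X.

(** Entry [m] of [b] codes a list of dense points that approximate [z 0, ..., z m] up to
    [1 / (m + 1)]. These shrinking boxes force convergence along a branch, which the closed sets of
    the scheme alone do not. *)
Let Rg (b : seq nat) (z : Z) := forall m i, (m < size b)%N -> (i <= m)%N ->
  rho (z i) (q (nth 0%N (odflt [::] (unpickle (nth 0%N b m))) i)) <= m.+1%:R^-1.

Let Rg_ex (z : Z) : exists b : nat -> nat, forall n, Rg (mkseq b n) z.
Proof.
have /choice[h hh] : forall mi : nat * nat, exists k, rho (z mi.2) (q k) < mi.1.+1%:R^-1.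
  by move=> [m i] /=; apply: (rho_dense pm); rewrite invr_gt0.
exists (fun m => pickle (mkseq (fun i => h (m, i)) m.+1)) => n m i.
rewrite size_mkseq => mn im; rewrite nth_mkseq // pickleK /= nth_mkseq //.
exact: ltW (hh (m, i)).
Qed.

(** The projection of the part of the Souslin set whose branches extend [s]. The first components of
    a branch address the scheme, the second ones the boxes of [Rg]. *)
Let AP (P : seq nat -> set Z) (s : seq (nat * nat)) : set X :=
  [set x | exists z : Z, z 0%N = x /\ exists a : nat -> nat * nat,
     mkseq a (size s) = s /\
     forall n, P (mkseq (fun k => (a k).1) n) z /\ Rg (mkseq (fun k => (a k).2) n) z].

Let AP_agree P (a : nat -> nat * nat) n x : AP P (mkseq a n) x ->
  exists z : Z, z 0%N = x /\ forall m, (m <= n)%N ->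
    P (mkseq (fun k => (a k).1) m) z /\ Rg (mkseq (fun k => (a k).2) m) z.
Proof.
move=> [z [zx [b [ba bz]]]]; exists z; split => // m mn.
have ab k : (k < n)%N -> b k = a k.
  move=> kn; have := congr1 (fun s => nth (0, 0)%N s k) ba.
  by rewrite size_mkseq !nth_mkseq.
have [Pz Rz] := bz m; rewrite /mkseq.
by split; [move: Pz|move: Rz]; congr (_ _ z);
   apply/eq_in_map => k; rewrite mem_iota add0n => km; rewrite ab //;
   exact: leq_trans mn.
Qed.

(** Points chosen in the successive pieces are Cauchy in every coordinate because of the boxes, and
    the limit stays in the closed sets of the scheme. *)
Let AP_limit P (a : nat -> nat * nat) : (forall s, closedZ rho (P s)) ->
  (forall n, AP P (mkseq a n) !=set0) ->
  exists z : Z, (forall m, P (mkseq (fun k => (a k).1) m) z) /\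
    forall e : R, 0 < e -> exists n, forall x, AP P (mkseq a n) x -> rho (z 0%N) x < e.
Proof.
move=> cP ne.
have /choice[u hu] : forall n, exists z : Z, forall m, (m <= n)%N ->
    P (mkseq (fun k => (a k).1) m) z /\ Rg (mkseq (fun k => (a k).2) m) z.
  by move=> n; have [x /AP_agree[z [_ hz]]] := ne n; exists z.
pose c m i := q (nth 0%N (odflt [::] (unpickle (a m).2)) i).
have uc n m i : (m < n)%N -> (i <= m)%N -> rho (u n i) (c m i) <= m.+1%:R^-1.
  move=> mn im; have [_ /(_ m i)] := hu n n (leqnn _).
  by rewrite size_mkseq nth_mkseq //; apply.
have uC i (e : R) : 0 < e -> exists n, forall k, (n <= k)%N -> rho (u n i) (u k i) < e.
  move=> e0; have [|j je] := @inv_natS_lt R (e / 2); first by rewrite divr_gt0.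
  exists (maxn i j).+1 => k nk.
  apply: le_lt_trans (rho_tri pm (c (maxn i j) i) _ _) _.
  have h1 := uc (maxn i j).+1 (maxn i j) i (leqnn _) (leq_maxl _ _).
  have h2 := uc k (maxn i j) i nk (leq_maxl _ _).
  have h3 : (maxn i j).+1%:R^-1 <= (j.+1%:R^-1 : R).
    by rewrite lef_pV2 ?posrE // ler_nat ltnS leq_maxr.
  rewrite (rhoC pm (c _ _)) [ltRHS](splitr e); apply: ltrD.
    exact: le_lt_trans (le_trans h1 h3) je.
  exact: le_lt_trans (le_trans h2 h3) je.
have /choice[z hz] : forall i, exists l, forall e : R, 0 < e -> exists n, forall k,
    (n <= k)%N -> rho l (u k i) < e by move=> i; exact: (rho_complete pm (uC i)).
exists z; split.
  move=> m; apply: (cP _ (fun n => u (m + n)%N) z).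
    by move=> n; case: (hu (m + n)%N m (leq_addr _ _)).
  move=> i e e0; have [n hn] := hz i e e0; exists n => k nk; apply: hn.
  by rewrite (leq_trans nk) // leq_addl.
move=> e e0; have [|j je] := @inv_natS_lt R (e / 3); first by rewrite divr_gt0.
have [|n hn] := hz 0%N (e / 3); first by rewrite divr_gt0.
exists j.+1 => x /AP_agree[y [<- /(_ _ (leqnn _))[_ /(_ j 0%N)]]].
rewrite size_mkseq nth_mkseq // => /(_ (leqnn _) isT) yc.
have h1 := hn (maxn n j.+1) (leq_maxl _ _).
have h2 := uc (maxn n j.+1) j 0%N (leq_maxr _ _) isT.
apply: le_lt_trans (rho_tri pm (u (maxn n j.+1) 0%N) _ _) _.
have h4 := rho_tri pm (c j 0%N) (u (maxn n j.+1) 0%N) (y 0%N).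
rewrite (rhoC pm (c _ _)) in h4.
have h5 := le_lt_trans h2 je; have h6 := le_lt_trans yc je.
apply: le_lt_trans (lerD (lexx _) h4) _.
have -> : e = e / 3 + (e / 3 + e / 3).
  by lra.
by apply: ltrD => //; apply: ltrD.
Qed.

(** Otherwise two branches can be followed along which the pieces remain unseparated. They converge
    to points with distinct coordinates 0, and a small ball around the first of these separates late
    pieces. *)
Lemma lusin_separation (B1 B2 : set Z) : sous rho B1 -> sous rho B2 ->
  (forall z1 z2, B1 z1 -> B2 z2 -> z1 0%N <> z2 0%N) ->
  bsep [set x | exists z, B1 z /\ z 0%N = x] [set x | exists z, B2 z /\ z 0%N = x].
Proof.
move=> [P1 [cP1 hP1]] [P2 [cP2 hP2]] dis.
pose pr k : nat * nat := odflt (0, 0)%N (unpickle k).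
have Acup P s x : AP P s x -> exists k, AP P (rcons s (pr k)) x.
  move=> [z [zx [a [as_ az]]]]; exists (pickle (a (size s))), z; split => //.
  by exists a; split => //; rewrite size_rcons mkseqS as_ /pr pickleK.
have A0 P (B : set Z) : (forall z, B z <-> exists a : nat -> nat, forall n, P (mkseq a n) z) ->
    [set x | exists z, B z /\ z 0%N = x] `<=` AP P [::].
  move=> hP x [z [/hP[a az] zx]]; have [b bz] := Rg_ex z.
  by exists z; split => //; exists (fun k => (a k, b k)).
have sub A A' B B' : A `<=` A' -> B `<=` B' -> bsep A' B' -> bsep A B.
  move=> AA BB [D [mD A'D B'D]]; exists D; split => //; first exact: subset_trans A'D.
  by rewrite -subset0 -B'D; exact: setSI.
apply: contrapT => nsep.
have ns0 : ~ bsep (AP P1 [::]) (AP P2 [::]).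
  by move=> s0; apply: nsep; apply: sub s0; exact: A0.
have step (st : seq (nat * nat) * seq (nat * nat)) : exists p : (nat * nat) * (nat * nat),
    ~ bsep (AP P1 st.1) (AP P2 st.2) ->
    ~ bsep (AP P1 (rcons st.1 p.1)) (AP P2 (rcons st.2 p.2)).
  apply: contrapT => h; have h' p : bsep (AP P1 (rcons st.1 p.1)) (AP P2 (rcons st.2 p.2)).
    by apply: contrapT => h'; apply: h; exists p.
  apply: h; exists ((0, 0), (0, 0))%N => h0; exfalso; apply: h0.
  have hb := @bsep_bigcup _ X (fun i => AP P1 (rcons st.1 (pr i)))
    (fun j => AP P2 (rcons st.2 (pr j))) (fun i j => h' (pr i, pr j)).
  apply: sub hb.
    by move=> x /Acup.
  by move=> x /Acup.
have [F hF] := choice step.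
pose st := fix st n := if n is n'.+1 then
   (rcons (st n').1 (F (st n')).1, rcons (st n').2 (F (st n')).2) else ([::], [::]).
pose a1 n := (F (st n)).1; pose a2 n := (F (st n)).2.
have stE n : st n = (mkseq a1 n, mkseq a2 n).
  by elim: n => [//|n IH]; rewrite !mkseqS [LHS]/= IH /=; congr (rcons _ _, rcons _ _);
     rewrite ?/a1 ?/a2 IH.
have ns n : ~ bsep (AP P1 (mkseq a1 n)) (AP P2 (mkseq a2 n)).
  have -> : mkseq a1 n = (st n).1 by rewrite stE.
  have -> : mkseq a2 n = (st n).2 by rewrite stE.
  by elim: n => [//|n IH]; exact: hF.
have ne1 n : AP P1 (mkseq a1 n) !=set0.
  apply/set0P/eqP => E; apply: (ns n); rewrite E; exists set0; split => //.
  by rewrite setI0.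
have ne2 n : AP P2 (mkseq a2 n) !=set0.
  apply/set0P/eqP => E; apply: (ns n); rewrite E; exists setT; split => //.
  by rewrite set0I.
have [z1 [Pz1 cz1]] := AP_limit cP1 ne1.
have [z2 [Pz2 cz2]] := AP_limit cP2 ne2.
have z12 : z1 0%N <> z2 0%N.
  by apply: dis; [apply/hP1; exists (fun k => (a1 k).1)|apply/hP2; exists (fun k => (a2 k).1)].
have e0 := rho_neq pm z12; set e := rho _ _ in e0.
have e20 : 0 < e / 2 by rewrite divr_gt0.
have [n1 h1] := cz1 _ e20; have [n2 h2] := cz2 _ e20.
have mono P a n m : (n <= m)%N -> AP P (mkseq a m) `<=` AP P (mkseq a n).
  move=> nm x [z [zx [b [bm bz]]]]; exists z; split => //; exists b; split => //.
  have := congr1 (take n) bm; rewrite !size_mkseq /mkseq -!map_take.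
  by rewrite take_iota (minn_idPl nm).
apply: (ns (maxn n1 n2)); exists [set y | rho (z1 0%N) y < e / 2]; split.
- by apply/cmp; apply: sub_sigma_algebra; exact: (open_rball pm).
- by move=> x /(mono _ _ _ _ (leq_maxl n1 n2)) /h1.
- rewrite -subset0 => x [/(mono _ _ _ _ (leq_maxr n1 n2)) /h2 x2 /= x1].
  have := rho_tri pm x (z1 0%N) (z2 0%N); rewrite (rhoC pm x) leNgt => /negP; apply.
  by rewrite -/e [ltRHS](splitr e) ltrD.
Qed.

(** The two projections are disjoint and cover [X], so a Borel set that separates them is equal to
    the first. *)
Lemma souslin_measurable (B1 B2 : set Z) : sous rho B1 -> sous rho B2 ->
  (forall z1 z2, B1 z1 -> B2 z2 -> z1 0%N <> z2 0%N) ->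
  (forall x, exists z, z 0%N = x /\ (B1 z \/ B2 z)) ->
  measurable [set x | exists z, B1 z /\ z 0%N = x].
Proof.
move=> s1 s2 dis cov; have [D [mD h1 h2]] := lusin_separation s1 s2 dis.
suff -> : [set x | exists z, B1 z /\ z 0%N = x] = D by [].
apply/seteqP; split => // x Dx; have [z [zx [Bz|Bz]]] := cov x; first by exists z.
by have : set0 x by rewrite -h2; split => //; exists z.
Qed.

End Separation.

(** * A calculus of Borel predicates and Borel functions *)

Section BorelPredicates.
Variables (disp : measure_display) (X : measurableType disp).
Implicit Types (P Q : X -> Prop).

Definition bor P := measurable [set x | P x].
Definition bfun (h : X -> X) := measurable_fun [set: X] h.

Lemma bor_ext P Q : (forall x, P x <-> Q x) -> bor P -> bor Q.
Proof.
move=> PQ; rewrite /bor; congr measurable.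
by apply/seteqP; split => x /PQ.
Qed.

Lemma bor_cst (p : Prop) : bor (fun=> p).
Proof.
have [hp|hp] := pselect p.
  by apply: (@bor_ext (fun=> True)) => //; exact: measurableT.
by apply: (@bor_ext (fun=> False)) => //; exact: measurable0.
Qed.

Lemma bor_not P : bor P -> bor (fun x => ~ P x).
Proof. exact: measurableC. Qed.

Lemma bor_and P Q : bor P -> bor Q -> bor (fun x => P x /\ Q x).
Proof. exact: measurableI. Qed.

Lemma bor_or P Q : bor P -> bor Q -> bor (fun x => P x \/ Q x).
Proof. exact: measurableU. Qed.

Lemma bor_imp P Q : bor P -> bor Q -> bor (fun x => P x -> Q x).
Proof.
move=> bP bQ; apply: bor_ext (bor_or (bor_not bP) bQ) => x; split.
  by case.
by move=> PQ; have [/PQ|] := pselect (P x); [right|left].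
Qed.

Lemma bor_iff P Q : bor P -> bor Q -> bor (fun x => P x <-> Q x).
Proof. by move=> bP bQ; apply: bor_and; exact: bor_imp. Qed.

Lemma bor_ex (T : countType) (P : T -> X -> Prop) : (forall t, bor (P t)) ->
  bor (fun x => exists t, P t x).
Proof.
move=> bP.
apply: (@bor_ext (fun x => exists n : nat, if unpickle n is Some t then P t x else False)).
  move=> x; split => [[n]|[t Pt]]; first by case: unpickle => // t ?; exists t.
  by exists (pickle t); rewrite pickleK.
rewrite /bor; have -> : [set x | exists n : nat, if @unpickle T n is Some t then P t x else False] =
  \bigcup_n [set x | if @unpickle T n is Some t then P t x else False].
  by apply/seteqP; split => x [n]; [exists n|move=> _ ?; exists n].
apply: bigcupT_measurable => n; case: unpickle => [t|]; first exact: bP.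
exact: measurable0.
Qed.

Lemma bor_all (T : countType) (P : T -> X -> Prop) : (forall t, bor (P t)) ->
  bor (fun x => forall t, P t x).
Proof.
move=> bP; apply: bor_ext (bor_not (bor_ex (fun t => bor_not (bP t)))) => x.
split=> [h t|h [t]]; last by apply; exact: h.
by apply: contrapT => nP; apply: h; exists t.
Qed.

Lemma bor_comp P h : bfun h -> bor P -> bor (fun x => P (h x)).
Proof. by move=> mh bP; have := mh measurableT _ bP; rewrite setTI. Qed.

Lemma bfun_comp h h' : bfun h -> bfun h' -> bfun (fun x => h (h' x)).
Proof. by move=> mh mh'; apply: measurableT_comp. Qed.

Lemma bfun_id : bfun (fun x => x). Proof. exact: measurable_id. Qed.

Definition dbor (T : Type) (F : X -> T) := forall t, bor (fun x => F x = t).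

Lemma dbor_pre (T : countType) (F : X -> T) (Q : T -> Prop) :
  dbor F -> bor (fun x => Q (F x)).
Proof.
move=> bF; apply: (@bor_ext (fun x => exists t, F x = t /\ Q t)).
  by move=> x; split => [[t [<-]]//|]; exists (F x).
by apply: bor_ex => t; apply: bor_and => //; exact: bor_cst.
Qed.

Lemma dbor_comp (T : countType) (U : Type) (F : X -> T) (k : T -> U) :
  dbor F -> dbor (fun x => k (F x)).
Proof. by move=> bF u; apply: (dbor_pre (fun t => k t = u)). Qed.

Lemma dbor_pair (T U : Type) (F : X -> T) (F' : X -> U) :
  dbor F -> dbor F' -> dbor (fun x => (F x, F' x)).
Proof.
move=> bF bF' [t u]; apply: (@bor_ext (fun x => F x = t /\ F' x = u)).
  by move=> x; split => [[-> ->]//|[-> ->]].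
exact: bor_and.
Qed.

Lemma dbor_fun (T : Type) (F : X -> T) h : bfun h -> dbor F -> dbor (fun x => F (h x)).
Proof. by move=> bh bF t; apply: (bor_comp (P := fun x => F x = t)). Qed.

Lemma dbor_bool (F : X -> bool) : bor (fun x => F x) -> dbor F.
Proof.
move=> bF [|]; first by apply: bor_ext bF.
by apply: bor_ext (bor_not bF) => x; case: (F x); split.
Qed.

Lemma bor_sep (U : nat -> set X) h h' : (forall n, measurable (U n)) ->
  (forall x y, (forall n, U n x <-> U n y) -> x = y) ->
  bfun h -> bfun h' -> bor (fun x => h x = h' x).
Proof.
move=> mU sU bh bh'; apply: (@bor_ext (fun x => forall n, U n (h x) <-> U n (h' x))).
  by move=> x; split => [/sU|-> //].
by apply: bor_all => n; apply: bor_iff; apply: bor_comp => //; exact: mU.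
Qed.

End BorelPredicates.

(** * Borel enumeration of the neighbours *)

Section Enumeration.
Variables (R : realType) (disp : measure_display) (X : measurableType disp).
Variables (tau : topology_on X) (rho : X -> X -> R) (q : nat -> X).
Hypothesis pm : polish_metric tau rho q.
Hypothesis cmp : compatible tau.
Let U := obase rho q.

Lemma obase_measurable n : measurable (U n).
Proof. by apply/cmp; apply: sub_sigma_algebra; exact: (open_obase pm). Qed.

Lemma obase_sep x y : (forall n, U n x <-> U n y) -> x = y.
Proof.
move=> h; have [n [nx hn]] := obase_isolate pm x [:: y].
by symmetry; apply: hn; [left|apply/h].
Qed.

(** The lexicographic order of the membership sequences [n |-> U n x], a member coming before a
    non-member. *)
Definition ltX x y := exists n, [/\ U n x, ~ U n y & forall m, (m < n)%N -> U m x <-> U m y].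

Definition leX x y := `[< x = y \/ ltX x y >].

Lemma ltX_trans : forall x y z, ltX x y -> ltX y z -> ltX x z.
Proof.
move=> x y z [n [nx ny nm]] [n' [ny' nz' nm']].
case: (ltngtP n n') => nn.
- exists n; split => //; first by move/(nm' _ nn).
  by move=> m mn; rewrite nm // nm' //; apply: ltn_trans nn.
- exists n'; split => //; first by apply/(nm _ nn).
  by move=> m mn; rewrite nm ?nm' //; apply: ltn_trans nn.
- by rewrite nn in ny.
Qed.

Lemma ltX_irr x : ~ ltX x x. Proof. by case=> n []. Qed.

Lemma ltX_total x y : x <> y -> ltX x y \/ ltX y x.
Proof.
move=> xy; have : exists n, `[< ~ (U n x <-> U n y) >].
  apply: contrapT => h; apply: xy; apply: obase_sep => n.
  by apply: contrapT => h'; apply: h; exists n; apply/asboolP.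
case/ex_minnP => n /asboolP nn mn.
have hm m : (m < n)%N -> U m x <-> U m y.
  move=> mn'; apply: contrapT => h; have := mn m.
  by move=> /(_ (introT (asboolP _) h)); rewrite leqNgt mn'.
have [Ux|Ux] := pselect (U n x); have [Uy|Uy] := pselect (U n y).
- by exfalso; apply: nn.
- by left; exists n; split.
- by right; exists n; split => // m /hm ->.
- by exfalso; apply: nn.
Qed.

Lemma leX_total : total leX.
Proof.
move=> x y; apply/orP; have [->|/ltX_total[|]] := pselect (x = y).
- by left; apply/asboolP; left.
- by left; apply/asboolP; right.
- by right; apply/asboolP; right.
Qed.

Lemma leX_trans : transitive leX.
Proof.
move=> y x z /asboolP[->//|xy] /asboolP[<-|yz]; apply/asboolP; right => //.
exact: ltX_trans yz.
Qed.

Lemma leX_anti : antisymmetric leX.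
Proof.
move=> x y /andP[/asboolP[//|xy] /asboolP[//|yx]].
by have := @ltX_irr x (ltX_trans xy yx).
Qed.

Lemma bisous_cst (p : Prop) : bisous rho [set z : nat -> X | p].
Proof.
split; apply: sous_closed; [by move=> u z /(_ 0%N)|].
by move=> u z /(_ 0%N).
Qed.

Lemma bisous_imp (A B : set (nat -> X)) : bisous rho A -> bisous rho B ->
  bisous rho [set z | A z -> B z].
Proof.
move=> bA bB; apply: bisous_ext (bisousC (bisous_and bA (bisousC bB))) => z.
split=> [h Az|h [Az]]; last by apply; exact: h.
by apply: contrapT => nB; apply: h.
Qed.

Lemma bisous_ltX i j : bisous rho [set z : nat -> X | ltX (z i) (z j)].
Proof.
pose b k n := bisous_coord pm cmp k (obase_measurable n).
have bimp n m := bisous_imp (bisous_cst (m < n)%N)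
  (bisous_and (bisous_imp (b i m) (b j m)) (bisous_imp (b j m) (b i m))).
have := bisous_ex (fun n => bisous_and (b i n) (bisous_and (bisousC (b j n))
  (bisous_all (bimp n)))).
apply: bisous_ext => z; split => -[n].
  by move=> [? [? ?]]; exists n.
by move=> [? ? ?]; exists n.
Qed.

(** A vertex has only one increasing list of its [d] neighbours. Hence the preimages under [g i] of
    [A] and of its complement are both projections of Souslin sets of such lists, and Lusin
    separation makes them Borel. *)
Lemma borel_enumeration (d : nat) (G : set (X * X)) :
  measurable G -> regular_on [set: X] d G ->
  exists g : 'I_d -> X -> X, [/\ forall i, bfun (g i),
    forall x, injective (g^~ x) & forall x y, G (x, y) <-> exists i, g i x = y].
Proof.
move=> mG rG.
have /choice[s hs] : forall x, exists s : seq X,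
    [/\ uniq s, size s = d & forall y, y \in s <-> G (x, y)].
  move=> x; have := rG x I; rewrite card_eq_sym => /card_set_bijP[f [fd finj fsurj]].
  exists (map f (iota 0 d)); split.
  - rewrite map_inj_in_uniq ?iota_uniq // => i j; rewrite !mem_iota !add0n /= => id jd.
    by apply: finj; rewrite inE.
  - by rewrite size_map size_iota.
  - move=> y; split => [/mapP[i]|/fsurj[i id <-]].
      by rewrite mem_iota add0n /= => id ->; exact: fd.
    by apply: map_f; rewrite mem_iota add0n.
pose t x := sort leX (s x).
have ts x : [/\ uniq (t x), size (t x) = d & forall y, y \in t x <-> G (x, y)].
  have [us ss ms] := hs x; rewrite /t sort_uniq size_sort; split => // y.
  by rewrite mem_sort.
pose g (i : 'I_d) x := nth point (t x) i.
have uniqt x (r : seq X) : size r = d -> (forall y, y \in r -> G (x, y)) ->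
    (forall k, (k.+1 < d)%N -> ltX (nth point r k) (nth point r k.+1)) -> r = t x.
  move=> sr rG' rlt; have [ut st mt] := ts x.
  have srt : sorted (fun x y => `[< ltX x y >]) r.
    by apply/(sortedP point) => k; rewrite sr => /rlt h; apply/asboolP.
  have ur : uniq r.
    apply: (@sorted_uniq _ (fun x y => `[< ltX x y >])) srt.
      by move=> a b c /asboolP ab /asboolP bc; apply/asboolP; exact: ltX_trans bc.
    by move=> a; apply/negP => /asboolP /ltX_irr.
  apply: (@sorted_eq _ leX).
  - exact: leX_trans.
  - exact: leX_anti.
  - by apply: sub_sorted srt => a b /asboolP ab; apply/asboolP; right.
  - by apply: sort_sorted; exact: leX_total.
  - apply: uniq_perm => //; apply: (uniq_min_size _ _ _).2 => //.
      by move=> y /rG' /mt.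
    by rewrite sr st.
exists g; split.
- move=> i _ A mA; rewrite setTI.
  (* Coordinate 0 holds [x], coordinate [k + 1] its neighbour of rank [k]. *)
  pose B A := [set z : nat -> X | (forall k, (k < d)%N -> G (z 0%N, z k.+1)) /\
     ((forall k, (k.+1 < d)%N -> ltX (z k.+1) (z k.+2)) /\ A (z i.+1))].
  have bB A' : measurable A' -> bisous rho (B A').
    move=> mA'; apply: bisous_and; last apply: bisous_and.
    + apply: (bisous_all (B := fun k => [set z : nat -> X | (k < d)%N -> G (z 0%N, z k.+1)])) => k.
      by apply: bisous_imp; [exact: bisous_cst|exact: (bisous_pair pm cmp)].
    + apply: (bisous_all (B := fun k => [set z : nat -> X | (k.+1 < d)%N -> ltX (z k.+1) (z k.+2)])) => k.
      by apply: bisous_imp; [exact: bisous_cst|exact: bisous_ltX].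
    + exact: (bisous_coord pm cmp).
  have zt z : (forall k, (k < d)%N -> G (z 0%N, z k.+1)) ->
     (forall k, (k.+1 < d)%N -> ltX (z k.+1) (z k.+2)) -> z i.+1 = g i (z 0%N).
    move=> h1 h2; rewrite /g -(uniqt (z 0%N) (mkseq (fun k => z k.+1) d)).
    + by rewrite nth_mkseq.
    + by rewrite size_mkseq.
    + by move=> y /mapP[k]; rewrite mem_iota add0n /= => /h1 ? ->.
    + by move=> k kd; rewrite !nth_mkseq //; [exact: h2|exact: ltnW].
  have ex x : exists z : nat -> X, [/\ z 0%N = x, (forall k, (k < d)%N -> G (z 0%N, z k.+1)),
      (forall k, (k.+1 < d)%N -> ltX (z k.+1) (z k.+2)) & z i.+1 = g i x].
    exists (fun n => if n is k.+1 then nth point (t x) k else x); split => //.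
      by move=> k kd; have [_ st mt] := ts x; apply/mt; rewrite mem_nth // st.
    move=> k kd; have [ut st mt] := ts x.
    have := sort_sorted leX_total (s x); rewrite -/(t x) => /(sortedP point)/(_ k).
    rewrite st => /(_ kd)/asboolP[|//] /eqP; rewrite nth_uniq ?st //; last exact: ltnW.
    by rewrite eqn_leq ltnn andbF.
  suff -> : g i @^-1` A = [set x | exists z, B A z /\ z 0%N = x].
    apply: (souslin_measurable pm cmp (bB A mA).1 (bB _ (measurableC mA)).1).
      move=> z1 z2 [a1 [b1 c1]] [a2 [b2 c2]] z12; apply: c2.
      by rewrite zt // -z12 -zt.
    move=> x; have [z [zx h1 h2 h3]] := ex x; exists z; split => //.
    have [Az|Az] := pselect (A (z i.+1)); [by left|].
    by right.
  apply/seteqP; split => x.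
    by rewrite /preimage /= => Ag; have [z [zx h1 h2 h3]] := ex x; exists z; rewrite /B /= h3.
  by move=> [z [[h1 [h2 h3]] <-]]; rewrite /preimage /= -zt.
- move=> x i j; rewrite /g => /eqP; have [ut st mt] := ts x.
  by rewrite nth_uniq ?st // => /eqP /val_inj.
- move=> x y; have [ut st mt] := ts x; rewrite -mt; split.
    move=> yt; have iy : (index y (t x) < d)%N by rewrite -st index_mem.
    by exists (Ordinal iy); rewrite /g nth_index.
  by move=> [i <-]; rewrite /g mem_nth // st.
Qed.

End Enumeration.

(** * Borel graphs and fractional factors *)

(* A bipartite [d]-regular Borel graph, presented by Borel functions listing the
   neighbours of a vertex, together with countably many Borel sets isolating
   points from finite sets and a Borel linear order. *)
Record bgraph (disp : measure_display) (X : measurableType disp) (d : nat)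
    (g : 'I_d -> X -> X) (U : nat -> set X) (lt : X -> X -> Prop) : Prop := BGraph {
  bg_borel : forall i, bfun (g i);
  bg_inj : forall x, injective (g^~ x);
  bg_sym : forall x i, exists j, g j (g i x) = x;
  bg_bip : exists S : X -> Prop, forall x i, S x <-> ~ S (g i x);
  bg_UB : forall n, measurable (U n);
  bg_iso : forall x (s : seq X), exists n, U n x /\ forall y, y \in s -> U n y -> y = x;
  bg_ltB : forall h h', bfun h -> bfun h' -> bor (fun x => lt (h x) (h' x));
  bg_ltI : forall x, ~ lt x x;
  bg_ltT : forall x y z, lt x y -> lt y z -> lt x z;
  bg_ltC : forall x y, x <> y -> lt x y \/ lt y x }.

Section Words.
Variables (disp : measure_display) (X : measurableType disp) (d : nat).
Variables (g : 'I_d -> X -> X) (U : nat -> set X) (lt : X -> X -> Prop).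
Hypothesis bg : bgraph g U lt.
Implicit Types (x y z : X) (w : seq 'I_d) (i j : 'I_d).

Definition act w x := foldl (fun y i => g i y) x w.

Lemma act_cat w w' x : act (w ++ w') x = act w' (act w x).
Proof. by rewrite /act foldl_cat. Qed.

Lemma bfun_act w h : bfun h -> bfun (fun x => act w (h x)).
Proof.
elim: w h => [|i w IH] h bh //=.
by apply: (IH (fun x => g i (h x))); apply: bfun_comp => //; exact: (bg_borel bg).
Qed.

Lemma bfun_g i h : bfun h -> bfun (fun x => g i (h x)).
Proof. by move=> bh; apply: bfun_comp => //; exact: (bg_borel bg). Qed.

Lemma bor_eq h h' : bfun h -> bfun h' -> bor (fun x => h x = h' x).
Proof.
apply: (bor_sep (bg_UB bg)) => x y hxy.
have [n [nx hn]] := bg_iso bg x [:: y].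
by symmetry; apply: hn; rewrite ?inE //; apply/hxy.
Qed.

Lemma bor_U n h : bfun h -> bor (fun x => U n (h x)).
Proof. by move=> bh; apply: (bor_comp (P := U n)) => //; exact: (bg_UB bg). Qed.

Lemma act_rev w x : exists w', size w' = size w /\ act w' (act w x) = x.
Proof.
elim: w x => [|i w IH] x; first by exists [::].
have [w' [sw' hw']] := IH (g i x); have [j hj] := bg_sym bg x i.
exists (rcons w' j); rewrite size_rcons sw'; split => //.
by rewrite -cats1 act_cat /= hw' hj.
Qed.

Definition inv (V : X -> Prop) := forall x i, V x <-> V (g i x).

Lemma inv_act V w x : inv V -> V x <-> V (act w x).
Proof. by move=> iV; elim: w x => [|i w IH] x; [by []|rewrite (iV x i); exact: IH]. Qed.

Lemma inv_and V V' : inv V -> inv V' -> inv (fun x => V x /\ V' x).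
Proof. by move=> iV iV' x i; rewrite (iV x i) (iV' x i). Qed.

Lemma inv_forall (Q : X -> Prop) : inv (fun x => forall w, Q (act w x)).
Proof.
move=> x i; split => [h w|h w]; first exact: (h (i :: w)).
have [j hj] := bg_sym bg x i; have := h (j :: w).
by rewrite /= hj.
Qed.

Definition words (m : nat) : seq (seq 'I_d) :=
  flatten [seq [seq tval t | t <- enum {:k.-tuple 'I_d}] | k <- iota 0 m.+1].

Lemma mem_words m w : (size w <= m)%N -> w \in words m.
Proof.
move=> wm; apply/flattenP; exists [seq tval t | t <- enum {:(size w).-tuple 'I_d}].
  by apply/mapP; exists (size w) => //; rewrite mem_iota add0n.
by apply/mapP; exists (in_tuple w) => //; rewrite mem_enum.
Qed.

Lemma isolate_ball x m : exists n, U n x /\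
  forall w, (size w <= m)%N -> U n (act w x) -> act w x = x.
Proof.
have [n [nx hn]] := bg_iso bg x [seq act w x | w <- words m].
by exists n; split => // w wm; apply: hn; apply: map_f; exact: mem_words.
Qed.

Lemma slot_ex x i : {j | g j (g i x) = x}.
Proof. by apply: cid; exact: (bg_sym bg). Qed.

(** An edge is stored in two slots, one at each end; [rv x i] is the slot of the other end that
    leads back to [x]. *)
Definition rv x i := sval (slot_ex x i).

Lemma rvK x i : g (rv x i) (g i x) = x.
Proof. by rewrite /rv; case: slot_ex. Qed.

Lemma rv_uniq x i j : g j (g i x) = x -> j = rv x i.
Proof. by move=> h; apply: (bg_inj bg (x := g i x)); rewrite /= rvK. Qed.

Lemma rv_rv x i : rv (g i x) (rv x i) = i.
Proof. by symmetry; apply: rv_uniq; rewrite !rvK. Qed.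

Lemma g_neq x i : g i x <> x.
Proof. by move=> h; have [S hS] := bg_bip bg; have := hS x i; rewrite h; tauto. Qed.

Lemma bor_rv i j : bor (fun x => rv x i = j).
Proof.
apply: (@bor_ext _ _ (fun x => g j (g i x) = x)).
  by move=> x; split => [/rv_uniq|<-]; rewrite ?rvK.
by apply: bor_eq; [do 2!apply: bfun_g|]; exact: bfun_id.
Qed.

(** * Fractional solutions and their admissible changes *)

Section State.
Variable N : nat.
Implicit Type f : X -> 'I_d -> int.
Local Open Scope ring_scope.

Definition symf (A : Type) (f : X -> 'I_d -> A) := forall x i, f (g i x) (rv x i) = f x i.

Definition fractional f x i := (0 < f x i) && (f x i < N%:Z).

Definition adj f x y := exists i, g i x = y /\ fractional f x i.

(** [f / N] is a fractional [kap]-factor over [V]. Only the vertex sums are restricted to [V], so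
    that [f] remains a total Borel function while [V] shrinks. *)
Definition Sol (kap : nat) f (V : X -> Prop) :=
  [/\ forall i, dbor (f^~ i), symf f, forall x i, 0 <= f x i <= N%:Z
    & forall x, V x -> \sum_i f x i = (kap * N)%:Z].

(** Changes of at most one unit, on fractional edges only: by integrality both [f + D] and [f - D]
    stay between 0 and [N]. *)
Definition circ f (D : X -> 'I_d -> int) :=
  [/\ forall i, dbor (D^~ i), symf D, forall x i, D x i != 0 -> fractional f x i,
      forall x i, `|D x i| <= 1 & forall x, \sum_i D x i = 0].

Definition addf (f D : X -> 'I_d -> int) x i := f x i + D x i.
Definition oppf (D : X -> 'I_d -> int) x i := - D x i.

Lemma circN f D : circ f D -> circ f (oppf D).
Proof.
move=> [bD sD tD nD zD]; split.
- by move=> i; apply: (dbor_comp (fun n : int => - n)).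
- by move=> x i; rewrite /oppf sD.
- by move=> x i; rewrite oppr_eq0; exact: tD.
- by move=> x i; rewrite normrN.
- by move=> x; rewrite sumrN zD oppr0.
Qed.

Lemma T_addf f D x i : circ f D -> fractional (addf f D) x i -> fractional f x i.
Proof.
move=> [_ _ tD _ _]; rewrite /addf /fractional; have [->|/tD//] := eqVneq (D x i) 0.
by rewrite addr0.
Qed.

Lemma Sol_addf kap f D V : Sol kap f V -> circ f D -> Sol kap (addf f D) V.
Proof.
move=> [bf sf rf zf] [bD sD tD nD zD]; split.
- move=> i; apply: (dbor_comp (fun p : int * int => p.1 + p.2) (F := fun x => (f x i, D x i))).
  exact: dbor_pair.
- by move=> x i; rewrite /addf sf sD.
- move=> x i; rewrite /addf; have [->|Dn] := eqVneq (D x i) 0; first by rewrite addr0.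
  by have := tD x i Dn; have := nD x i; rewrite /fractional; lia.
- by move=> x Vx; rewrite big_split /= zD addr0 zf.
Qed.

Lemma T_sym f x i : symf f -> fractional f (g i x) (rv x i) = fractional f x i.
Proof. by move=> sf; rewrite /fractional sf. Qed.

Lemma adj_sym f x y : symf f -> adj f x y -> adj f y x.
Proof. by move=> sf [i [<- Ti]]; exists (rv x i); rewrite rvK T_sym. Qed.

Lemma dbor_slot f i h : (forall i, dbor (f^~ i)) -> bfun h -> dbor (fun x => f (h x) i).
Proof. by move=> bf bh; apply: (dbor_fun (F := f^~ i)). Qed.

Lemma bor_T f i h : (forall i, dbor (f^~ i)) -> bfun h -> bor (fun x => fractional f (h x) i).
Proof.
move=> bf bh; apply: (dbor_pre (fun n : int => is_true ((0 < n) && (n < N%:Z)))).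
exact: (dbor_slot i bf bh).
Qed.

Lemma bor_adj f h h' : (forall i, dbor (f^~ i)) -> bfun h -> bfun h' ->
  bor (fun x => adj f (h x) (h' x)).
Proof.
move=> bf bh bh'; apply: bor_ex => i; apply: bor_and.
  by apply: bor_eq => //; exact: bfun_g.
exact: bor_T.
Qed.

End State.
End Words.

(** * Cycles *)

Section Cycles.
Local Open Scope ring_scope.
Variables (disp : measure_display) (X : measurableType disp) (d : nat).
Variables (g : 'I_d -> X -> X) (U : nat -> set X) (lt : X -> X -> Prop).
Hypothesis bg : bgraph g U lt.
Variable N : nat.
Implicit Types (x y z u v : X) (w : seq 'I_d) (i j : 'I_d) (p : seq X).
Implicit Type f : X -> 'I_d -> int.

Let nx (l k : nat) : nat := if k.+1 == l then 0%N else k.+1.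
Let pv (l k : nat) : nat := if k == 0%N then l.-1 else k.-1.

Let nxpv l k : (2 < l)%N -> (k < l)%N ->
  [/\ (nx l k < l)%N, (pv l k < l)%N, nx l (pv l k) = k, pv l (nx l k) = k & nx l k <> pv l k].
Proof.
move=> l2 kl; have e : nx l k = (if k.+1 == l then 0%N else k.+1) by [].
have e' : pv l k = (if k == 0%N then l.-1 else k.-1) by [].
move: e e'; move: (nx l k) (pv l k) => a b; rewrite /nx /pv.
case: (k.+1 =P l) => [kl'|kl'] ->; case: (k =P 0%N) => [k0|k0] ->; split; try lia;
  do ?[case: eqP => //]; lia.
Qed.

(** Length at least 3, since a list of two vertices would run through one edge back and forth. *)
Definition cyc f p := [/\ (2 < size p)%N, uniq p &
  forall k, (k < size p)%N -> adj g N f (nth point p k) (nth point p (nx (size p) k))].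

(** The edge from position [k] to its successor gets [(-1) ^+ k]. Seen from position [k], the edge
    to the predecessor has the opposite sign. *)
Definition delta p u i : int :=
  if u \in p then
    if g i u == nth point p (nx (size p) (index u p)) then (-1) ^+ index u p
    else if g i u == nth point p (pv (size p) (index u p)) then - (-1) ^+ index u p
    else 0
  else 0.

(** The part of the bipartition that contains position [k] is determined by the parity of [k]. *)
Lemma cyc_even f p : cyc f p -> ~~ odd (size p).
Proof.
move=> [l2 _ ap]; have [S hS] := bg_bip bg.
have alt k : (k < size p)%N -> S (nth point p k) <-> (if odd k then ~ S (nth point p 0%N) else S (nth point p 0%N)).
  elim: k => [//|k IH] kl; have := ap k (ltnW kl); rewrite /nx ltn_eqF // => -[i [<- _]].
  have := hS (nth point p k) i; have := IH (ltnW kl); rewrite /=.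
  by case: (odd k) => /=; have := EM (S (g i (nth point p k))); have := EM (S (nth point p 0%N)); tauto.
apply/negP => ol; have l0 : ((size p).-1 < size p)%N by lia.
have := ap _ l0; rewrite /nx prednK ?eqxx; last by lia.
case=> i [e _]; have := hS (nth point p (size p).-1) i; rewrite e; have := alt _ l0.
have -> : odd (size p).-1 = false by apply/negbTE; lia.
by have := EM (S (nth point p 0%N)); tauto.
Qed.

Lemma delta_sum f p u : symf bg f -> cyc f p -> \sum_i delta p u i = 0.
Proof.
move=> sf [l2 up ap]; have [pu|/negbTE npu] := boolP (u \in p); last first.
  by rewrite big1 // => i _; rewrite /delta npu.
rewrite /delta; under eq_bigr do rewrite pu.
have kl : (index u p < size p)%N by rewrite index_mem.
set k := index u p in kl *; have [nl pl np pn ne] := nxpv l2 kl.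
have [i1 [e1 _]] : adj g N f u (nth point p (nx (size p) k)).
  by have := ap _ kl; rewrite nth_index.
have [i2 [e2 _]] : adj g N f u (nth point p (pv (size p) k)).
  by apply: (adj_sym sf); have := ap _ pl; rewrite np nth_index.
have ne12 : i1 != i2.
  apply/eqP => e; apply: ne; apply/eqP; rewrite -(nth_uniq point _ _ up) //.
  by rewrite -e1 -e2 e.
have ne21 : i2 != i1 by rewrite eq_sym.
rewrite (bigD1 i1) //= e1 eqxx (bigD1 i2) //= e2 eqxx.
have -> : (nth point p (pv (size p) k) == nth point p (nx (size p) k)) = false.
  by rewrite nth_uniq // eq_sym; apply/eqP.
rewrite big1 ?addr0 ?subrr //.
move=> i /andP[ii1 ii2]; rewrite -e1 -e2 !(inj_eq (bg_inj bg (x := u))).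
by rewrite (negbTE ii1) (negbTE ii2).
Qed.

Lemma delta_T f p u i : symf bg f -> cyc f p -> delta p u i != 0 -> fractional N f u i.
Proof.
move=> sf [l2 up ap]; rewrite /delta; case: ifP => [pu|_]; last by rewrite eqxx.
have kl : (index u p < size p)%N by rewrite index_mem.
have [nl pl np pn ne] := nxpv l2 kl.
case: (g i u =P _) => [e _|_].
  have := ap _ kl; rewrite nth_index // -e => -[j [ej]].
  by rewrite (bg_inj bg ej).
case: (g i u =P _) => [e _|_]; last by rewrite eqxx.
have := adj_sym sf (ap _ pl); rewrite np nth_index // -e => -[j [ej]].
by rewrite (bg_inj bg ej).
Qed.

Lemma delta_le1 p u i : `|delta p u i| <= 1.
Proof.
rewrite /delta; do ?case: ifP => _; rewrite ?normrN ?normr0 //.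
all: by rewrite normrX normrN normr1 expr1n.
Qed.

Lemma delta_sym f p : cyc f p -> symf bg (delta p).
Proof.
move=> cp u i; have [l2 up ap] := cp; have ev := cyc_even cp.
(* At the closing edge, from the last position to position 0, the two signs agree because the length
   is even. *)
have key a c : a \in p -> nth point p (nx (size p) (index a p)) = c ->
    [/\ c \in p, index c p = nx (size p) (index a p) & (-1) ^+ index c p = - (-1) ^+ index a p :> int].
  move=> pa <-; have kl : (index a p < size p)%N by rewrite index_mem.
  have [nl _ _ _ _] := nxpv l2 kl; rewrite mem_nth // index_uniq //; split => //.
  rewrite /nx; case: eqP => [e|_]; last by rewrite exprS mulN1r.
  have -> : index a p = (size p).-1 by rewrite -e.
  rewrite -signr_odd -[in RHS]signr_odd; have -> : odd (size p).-1 by lia.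
  by rewrite /= expr1 opprK.
have sgn a c j : a \in p -> g j a = c -> nth point p (nx (size p) (index a p)) = c ->
    delta p c (rv bg a j) = (-1) ^+ index a p /\ delta p a j = (-1) ^+ index a p.
  move=> pa ec nc; have [pc ic sc] := key a c pa nc.
  have kl : (index a p < size p)%N by rewrite index_mem.
  have [nl pl np pn ne] := nxpv l2 kl; have [nl' pl' np' pn' ne'] := nxpv l2 nl.
  split; last by rewrite /delta pa ec nc eqxx.
  have eg : g (rv bg a j) c = a by rewrite -ec rvK.
  have ef : (a == nth point p (nx (size p) (nx (size p) (index a p)))) = false.
    rewrite -{1}(nth_index point pa) nth_uniq //.
    by apply/eqP => e; apply: ne'; rewrite -e pn.
  by rewrite /delta pc eg ic ef pn nth_index // eqxx -ic sc opprK.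
have [pu|npu] := boolP (u \in p); last first.
  have -> : delta p u i = 0 by rewrite /delta (negbTE npu).
  rewrite /delta; case: ifP => // pgu.
  have kl : (index (g i u) p < size p)%N by rewrite index_mem.
  have [nl pl _ _ _] := nxpv l2 kl.
  rewrite rvK; case: eqP => [e|_]; first by rewrite e mem_nth in npu.
  by case: eqP => [e|_] //; rewrite e mem_nth in npu.
have kl : (index u p < size p)%N by rewrite index_mem.
have [nl pl np pn ne] := nxpv l2 kl.
have [e1|n1] := eqVneq (nth point p (nx (size p) (index u p))) (g i u).
  by have [-> ->] := sgn u (g i u) i pu erefl e1.
have [e2|n2] := eqVneq (nth point p (pv (size p) (index u p))) (g i u).
  have pc : g i u \in p by rewrite -e2 mem_nth.
  have ic : index (g i u) p = pv (size p) (index u p) by rewrite -e2 index_uniq.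
  have := sgn (g i u) u (rv bg u i) pc (rvK bg u i).
  rewrite ic np nth_index // => /(_ erefl)[h1 h2].
  by rewrite h2 -h1 rv_rv.
have -> : delta p u i = 0.
  by rewrite /delta pu eq_sym (negbTE n1) eq_sym (negbTE n2).
rewrite /delta; case: ifP => // pc; rewrite rvK.
have kl' : (index (g i u) p < size p)%N by rewrite index_mem.
have [nl' pl' np' pn' ne'] := nxpv l2 kl'.
case: eqP => [e|_].
  have : index u p = nx (size p) (index (g i u) p) by rewrite {1}e index_uniq.
  by move=> e'; rewrite e' pn' nth_index ?eqxx // in n2.
case: eqP => [e|_] //.
have : index u p = pv (size p) (index (g i u) p) by rewrite {1}e index_uniq.
by move=> e'; rewrite e' np' nth_index ?eqxx // in n1.
Qed.

Definition walk x w := mkseq (fun k => act g (take k w) x) (size w).+1.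

Lemma nth_walk x w k : (k <= size w)%N -> nth point (walk x w) k = act g (take k w) x.
Proof. by move=> kw; rewrite nth_mkseq. Qed.

Lemma size_walk x w : size (walk x w) = (size w).+1.
Proof. exact: size_mkseq. Qed.

Lemma mem_walk x w u : u \in walk x w -> exists w', (size w' <= size w)%N /\ u = act g w' x.
Proof.
move=> /mapP[k]; rewrite mem_iota add0n /= ltnS => kw ->.
by exists (take k w); rewrite size_take_min geq_minr.
Qed.

Lemma walk_of (p : seq X) f : (0 < size p)%N ->
  (forall k, (k.+1 < size p)%N -> adj g N f (nth point p k) (nth point p k.+1)) ->
  exists w, walk (nth point p 0%N) w = p.
Proof.
move=> p0 ap; have /choice[c hc] : forall k, exists oi : option 'I_d, (k.+1 < size p)%N ->
   exists2 i, oi = Some i & g i (nth point p k) = nth point p k.+1.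
  move=> k.
  have [kp|kp] := boolP (k.+1 < size p)%N; last by exists None.
  by have [i [e _]] := ap k kp; exists (Some i) => _; exists i.
pose w := pmap c (iota 0 (size p).-1).
have sw : forall m, (m <= (size p).-1)%N -> size (pmap c (iota 0 m)) = m /\
    act g (pmap c (iota 0 m)) (nth point p 0%N) = nth point p m.
  elim=> [//|m IH] mp; have [|s1 s2] := IH; first exact: ltnW.
  have [|i e1 e2] := hc m; first by rewrite -ltn_predRL.
  by rewrite -addn1 iotaD pmap_cat /= e1 /= size_cat s1 /= addn1 act_cat s2 /= e2.
have [sw1 sw2] := sw _ (leqnn _).
exists w; apply: (@eq_from_nth _ point).
  by rewrite size_walk sw1 prednK.
move=> k; rewrite size_walk sw1 prednK // => kp.
have kp' : (k <= (size p).-1)%N by rewrite -ltnS prednK.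
rewrite nth_walk ?sw1 //; have [s1 <-] := sw k kp'.
congr (act g _ _); rewrite /w -[in iota 0 _](subnKC kp') iotaD pmap_cat.
by rewrite take_size_cat // s1.
Qed.

(** Isolation in [U n] up to distance [2 * size w] makes cycles with the same code [(w, n)] disjoint
    unless they start at the same vertex, so all of them can be pushed at once. *)
Definition start f w n x := [/\ cyc f (walk x w), U n x &
  forall w', (size w' <= 2 * size w)%N -> U n (act g w' x) -> act g w' x = x].

Lemma start_uniq f w n x x' u : start f w n x -> start f w n x' ->
  u \in walk x w -> u \in walk x' w -> x = x'.
Proof.
move=> [_ _ hx] [_ Ux' _] /mem_walk[w1 [s1 e1]] /mem_walk[w2 [s2 e2]].
have [w3 [s3 e3]] := act_rev bg w2 x'.
have e : act g (w1 ++ w3) x = x' by rewrite act_cat -e1 e2 e3.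
rewrite -e hx // ?e //.
by rewrite size_cat s3 mul2n -addnn leq_add.
Qed.

Definition push f (c : seq 'I_d * nat) u i : int :=
  if pselect (exists x, start f c.1 c.2 x /\ u \in walk x c.1) is left e
  then delta (walk (sval (cid e)) c.1) u i else 0.

Lemma pushE f c x u i : start f c.1 c.2 x -> u \in walk x c.1 ->
  push f c u i = delta (walk x c.1) u i.
Proof.
move=> sx ux; rewrite /push; case: pselect => [e|[]]; last by exists x.
by case: (cid e) => y [sy uy] /=; rewrite (start_uniq sx sy ux uy).
Qed.

Lemma push0 f c u i : (forall x, start f c.1 c.2 x -> u \in walk x c.1 -> False) ->
  push f c u i = 0.
Proof. by move=> h; rewrite /push; case: pselect => // e; case: (cid e) => x [sx ux]; case: (h x sx ux). Qed.

Lemma bor_uniq_walk w h : bfun h -> bor (fun x => uniq (walk (h x) w)).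
Proof.
move=> bh; apply: (@bor_ext _ _ (fun x => forall k k' : nat, (k <= size w)%N -> (k' <= size w)%N ->
   act g (take k w) (h x) = act g (take k' w) (h x) -> k = k')).
  move=> x; split => [hk|/(uniqP point) u k k' kw k'w].
    apply/(uniqP point) => k k'; rewrite !inE size_walk !ltnS => kw k'w.
    by rewrite !nth_walk // => /hk; exact.
  by rewrite -!nth_walk // => /u; rewrite !inE size_walk !ltnS; exact.
apply: bor_all => k; apply: bor_all => k'; do 2!(apply: bor_imp; first exact: bor_cst).
apply: bor_imp; last exact: bor_cst.
by apply: (bor_eq bg); exact: (bfun_act bg).
Qed.

Lemma bor_cyc f w h : (forall i, dbor (f^~ i)) -> bfun h ->
  bor (fun x => cyc f (walk (h x) w)).
Proof.
move=> bf bh; apply: (@bor_ext _ _ (fun x => ((2 < (size w).+1)%N /\ uniq (walk (h x) w)) /\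
   forall k : nat, (k < (size w).+1)%N ->
     adj g N f (act g (take k w) (h x)) (act g (take (nx (size w).+1 k) w) (h x)))).
  have nxl k : (k < (size w).+1)%N -> (nx (size w).+1 k <= size w)%N.
    by rewrite /nx; case: eqP => // ? ?; lia.
  move=> x; split => [[[l2 u] ap]|[l2 u ap]]; rewrite ?size_walk in l2 *; split => //.
    by rewrite size_walk.
    by move=> k; rewrite size_walk => kl; rewrite !nth_walk ?nxl //; exact: ap.
  by move=> k kl; have := ap k; rewrite size_walk !nth_walk ?nxl //; exact.
apply: bor_and; first by apply: bor_and; [exact: bor_cst|exact: bor_uniq_walk].
apply: bor_all => k; apply: bor_imp; first exact: bor_cst.
by apply: (bor_adj bg) => //; exact: (bfun_act bg).
Qed.

Lemma bor_start f w n h : (forall i, dbor (f^~ i)) -> bfun h ->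
  bor (fun x => start f w n (h x)).
Proof.
move=> bf bh; apply: (@bor_ext _ _ (fun x => (cyc f (walk (h x) w) /\ U n (h x)) /\
  forall w' : seq 'I_d, (size w' <= 2 * size w)%N ->
    U n (act g w' (h x)) -> act g w' (h x) = h x)).
  by move=> x; split => [[[? ?] ?]|[? ? ?]].
apply: bor_and; first by apply: bor_and; [exact: bor_cyc|exact: (bor_U bg)].
apply: bor_all => w'; apply: bor_imp; first exact: bor_cst.
by apply: bor_imp; [apply: (bor_U bg)|apply: (bor_eq bg)] => //; exact: (bfun_act bg).
Qed.

Lemma bor_mem_walk w h h' : bfun h -> bfun h' -> bor (fun x => h' x \in walk (h x) w).
Proof.
move=> bh bh'; apply: (@bor_ext _ _ (fun x => exists k : nat, (k <= size w)%N /\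
   h' x = act g (take k w) (h x))).
  move=> x; split => [[k [kw ->]]|/mapP[k]].
    by rewrite -nth_walk // mem_nth // size_walk.
  by rewrite mem_iota add0n /= ltnS => ? ?; exists k.
apply: bor_ex => k; apply: bor_and; first exact: bor_cst.
by apply: (bor_eq bg) => //; exact: (bfun_act bg).
Qed.

Lemma dbor_index_walk w h h' : bfun h -> bfun h' ->
  dbor (fun x => index (h' x) (walk (h x) w)).
Proof.
move=> bh bh' m; apply: (@bor_ext _ _ (fun x => (m <= (size w).+1)%N /\
   ((m < (size w).+1)%N -> h' x = act g (take m w) (h x)) /\
   (forall k : nat, (k < m)%N -> h' x <> act g (take k w) (h x)))).
  move=> x; split => [[ml [h1 h2]]|<-].
    have [mlt|mge] := ltnP m (size w).+1.
      have e := h1 mlt; apply/eqP; rewrite eqn_leq; apply/andP; split.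
        rewrite leqNgt; apply/negP => mi; have := before_find (a := pred1 (h' x)) point mi.
        by rewrite /= nth_walk // -e eqxx.
      rewrite leqNgt; apply/negP => im; apply: (h2 _ im).
      have iw : (index (h' x) (walk (h x) w) <= size w)%N by lia.
      rewrite -nth_walk // nth_index // -index_mem size_walk.
      exact: leq_trans im ml.
    have -> : m = size (walk (h x) w) by rewrite size_walk; lia.
    apply/eqP; rewrite eqn_leq index_size /= leqNgt; apply/negP => iw.
    have iw' : (index (h' x) (walk (h x) w) <= size w)%N by rewrite -ltnS -(size_walk (h x)).
    apply: (h2 (index (h' x) (walk (h x) w))); first by lia.
    by rewrite -nth_walk // nth_index // -index_mem.
  split; first by rewrite -(size_walk (h x)) index_size.
  split=> [il|k ki e].
    by rewrite -nth_walk // nth_index // -index_mem size_walk.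
  have kw : (k <= size w)%N.
    by have := leq_trans ki (index_size _ _); rewrite size_walk.
  have := before_find (a := pred1 (h' x)) point ki.
  by rewrite /= nth_walk // -e eqxx.
apply: bor_and; first exact: bor_cst; apply: bor_and.
  by apply: bor_imp; [exact: bor_cst|apply: (bor_eq bg) => //; exact: (bfun_act bg)].
apply: bor_all => k; apply: bor_imp; first exact: bor_cst.
by apply: bor_not; apply: (bor_eq bg) => //; exact: (bfun_act bg).
Qed.

Lemma dbor_delta w h h' i : bfun h -> bfun h' ->
  dbor (fun x => delta (walk (h x) w) (h' x) i).
Proof.
move=> bh bh' v; apply: (@bor_ext _ _ (fun x => exists k : nat,
   index (h' x) (walk (h x) w) = k /\
   (((k <= size w)%N /\
     (g i (h' x) = act g (take (nx (size w).+1 k) w) (h x) /\ (-1) ^+ k = v \/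
      g i (h' x) <> act g (take (nx (size w).+1 k) w) (h x) /\
      (g i (h' x) = act g (take (pv (size w).+1 k) w) (h x) /\ - (-1) ^+ k = v \/
       g i (h' x) <> act g (take (pv (size w).+1 k) w) (h x) /\ 0 = v)))
    \/ (size w < k)%N /\ 0 = v))).
  move=> x; rewrite /delta -index_mem size_walk ltnS.
  split=> [[k [-> hk]]|e].
    have [kw|kw] := leqP k (size w); last by case: hk => [[]|[_ //]]; lia.
    case: hk => [[_ hk]|[]]; last by lia.
    rewrite !nth_walk; [|by rewrite /pv; case: eqP; lia|by rewrite /nx; case: eqP; lia].
    by case: hk => [[-> <-]|[/eqP/negbTE -> [[-> <-]|[/eqP/negbTE -> <-]]]]; rewrite ?eqxx.
  exists (index (h' x) (walk (h x) w)); split => //.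
  move: e; case: leqP => [kw|kw] e; last by right.
  left; split => //; move: e.
  rewrite !nth_walk; [|by rewrite /pv; case: eqP; lia|by rewrite /nx; case: eqP; lia].
  by case: eqP => [? ?|? ]; [left|case: eqP => [? ?|? ?]; right; split => //; [left|right]].
apply: bor_ex => k; apply: bor_and; first exact: dbor_index_walk.
have be w' : bor (fun x => g i (h' x) = act g w' (h x)).
  by apply: (bor_eq bg); [exact: (bfun_g bg)|exact: (bfun_act bg)].
by do ?[exact: bor_cst | exact: be | apply: bor_and | apply: bor_or | apply: bor_not].
Qed.

Lemma dbor_push f c i : (forall i, dbor (f^~ i)) -> dbor ((push f c)^~ i).
Proof.
move=> bf v; apply: (@bor_ext _ _ (fun u =>
   (exists w, start f c.1 c.2 (act g w u) /\
      (u \in walk (act g w u) c.1 /\ delta (walk (act g w u) c.1) u i = v))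
   \/ ~ (exists w, start f c.1 c.2 (act g w u) /\ u \in walk (act g w u) c.1) /\ 0 = v)).
  move=> u; split => [[[w [sw [uw <-]]]|[h <-]]|<-].
  - exact: pushE.
  - apply: push0 => x sx ux; apply: h; have [w [_ e]] := mem_walk ux.
    by have [w' [_ e']] := act_rev bg w x; exists w'; have -> : act g w' u = x by rewrite e e'.
  - have [[x [sx ux]]|h] := pselect (exists x, start f c.1 c.2 x /\ u \in walk x c.1).
      left; have [w [_ e]] := mem_walk ux; have [w' [_ e']] := act_rev bg w x.
      have eu : act g w' u = x by rewrite e e'.
      by exists w'; rewrite eu (pushE _ sx ux).
    right; split => [[w hw]|]; first by apply: h; exists (act g w u).
    by rewrite push0 // => x sx ux; apply: h; exists x.
apply: bor_or; first apply: bor_ex => w.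
  apply: bor_and; first by apply: bor_start => //; apply: (bfun_act bg); exact: bfun_id.
  apply: bor_and; first by apply: bor_mem_walk; [apply: (bfun_act bg)|]; exact: bfun_id.
  by apply: dbor_delta; [apply: (bfun_act bg)|]; exact: bfun_id.
apply: bor_and; last exact: bor_cst.
apply: bor_not; apply: bor_ex => w.
apply: bor_and; first by apply: bor_start => //; apply: (bfun_act bg); exact: bfun_id.
by apply: bor_mem_walk; [apply: (bfun_act bg)|]; exact: bfun_id.
Qed.

Lemma push_circ f c : (forall i, dbor (f^~ i)) -> symf bg f -> circ bg N f (push f c).
Proof.
move=> bf sf; split.
- by move=> i; exact: dbor_push.
- move=> u i.
  have [[x [sx ux]]|h] := pselect (exists x, start f c.1 c.2 x /\
      (u \in walk x c.1 \/ g i u \in walk x c.1)); last first.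
    rewrite !push0 // => x sx ux; apply: h; exists x; split => //; [by left|by right].
  have [cx _ _] := sx; have sd := delta_sym cx.
  have other a j : a \in walk x c.1 -> push f c (g j a) (rv bg a j) = push f c a j.
    move=> ax; rewrite (pushE j sx ax); have [gx|gx] := boolP (g j a \in walk x c.1).
      by rewrite (pushE _ sx gx) sd.
    have d0 : delta (walk x c.1) a j = 0 by rewrite -sd /delta (negbTE gx).
    rewrite d0; have [[y [sy uy]]|h] := pselect (exists y, start f c.1 c.2 y /\ g j a \in walk y c.1).
      rewrite (pushE _ sy uy); have [cy _ _] := sy; rewrite (delta_sym cy).
      have [ay|/negbTE ay] := boolP (a \in walk y c.1); last by rewrite /delta ay.
      by rewrite (start_uniq sx sy ax ay) uy in gx.
    by apply: push0 => y sy uy; apply: h; exists y.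
  case: ux => [/other//|/other].
  by move=> /(_ (rv bg u i)); rewrite rvK rv_rv.
- move=> u i; rewrite /push; case: pselect => [e|]; last by rewrite eqxx.
  by case: (cid e) => x [[cx _ _] _] /=; exact: delta_T.
- move=> u i; rewrite /push; case: pselect => [e|_]; last by rewrite normr0.
  exact: delta_le1.
- move=> u; have [[x [sx ux]]|h] := pselect (exists x, start f c.1 c.2 x /\ u \in walk x c.1).
    under eq_bigr do rewrite (pushE _ sx ux).
    by have [cx _ _] := sx; exact: (delta_sum _ sf cx).
  by rewrite big1 // => i _; apply: push0 => x sx ux; apply: h; exists x.
Qed.

(** The code depends on the vertices of the cycle only, so it still serves after [f] has changed
    elsewhere. *)
Lemma push_complete f p : cyc f p -> exists c, forall f', cyc f' p ->
  forall u i, u \in p -> push f' c u i = delta p u i.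
Proof.
move=> [l2 up ap].
have [||w hw] := @walk_of p f; first by lia.
  by move=> k kp; have := ap k (ltnW kp); rewrite /nx ltn_eqF.
have [n [nx_ hn]] := isolate_ball bg (nth point p 0%N) (2 * size w).
exists (w, n) => f' cf u i pu; rewrite -hw; apply: pushE; rewrite /= ?hw //.
by split => //; rewrite hw.
Qed.

Definition oncyc f u i := exists p, cyc f p /\ delta p u i <> 0.

Lemma oncyc_push f u i : oncyc f u i -> exists c, push f c u i <> 0.
Proof.
move=> [p [cp h]]; have [c hc] := push_complete cp; exists c.
rewrite (hc f cp u i) //; apply: contrapT => /negP/negbTE up; apply: h.
by rewrite /delta up.
Qed.

Lemma push_oncyc f c u i : push f c u i <> 0 -> oncyc f u i.
Proof.
rewrite /push; case: pselect => // e; case: (cid e) => x [[cx _ _] ux] /= h.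
by exists (walk x c.1).
Qed.

Lemma bor_oncyc f h i : (forall i, dbor (f^~ i)) -> bfun h -> bor (fun x => oncyc f (h x) i).
Proof.
move=> bf bh; apply: (@bor_ext _ _ (fun x => exists w w', cyc f (walk (act g w (h x)) w') /\
    delta (walk (act g w (h x)) w') (h x) i <> 0)).
  move=> x; split => [[w [w' hw]]|[p [[l2 up ap] hp]]].
    by exists (walk (act g w (h x)) w').
  have [||w hw] := @walk_of p f; first by lia.
    by move=> k kp; have := ap k (ltnW kp); rewrite /nx ltn_eqF.
  have pu : h x \in p by apply: contrapT => /negP/negbTE pu; apply: hp; rewrite /delta pu.
  have := pu; rewrite -{1}hw => /mem_walk[w1 [_ e]].
  have [w2 [_ e2]] := act_rev bg w1 (nth point p 0%N).
  have ew : act g w2 (h x) = nth point p 0%N by rewrite e e2.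
  by exists w2, w; rewrite ew hw.
apply: bor_ex => w; apply: bor_ex => w'; apply: bor_and.
  by apply: bor_cyc => //; exact: (bfun_act bg).
by apply: bor_not; apply: dbor_delta => //; exact: (bfun_act bg).
Qed.

Definition acyclic_on f (V : X -> Prop) := forall p, (forall x, x \in p -> V x) -> ~ cyc f p.

Lemma cyc_mono f f' p : (forall x i, x \in p -> fractional N f x i -> fractional N f' x i) ->
  cyc f p -> cyc f' p.
Proof.
move=> h [l2 up ap]; split => // k kp; have [i [e Ti]] := ap k kp.
by exists i; split => //; apply: h => //; rewrite mem_nth.
Qed.

End Cycles.

(** * Baire category *)

Section Category.
Local Open Scope ring_scope.
Variables (R : realType) (disp : measure_display) (X : measurableType disp).
Variables (tau : topology_on X) (rho : X -> X -> R) (q : nat -> X).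
Hypothesis pm : polish_metric tau rho q.
Hypothesis cmp : compatible tau.
Let S := space tau.
Implicit Types (A B F O : set S).

Lemma nowhere_denseP F : nowhere_dense F <->
  forall O, open O -> O !=set0 -> exists O', [/\ open O', O' !=set0, O' `<=` O & O' `&` F = set0].
Proof.
split=> [ndF O oO [x Ox]|h].
  exists (O `&` ~` closure F); split.
  - by apply: openI => //; apply: closed_openC; exact: closed_closure.
  - apply: contrapT => h; have : (closure F)^° x.
      have sub : O `<=` closure F.
        by move=> y Oy; apply: contrapT => nc; apply: h; exists y.
      by apply: (interiorS sub); move: oO; rewrite openE; apply.
    by rewrite ndF.
  - by move=> y [].
  - by rewrite -subset0 => y [[_ nc] Fy]; apply: nc; exact: subset_closure.
rewrite /nowhere_dense; apply/seteqP; split => // x ix.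
have [|O' [oO' [y Oy] sO' dis]] := h ((closure F)^°) (open_interior _); first by exists x.
have cy : closure F y by apply: interior_subset; exact: sO'.
have [z [Fz Oz]] := cy O' (open_nbhs_nbhs (conj oO' Oy)).
by have : set0 z by rewrite -dis.
Qed.

Lemma meager_sub A B : A `<=` B -> meager B -> meager A.
Proof.
move=> AB [F ndF eB]; exists (fun n => F n `&` A).
  move=> n; apply/nowhere_denseP => O oO O0.
  have [W [oW W0 sW dis]] := (nowhere_denseP (F n)).1 (ndF n) O oO O0.
  exists W; split => //; rewrite -subset0 => y [ Oy [Fy _]].
  by have : set0 y by rewrite -dis.
rewrite -setI_bigcupl -eB; apply/seteqP; split => [x Ax|x []//].
by split => //; exact: AB.
Qed.

Lemma meager_bigcup (C : countType) (F : C -> set S) : (forall n, meager (F n)) ->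
  meager (\bigcup_n F n).
Proof.
move=> mF; have /choice[H hH] : forall n, exists H : nat -> set S,
    (forall k, nowhere_dense (H k)) /\ F n = \bigcup_k H k.
  by move=> n; have [H h1 h2] := mF n; exists H.
exists (fun k => if unpickle k is Some (n, m) then H n m else set0).
  move=> k; case: unpickle => [[n m]|]; first exact: (hH n).1.
  by apply/nowhere_denseP => O oO O0; exists O; split => //; rewrite setI0.
apply/seteqP; split => [x [n _]|x [k _]].
  by rewrite (hH n).2 => -[m _ Hx]; exists (pickle (n, m)) => //; rewrite pickleK.
case: unpickle => [[n m] Hx|//]; exists n => //.
by rewrite (hH n).2; exists m.
Qed.

Lemma meager_nd F : nowhere_dense F -> meager F.
Proof. by move=> h; exists (fun=> F) => //; rewrite bigcup_const. Qed.

Lemma meager0 : meager (set0 : set S).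
Proof.
by apply: meager_nd; apply/nowhere_denseP => O oO O0; exists O; split => //; rewrite setI0.
Qed.

Lemma meagerU A B : meager A -> meager B -> meager (A `|` B).
Proof.
move=> mA mB; apply: (@meager_sub _ (\bigcup_n (if n is 0%N then A else B))).
  by move=> x [|] ?; [exists 0%N|exists 1%N].
by apply: meager_bigcup => -[|].
Qed.

Lemma baire_category O : open O -> O !=set0 -> ~ meager O.
Proof.
move=> oO [x0 Ox0] [F ndF eO].
(* The next closed ball avoids [F n] and has at most half the radius, so the centres converge to a
   point outside all [F n]. *)
pose good (n : nat) (c c' : S * R) := [/\ 0 < c'.2, c'.2 <= c.2 / 2 &
  forall y, rho c'.1 y <= c'.2 -> rho c.1 y < c.2 /\ ~ F n y].
have step n (c : S * R) : exists c', 0 < c.2 -> good n c c'.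
  have [c0|c0] := pselect (0 < c.2); last by exists c.
  have [||O' [oO' [y Oy] sO' dis]] := (nowhere_denseP (F n)).1 (ndF n) [set y | rho c.1 y < c.2].
  - exact: (open_rball pm).
  - by exists c.1; rewrite /= (rhoxx pm).
  have [e e0 he] := (rho_openP pm O').1 oO' _ Oy.
  exists (y, Num.min (e / 2) (c.2 / 2)) => _; split => /=.
  - by rewrite lt_min !divr_gt0.
  - by rewrite ge_min lexx orbT.
  - move=> z; rewrite le_min => /andP[ze _].
    have Oz : O' z by apply: he; apply: le_lt_trans ze _; rewrite ltr_pdivrMr // ltr_pMr // ltr1n.
    split; first exact: sO'.
    by move=> Fz; have : set0 z by rewrite -dis.
have [e e0 he] := (rho_openP pm O).1 oO _ Ox0.
have [st hst] := choice (fun nc : nat * (S * R) => step nc.1 nc.2).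
pose c := fix c n := if n is n'.+1 then st (n', c n') else (x0, e).
have c0 n : 0 < (c n).2.
  by elim: n => [//|n IH]; have [] := hst (n, c n) IH.
have hc n : good n (c n) (c n.+1) by exact: (hst (n, c n) (c0 n)).
have rn n : (c n).2 <= e * (2^-1) ^+ n.
  elim: n => [|n IH]; first by rewrite expr0 mulr1.
  have [_ h _] := hc n; apply: le_trans h _.
  by rewrite exprSr mulrA ler_pM2r // invr_gt0.
have nest k n y : rho (c (n + k)%N).1 y < (c (n + k)%N).2 -> rho (c n).1 y < (c n).2.
  elim: k => [|k IH]; first by rewrite addn0.
  by rewrite addnS => h; apply: IH; have [_ _ h'] := hc (n + k)%N; case: (h' y (ltW h)).
have near n k : (n <= k)%N -> rho (c n).1 (c k).1 < (c n).2.
  by move=> /subnKC <-; apply: (nest (k - n)%N); rewrite (rhoxx pm).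
have [|l hl] := rho_complete pm (u := fun n => (c n).1).
  have r0 (e' : R) : 0 < e' -> exists n, (c n).2 < e'.
    move=> e'0; pose n := (Num.truncn (e / e')).+1; exists n.
    apply: le_lt_trans (rn n) _; rewrite exprVn ltr_pdivrMr ?exprn_gt0 // mulrC -ltr_pdivrMr //.
    apply: lt_le_trans (truncnS_gt (e / e')) _.
    by rewrite -natrX ler_nat ltnW // ltn_expl.
  by move=> e1 e10; have [n hn] := r0 e1 e10; exists n => i ni; apply: lt_trans (near _ _ ni) hn.
have lc n : rho (c n).1 l <= (c n).2.
  apply/ler_addgt0Pr => e' e'0; have [m hm] := hl e' e'0.
  apply: le_trans (rho_tri pm (c (maxn n m)).1 _ _) _; apply: lerD.
    by apply: ltW; apply: near; exact: leq_maxl.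
  by rewrite (rhoC pm) ltW // hm // leq_maxr.
have Ol : O l by apply: he; have [_ _ h] := hc 0%N; case: (h l (lc 1%N)).
move: Ol; rewrite eO => -[n _ Fl]; have [_ _ h] := hc n.
by case: (h l (lc n.+1)).
Qed.

Lemma borel_baire_property A : measurable (A : set X) ->
  exists O, [/\ open O, meager (A `\` O) & meager (O `\` A)].
Proof.
move=> /cmp; move: A; apply: smallest_sub; last first.
  by move=> O oO; exists O; rewrite setDv; split => //; exact: meager0.
split.
- by exists set0; rewrite setDv; split; [exact: open0| |]; exact: meager0.
(* The complement of [O] differs from its own interior by a nowhere dense set. *)
- move=> A [ O [oO m1 m2]]; exists ((~` O)^°); split; first exact: open_interior.
    apply: (@meager_sub _ ((O `\` A) `|` ((~` O) `\` (~` O)^°))).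
      move=> x [[_ nA] ni]; have [ Ox|nO] := pselect (O x); [by left|by right].
    apply: meagerU => //; apply: meager_nd; apply/nowhere_denseP => O1 oO1 O10.
    have [[y [ O1y Oy]]|h] := pselect (O1 `&` O !=set0).
      exists (O1 `&` O); split; [exact: openI|by exists y|by move=> ? []|].
      by rewrite -subset0 => z [[_ Oz] [nO _]].
    exists O1; split => //; rewrite -subset0 => z [ O1z [_ ni]]; apply: ni.
    have sub : O1 `<=` ~` O by move=> t O1t Ot; apply: h; exists t.
    by apply: (interiorS sub); move: oO1; rewrite openE; apply.
  apply: (meager_sub _ m1) => x [ix nA]; have nO := interior_subset ix.
  by split => //; apply: contrapT => nAx; apply: nA.
- move=> F hF; have /choice[ O hO] := hF.
  exists (\bigcup_n O n); split.
  + by apply: bigcup_open => n _; case: (hO n).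
  + apply: (@meager_sub _ (\bigcup_n (F n `\` O n))).
      by move=> x [[n _ Fx] nO]; exists n => //; split => // Ox; apply: nO; exists n.
    by apply: meager_bigcup => n; case: (hO n).
  + apply: (@meager_sub _ (\bigcup_n (O n `\` F n))).
      by move=> x [[n _ Fx] nO]; exists n => //; split => // Ox; apply: nO; exists n.
    by apply: meager_bigcup => n; case: (hO n).
Qed.

Lemma comeager_somewhere (C : countType) (P : C -> set S) O :
  (forall t, measurable (P t : set X)) -> (forall x, exists t, P t x) ->
  open O -> O !=set0 ->
  exists t V, [/\ open V, V !=set0, V `<=` O & meager (V `\` P t)].
Proof.
move=> mP cov oO O0; have /choice[H hH] := fun t => borel_baire_property (mP t).
have [t [y [Hy Oy]]] : exists t, H t `&` O !=set0.
  apply: contrapT => h; apply: (baire_category oO O0).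
  apply: (@meager_sub _ (\bigcup_t (P t `\` H t))).
    move=> x Ox; have [t Pt] := cov x; exists t => //; split => // Ht.
    by apply: h; exists t; exists x.
  by apply: meager_bigcup => t; case: (hH t).
have [oH _ mH] := hH t.
exists t, (H t `&` O); split; [exact: openI|by exists y|by move=> ? []|].
by apply: meager_sub mH => x [[Hx _] nP].
Qed.

(** For every pair of a requirement and a basic open set, in turn, the sequence is prolonged by a
    block that works on a comeager part of some smaller nonempty open set. For each requirement
    these open sets have a dense union, so one sequence serves all points outside a meager set
    although extensions are only known to exist point by point. *)
Lemma generic_sequence (C : countType) (c0 : C) (Q : countType) (P : Q -> seq C -> set X) :
  (forall r s, measurable (P r s)) -> (forall r s x, exists t, P r (s ++ t) x) ->
  exists a : nat -> C, @meager S (~` [set x | forall r, exists n, P r (mkseq a n) x]).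
Proof.
move=> mP cov; pose U := obase rho q.
pose good (rn : Q * nat) (s t : seq C) := U rn.2 !=set0 ->
  exists V : set S, [/\ open V, V !=set0, V `<=` U rn.2 & meager (V `\` P rn.1 (s ++ t))].
have ext (rns : (Q * nat) * seq C) : exists t, good rns.1 rns.2 t.
  case: rns => [[r n] s] /=; have [U0|U0] := pselect (U n !=set0); last by exists [::].
  have [t [V hV]] := comeager_somewhere (fun t => mP r (s ++ t)) (cov r s) (open_obase pm n) U0.
  by exists t => _; exists V.
have [F hF] := choice ext.
(* The extra [c0] makes the lengths grow even if the chosen extensions are empty, so the stages
   define an infinite sequence. *)
pose st := fix st k := if k is k'.+1 then
   st k' ++ (if unpickle k' is Some rn then F (rn, st k') else [::]) ++ [:: c0] else [::].
have sst k : (k <= size (st k))%N.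
  by elim: k => [//|k IH] /=; rewrite !size_cat /=; lia.
have pre k m : exists u, st (k + m)%N = st k ++ u.
  elim: m => [|m [u hu]]; first by exists [::]; rewrite addn0 cats0.
  by rewrite addnS /= hu -!catA; eexists.
pose a n := nth c0 (st n.+1) n.
have ast k n : (n < size (st k))%N -> a n = nth c0 (st k) n.
  move=> nk; rewrite /a; case: (leqP n.+1 k) => nk'.
    have [u e] := pre n.+1 (k - n.+1)%N; move: e; rewrite subnKC // => ->.
    by rewrite nth_cat sst.
  have [u e] := pre k (n.+1 - k)%N; move: e; rewrite subnKC; last exact: ltnW.
  by move=> ->; rewrite nth_cat nk.
have apre s u k : st k = s ++ u -> mkseq a (size s) = s.
  move=> e; apply: (@eq_from_nth _ c0); rewrite size_mkseq // => n ns.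
  rewrite nth_mkseq // (ast k); last by rewrite e size_cat ltn_addr.
  by rewrite e nth_cat ns.
exists a; apply: (@meager_sub _ (\bigcup_r ~` [set x | exists n, P r (mkseq a n) x])).
  move=> x h; apply: contrapT => h'; apply: h => r; apply: contrapT => nP.
  by apply: h'; exists r.
apply: meager_bigcup => r.
have stage n : exists V : set S, U n !=set0 ->
    [/\ open V, V !=set0, V `<=` U n & meager (V `\` [set x | exists n, P r (mkseq a n) x])].
  have [U0|U0] := pselect (U n !=set0); last by exists set0.
  pose k := pickle (r, n); have [V [oV V0 sV mV]] := hF ((r, n), st k) U0.
  exists V => _; split => //; apply: meager_sub mV => x [Vx nP]; split => //.
  move=> /= Px; apply: nP; exists (size (st k ++ F ((r, n), st k))).
  by rewrite (apre _ [:: c0] k.+1) //= /k pickleK catA.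
have [V hV] := choice stage.
pose W := \bigcup_(n in [set n | U n !=set0]) V n.
apply: (@meager_sub _ (~` W `|` \bigcup_n ((V n `\` [set x | exists n, P r (mkseq a n) x]) `&` [set x | U n !=set0]))).
  move=> x nP; have [[n U0 Vx]|] := pselect (W x); [right|by left].
  by exists n.
apply: meagerU.
  apply: meager_nd; apply/nowhere_denseP => O oO [x Ox].
  have [n [Ux sU]] := obase_open pm oO Ox.
  have U0 : U n !=set0 by exists x.
  have [oV V0 sV _] := hV n U0; exists (V n); split => //.
    exact: subset_trans sU.
  by rewrite -subset0 => y [Vy]; apply; exists n.
apply: meager_bigcup => n; have [U0|U0] := pselect (U n !=set0).
  by have [_ _ _ m] := hV n U0; apply: meager_sub m => x [].
by apply: meager_sub meager0 => x [].
Qed.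

End Category.

(** * Limits of sequences of pushes *)

Section Limits.
Local Open Scope ring_scope.
Variables (disp : measure_display) (X : measurableType disp) (d : nat).
Variables (g : 'I_d -> X -> X) (U : nat -> set X) (lt : X -> X -> Prop).
Hypothesis bg : bgraph g U lt.
Variable N : nat.
Implicit Types (x y z u v : X) (w : seq 'I_d) (i j : 'I_d) (p : seq X).
Implicit Type f : X -> 'I_d -> int.

Lemma cyc_dart f p : cyc g N f p -> exists u i, u \in p /\ delta g p u i <> 0.
Proof.
move=> cp; have [l2 up ap] := cp; have l0 : (0 < size p)%N by lia.
have [i [e _]] := ap 0%N l0; exists (nth point p 0%N), i; rewrite mem_nth //; split => //.
rewrite /delta mem_nth // index_uniq //.
by move/eqP: e => ->; rewrite expr0.
Qed.

Lemma oncyc_sym f u i : oncyc g N f u i -> oncyc g N f (g i u) (rv bg u i).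
Proof. by move=> [p [cp h]]; exists p; rewrite (delta_sym bg cp). Qed.

(* [h n] is eventually constant on a dart once the dart is settled. *)
Lemma settled_limit kap (h : nat -> X -> 'I_d -> int) (st : nat -> X -> 'I_d -> Prop)
    (V : X -> Prop) :
  (forall n, Sol bg N kap (h n) V) ->
  (forall n i, bor (fun x => st n x i)) ->
  (forall n x i, st n x i <-> st n (g i x) (rv bg x i)) ->
  (forall n x i, st n x i -> st n.+1 x i /\ h n.+1 x i = h n x i) ->
  (forall n x i, st n x i -> ~ (exists p, [/\ cyc g N (h n) p, delta g p x i <> 0
     & forall y j, y \in p -> st n y j])) ->
  bor V -> inv g V ->
  let V' := fun x => V x /\ forall w i, exists n, st n (act g w x) i in
  exists f', [/\ bor V', inv g V', Sol bg N kap f' V' & acyclic_on g N f' V'].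
Proof.
move=> sh bst sst mst nst bV iV V'.
pose ev x i := exists n, st n x i.
have ev_ge n m x i : (n <= m)%N -> st n x i -> st m x i /\ h m x i = h n x i.
  move=> /subnKC <-; elim: (m - n)%N => [|k IH] s; first by rewrite addn0.
  have [s' e] := IH s; rewrite addnS; have [s2 e2] := mst _ _ _ s'.
  by rewrite e2 e.
(* Darts that never settle keep the value of [h 0], which preserves symmetry and bounds off [V']. *)
pose f' x i := if pselect (ev x i) is left e then h (sval (cid e)) x i else h 0%N x i.
have f'E n x i : st n x i -> f' x i = h n x i.
  move=> s; rewrite /f'; case: pselect => [e|[]]; last by exists n.
  case: (cid e) => m sm /=; have [_ <-] := ev_ge _ _ _ _ (leq_maxl m n) sm.
  by have [_ <-] := ev_ge _ _ _ _ (leq_maxr m n) s.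
have f'0 x i : ~ ev x i -> f' x i = h 0%N x i by rewrite /f'; case: pselect.
exists f'; split.
- apply: bor_and => //; apply: bor_all => w; apply: bor_all => i; apply: bor_ex => n.
  by apply: (bor_comp (P := fun x => st n x i)) => //; apply: (bfun_act bg); exact: bfun_id.
- by apply: inv_and => //; apply: (inv_forall bg (fun x => forall i, exists n, st n x i)).
- split.
  + move=> i v; apply: (@bor_ext _ _ (fun x => (exists n, st n x i /\ h n x i = v) \/
       ~ (exists n, st n x i) /\ h 0%N x i = v)).
      move=> x; split => [[[n [s <-]]|[/f'0 e <-]]|<-]; [exact: f'E|exact: e|].
      have [[n s]|ne] := pselect (ev x i); last by right; rewrite f'0.
      by left; exists n; rewrite (f'E n).
    have bh n : bor (fun x => h n x i = v) by have [+ _ _ _] := sh n; apply.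
    apply: bor_or; first by apply: bor_ex => n; apply: bor_and.
    by apply: bor_and => //; apply: bor_not; apply: bor_ex => n.
  + move=> x i; have [[n s]|ne] := pselect (ev x i).
      rewrite (f'E n x i s) (f'E n (g i x)); last exact: (sst n x i).1 s.
      by have [_ + _ _] := sh n; apply.
    rewrite !f'0 //; first by have [_ + _ _] := sh 0%N; apply.
    by move=> [n /(sst n x i).2 s]; apply: ne; exists n.
  + move=> x i; have [[n s]|ne] := pselect (ev x i).
      by rewrite (f'E n) //; have [_ _ + _] := sh n; apply.
    by rewrite f'0 //; have [_ _ + _] := sh 0%N; apply.
  + move=> x [Vx /(_ [::]) /choice[m hm]].
    pose n := (\max_i m i)%N; have [_ _ _ /(_ x Vx) <-] := sh n.
    apply: eq_bigr => i _; apply: f'E.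
    by have [] := ev_ge (m i) n x i (leq_bigmax i) (hm i).
(* A cycle has finitely many darts, all settled at a common stage [n], where it would be a cycle of
   [h n]. *)
- move=> p pV cp; have cp' := cp; have [u [i [up di]]] := cyc_dart cp'.
  have /choice[m hm] : forall yj : X * 'I_d, exists n, yj.1 \in p -> st n yj.1 yj.2.
    move=> [y j]; have [yp|yp] := boolP (y \in p); last by exists 0%N.
    by have [_ /(_ [::] j)[n s]] := pV y yp; exists n.
  pose n := (\max_(y <- p) \max_j m (y, j))%N.
  have sn y j : y \in p -> st n y j.
    move=> yp; have := hm (y, j) yp => /= s.
    have mn : (m (y, j) <= n)%N.
      apply: (@leq_trans (\max_j m (y, j))%N); first exact: (leq_bigmax (F := fun j => m (y, j)) j).
      rewrite /n (big_rem y) //=.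
      exact: leq_maxl.
    by have [] := ev_ge _ _ _ _ mn s.
  apply: (nst n u i (sn u i up)); exists p; split => //.
  by apply: cyc_mono cp => x j xp; rewrite /fractional (f'E n) //; exact: sn.
Qed.

End Limits.

(** * Removing the cycles on a comeager set *)

Section Pass1Baire.
Local Open Scope ring_scope.
Variables (R : realType) (disp : measure_display) (X : measurableType disp).
Variables (tau : topology_on X) (rho : X -> X -> R) (q : nat -> X).
Hypothesis pm : polish_metric tau rho q.
Hypothesis cmp : compatible tau.
Variables (d : nat) (g : 'I_d -> X -> X) (U : nat -> set X) (lt : X -> X -> Prop).
Hypothesis bg : bgraph g U lt.
Variable N : nat.
Implicit Type f : X -> 'I_d -> int.

Definition comeager (V : X -> Prop) := @meager (space tau) (~` [set x | V x]).

Let step f (c : (seq 'I_d * nat) * bool) :=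
  addf f (if c.2 then push g U N f c.1 else oppf (push g U N f c.1)).

Let step_circ kap f V c : Sol bg N kap f V ->
  circ bg N f (if c.2 then push g U N f c.1 else oppf (push g U N f c.1)).
Proof.
by move=> [bf sf _ _]; have h := push_circ N c.1 bf sf; case: c.2 => //; exact: circN.
Qed.

Let Sol_foldl kap f V s : Sol bg N kap f V -> Sol bg N kap (foldl step f s) V.
Proof.
by elim: s f => [//|c s IH] f sf /=; apply: IH; apply: Sol_addf => //; exact: step_circ sf.
Qed.

(** A push never creates a fractional edge, hence no new cycle. *)
Let settle_step kap f V c x i : Sol bg N kap f V -> ~ oncyc g N f x i ->
  ~ oncyc g N (step f c) x i /\ step f c x i = f x i.
Proof.
move=> sf no; split.
  move=> [p [cp h]]; apply: no; exists p; split => //; apply: cyc_mono cp => y j _.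
  by apply: (T_addf (step_circ c sf)).
have p0 : push g U N f c.1 x i = 0 by apply: contrapT => /push_oncyc.
by rewrite /step /addf; case: c.2; rewrite ?/oppf p0 ?oppr0 addr0.
Qed.

(** A cycle through the dart is pushed with the sign that lowers its value; the value is a
    nonnegative integer, so this ends. *)
Let settle_ex kap f V x i : Sol bg N kap f V -> exists t, ~ oncyc g N (foldl step f t) x i.
Proof.
have [m] := ubnP `|f x i|%N; elim: m f => // m IH f fm sf.
have [on|no] := pselect (oncyc g N f x i); last by exists [::].
have [c hc] := oncyc_push bg on.
have := step_circ (c, true) sf => -[_ _ _ /(_ x i) /= l1 _].
have [_ _ /(_ x i) /= f0 _] := sf.
pose b := push g U N f c x i < 0.
have e : step f (c, b) x i = f x i - 1.
  by rewrite /step /addf /oppf /b /=; case: ifP; lia.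
have [||t ht] := IH (step f (c, b)).
- have [_ _ /(_ x i) + _] := Sol_foldl [:: (c, b)] sf; rewrite /= e; lia.
- exact: (Sol_foldl [:: (c, b)] sf).
- by exists ((c, b) :: t).
Qed.

Lemma pass1_baire kap f V : bor V -> inv g V -> comeager V -> Sol bg N kap f V ->
  exists V' f', [/\ bor V', inv g V', comeager V', (forall x, V' x -> V x)
    & Sol bg N kap f' V' /\ acyclic_on g N f' V'].
Proof.
move=> bV iV cV sf.
pose P (r : seq 'I_d * 'I_d) s := [set x | ~ oncyc g N (foldl step f s) (act g r.1 x) r.2].
have [||a ha] := generic_sequence pm cmp (([::], 0%N), true) (P := P).
- move=> [w i] s; apply: (@bor_not _ _ (fun x => oncyc g N (foldl step f s) (act g w x) i)).
  apply: (bor_oncyc bg); first by have [] := Sol_foldl s sf.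
  by apply: (bfun_act bg); exact: bfun_id.
- move=> [w i] s x; have [t ht] := settle_ex (act g w x) i (Sol_foldl s sf).
  by exists t; rewrite /P /= foldl_cat.
pose h n := foldl step f (mkseq a n).
have hS n : h n.+1 = step (h n) (a n) by rewrite /h mkseqS -cats1 foldl_cat.
have sh n : Sol bg N kap (h n) V by exact: Sol_foldl.
have [||||||f' [h1 h2 h3 h4]] := @settled_limit _ _ _ _ _ _ bg N kap h
  (fun n x i => ~ oncyc g N (h n) x i) V sh.
- move=> n i; apply: bor_not; apply: (bor_oncyc bg); last exact: bfun_id.
  by have [] := sh n.
- move=> n x i; split => no on; apply: no; last exact: (oncyc_sym bg).
  by have := oncyc_sym bg on; rewrite rvK rv_rv.
- by move=> n x i; rewrite hS; exact: settle_step (sh n).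
- by move=> n x i no [p [cp hp _]]; apply: no; exists p.
- exact: bV.
- exact: iV.
eexists; exists f'; split; [exact: h1|exact: h2| |by move=> x []|by split].
apply: meager_sub (meagerU cV ha) => x nV.
apply: contrapT => /not_orP[/contrapT Vx /contrapT hx]; apply: nV.
by split => // w i; have [n hn] := hx (w, i); exists n.
Qed.

End Pass1Baire.

(** * Measure *)

Section Saturated.
Local Open Scope ring_scope.
Variables (R : realType) (disp : measure_display) (X : measurableType disp).
Variable mu : probability X R.

Definition pfm (h : X -> X) (bh : bfun h) (A : set X) : \bar R := mu (h @^-1` A).

Let pfm0 h (bh : bfun h) : pfm bh set0 = 0%E.
Proof. by rewrite /pfm preimage_set0 measure0. Qed.

Let pfm_ge0 h (bh : bfun h) A : (0 <= pfm bh A)%E.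
Proof. exact: measure_ge0. Qed.

Let pfm_add h (bh : bfun h) : semi_sigma_additive (pfm bh).
Proof.
move=> F mF tF mUF; rewrite /pfm preimage_bigcup.
apply: measure_semi_sigma_additive.
- by move=> n; rewrite -[X in measurable X]setTI; exact: bh.
- apply/trivIsetP => /= i j _ _ ij; rewrite -preimage_setI.
  by move/trivIsetP : tF => /(_ _ _ _ _ ij) ->//; rewrite preimage_set0.
- by rewrite -preimage_bigcup -[X in measurable X]setTI; exact: bh.
Qed.

HB.instance Definition _ h (bh : bfun h) := isMeasure.Build _ _ _ (pfm bh)
  (@pfm0 h bh) (@pfm_ge0 h bh) (@pfm_add h bh).

Variables (d : nat) (g : 'I_d -> X -> X) (U : nat -> set X) (lt : X -> X -> Prop).
Hypothesis bg : bgraph g U lt.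

Let half_ge0 n : 0 <= 1 / (2 ^ (n + 1))%:R :> R.
Proof. by rewrite divr_ge0. Qed.

(* The measure [\sum_n 2^-(n+1) (act w_n)_* mu] over an enumeration of the words:
   its null sets are those whose saturation is [mu]-null. *)
Lemma saturated_measure : exists nu : {measure set X -> \bar R}, (nu setT < +oo)%E /\
  forall A, measurable A -> nu A = 0%E -> mu [set x | exists w, A (act g w x)] = 0%E.
Proof.
pose wd n : seq 'I_d := odflt [::] (unpickle n).
have bw n : bfun (act g (wd n)) by apply: (bfun_act bg); exact: bfun_id.
pose m n : {measure set X -> \bar R} := mscale (NngNum (half_ge0 n)) (pfm (bw n)).
have mE n A : m n A = ((1 / (2 ^ (n + 1))%:R)%:E * mu (act g (wd n) @^-1` A))%E by [].
exists (mseries m 0); split.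
  have e : mseries m 0 setT = limn (eseries (fun k => (1 / (2 ^ (k + 1))%:R)%:E : \bar R)).
    rewrite /mseries; apply: congr_lim; apply/funext => n; apply: eq_bigr => k _.
    by rewrite mE preimage_setT probability_setT mule1.
  have : (mseries m 0 setT < +oo)%E.
    by rewrite e (cvg_lim _ (@cvg_geometric_eseries_half R 1 0)) // expr0 divr1 ltry.
  exact.
move=> A mA nuA.
have mw n : measurable (act g (wd n) @^-1` A) by rewrite -[X in measurable X]setTI; exact (bw n measurableT A mA).
have nul n : mu (act g (wd n) @^-1` A) = 0%E.
  have m0 k : (0 <= m k A)%E by exact: measure_ge0.
  have : (m n A <= 0)%E.
    rewrite -nuA; apply: (@le_trans _ _ (\sum_(0 <= k < n.+1) m k A)%E).
      by rewrite big_nat_recr //= leeDr // sume_ge0.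
    exact: nneseries_lim_ge.
  rewrite mE => h; apply/eqP; rewrite eq_le measure_ge0 andbT.
  by move: h; rewrite pmule_rle0 // lte_fin divr_gt0 // ltr0n expn_gt0.
have -> : [set x | exists w, A (act g w x)] = \bigcup_n (act g (wd n) @^-1` A).
  apply/seteqP; split => x [w].
    by move=> Aw; exists (pickle w) => //; rewrite /preimage /= /wd pickleK.
  by move=> _ Aw; exists (wd w).
apply: measure_negligible; first exact: bigcupT_measurable.
by apply: negligible_bigcup => n; apply/(negligibleP mu (mw n)); exact: nul.
Qed.

End Saturated.

(** * Integrals of bounded functions *)

Section Integrals.
Local Open Scope ring_scope.
Variables (R : realType) (disp : measure_display) (X : measurableType disp).
Variable nu : {measure set X -> \bar R}.
Hypothesis nuT : (nu setT < +oo)%E.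

Definition bm (h : X -> R) := measurable_fun [set: X] h /\ exists M, forall x, `|h x| <= M.

Definition II (h : X -> R) : R := \int[nu]_(x in setT) h x.

Lemma bm_int h : bm h -> nu.-integrable setT (EFin \o h).
Proof.
move=> [mh [M hM]]; apply: measurable_bounded_integrable => //.
exists M; split; first exact: num_real.
by move=> t Mt x _; apply: le_trans (hM x) (ltW Mt).
Qed.

Lemma bm_dbor (T : countType) (F : X -> T) (phi : T -> R) M : dbor F ->
  (forall x, `|phi (F x)| <= M) -> bm (fun x => phi (F x)).
Proof.
move=> bF hM; split; last by exists M.
by move=> _ B mB; rewrite setTI; exact: (dbor_pre (fun t => B (phi t)) bF).
Qed.

Lemma bmD h h' : bm h -> bm h' -> bm (fun x => h x + h' x).
Proof.
move=> [mh [M hM]] [mh' [M' hM']]; split; first exact: measurable_funD.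
by exists (M + M') => x; apply: le_trans (ler_normD _ _) _; exact: lerD.
Qed.

Lemma bmM h h' : bm h -> bm h' -> bm (fun x => h x * h' x).
Proof.
move=> [mh [M hM]] [mh' [M' hM']]; split; first exact: measurable_funM.
by exists (M * M') => x; rewrite normrM ler_pM.
Qed.

Lemma bm_cst c : bm (fun=> c).
Proof. by split; [exact: measurable_cst|exists `|c|]. Qed.

Lemma IID h h' : bm h -> bm h' -> II (fun x => h x + h' x) = II h + II h'.
Proof. by move=> /bm_int ? /bm_int ?; apply: RintegralD. Qed.

Lemma IIZ c h : bm h -> II (fun x => c * h x) = c * II h.
Proof. by move=> /bm_int ?; apply: RintegralZl. Qed.

Lemma II_le h h' : bm h -> bm h' -> (forall x, h x <= h' x) -> II h <= II h'.
Proof. by move=> /bm_int ? /bm_int ? hh; apply: le_Rintegral. Qed.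

Lemma II_ge0 h : (forall x, 0 <= h x) -> 0 <= II h.
Proof. by move=> hh; apply: Rintegral_ge0. Qed.

Lemma eq_II h h' : (forall x, h x = h' x) -> II h = II h'.
Proof. by move=> e; congr II; apply/funext. Qed.

Lemma II_markov A c h : measurable A -> bm h -> (forall x, 0 <= h x) -> 0 <= c ->
  (forall x, A x -> c <= h x) -> (c%:E * nu A <= (II h)%:E)%E.
Proof.
move=> mA bh h0 c0 hA; have b1 : bm (fun x => c * \1_A x).
  apply: bmM; first exact: bm_cst.
  split; first exact: measurable_indic.
  by exists 1 => x; rewrite indicE; case: (_ \in _); rewrite ?normr1 ?normr0.
have le1 : II (fun x => c * \1_A x) <= II h.
  apply: II_le => // x; rewrite indicE; have [/set_mem/hA|_] := boolP (x \in A).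
    by rewrite mulr1.
  by rewrite mulr0.
apply: le_trans (_ : ((II (fun x => c * \1_A x))%:E <= _)%E); last by rewrite lee_fin.
rewrite /II /Rintegral fineK; last by apply: integrable_fin_num => //; exact: bm_int.
under eq_integral do rewrite EFinM.
rewrite ge0_integralZl_EFin //; last first.
  by apply/measurable_EFinP; exact: measurable_indic.
by rewrite integral_indic // setIT.
Qed.

(** The Borel-Cantelli lemma, with convergence supplied by a bound on the partial sums. *)
Lemma summable_null (B : nat -> set X) (c : R) : (forall n, measurable (B n)) ->
  (forall n, (\sum_(0 <= k < n) nu (B k) <= c%:E)%E) -> nu (lim_sup_set B) = 0%E.
Proof.
move=> mB h; apply: lim_sup_set_cvg0 => //.
apply: le_lt_trans (ltry c); apply: lime_le; first exact: is_cvg_nneseries.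
by apply: nearW => n; exact: h.
Qed.

End Integrals.

(** * Removing the cycles on a conull set *)

Section Pass1Measure.
Local Open Scope ring_scope.
Variables (R : realType) (disp : measure_display) (X : measurableType disp).
Variable mu : probability X R.
Variables (d : nat) (g : 'I_d -> X -> X) (U : nat -> set X) (lt : X -> X -> Prop).
Hypothesis bg : bgraph g U lt.
Variable N : nat.
Implicit Type f : X -> 'I_d -> int.

Definition conull (V : X -> Prop) := mu (~` [set x | V x]) = 0%E.

Lemma dbor_ffun f : (forall i, dbor (f^~ i)) -> dbor (fun x => [ffun i => f x i]).
Proof.
move=> bf t; apply: (@bor_ext _ _ (fun x => forall i, f x i = t i)).
  move=> x; split => [h|<- i]; last by rewrite ffunE.
  by apply/ffunP => i; rewrite ffunE.
by apply: bor_all => i; exact: bf.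
Qed.

(** By concavity of [f (N - f)], the mean of its integrals after a push and after the opposite push
    is smaller than before, by exactly the integral of [sq] of the push. *)
Let psi (F : {ffun 'I_d -> int}) : R := \sum_i (F i * (N%:Z - F i))%:~R.
Let sq (F : {ffun 'I_d -> int}) : R := \sum_i (F i * F i)%:~R.

Lemma pass1_measure kap f V : bor V -> inv g V -> conull V -> Sol bg N kap f V ->
  exists V' f', [/\ bor V', inv g V', conull V', (forall x, V' x -> V x)
    & Sol bg N kap f' V' /\ acyclic_on g N f' V'].
Proof.
move=> bV iV cV sf.
have [nu [nuT nu0]] := saturated_measure mu bg.
pose Psi f := II nu (fun x => psi [ffun i => f x i]).
pose sgn f c := if Psi (addf f (push g U N f c)) <= Psi (addf f (oppf (push g U N f c)))
  then push g U N f c else oppf (push g U N f c).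
(* The second component of the decoded pair is padding: every code occurs infinitely often. *)
pose cc n : seq 'I_d * nat := (odflt ([::], 0%N, 0%N) (unpickle n)).1.
pose h := fix h n := if n is n'.+1 then addf (h n') (sgn (h n') (cc n')) else f.
have ci f0 c : Sol bg N kap f0 V -> circ bg N f0 (sgn f0 c).
  move=> [bf sy _ _]; have hc := push_circ N c bf sy.
  by rewrite /sgn; case: ifP => // _; exact: circN.
have sh n : Sol bg N kap (h n) V.
  by elim: n => [//|n IH] /=; apply: Sol_addf => //; exact: ci.
pose D n := sgn (h n) (cc n).
have cD n : circ bg N (h n) (D n) by exact: ci (sh n).
pose B n := [set x | exists i, D n x i <> 0].
have bD n i : bor (fun x => D n x i <> 0).
  by apply: bor_not; have [+ _ _ _ _] := cD n; apply.
have mB n : measurable (B n) by apply: bor_ex => i; exact: bD.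
have bpsi f0 : Sol bg N kap f0 V -> bm (fun x => psi [ffun i => f0 x i]).
  move=> [bf _ rf _]; apply: (@bm_dbor _ _ _ _ _ psi (\sum_(i < d) (N%:Z * N%:Z)%:~R)).
    exact: dbor_ffun.
  move=> x; rewrite ger0_norm; last first.
    by apply: sumr_ge0 => i _; rewrite ffunE ler0z; have := rf x i; nia.
  by apply: ler_sum => i _; rewrite ffunE ler_int; have := rf x i; nia.
have bsq n : bm (fun x => sq [ffun i => D n x i]).
  have [bDn _ _ lD _] := cD n.
  apply: (@bm_dbor _ _ _ _ _ sq (\sum_(i < d) 1)); first exact: dbor_ffun.
  move=> x; rewrite ger0_norm; last first.
    by apply: sumr_ge0 => i _; rewrite ffunE ler0z; have := lD x i; nia.
  apply: ler_sum => i _; rewrite ffunE; have := lD x i => l1.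
  by rewrite (_ : 1 = 1%:~R :> R) // ler_int; nia.
have drop n : Psi (h n.+1) <= Psi (h n) - II nu (fun x => sq [ffun i => D n x i]).
  have p1 : bm (fun x => psi [ffun i => addf (h n) (push g U N (h n) (cc n)) x i]).
    apply: bpsi; apply: Sol_addf => //; have [bf sy _ _] := sh n; exact: push_circ.
  have p2 : bm (fun x => psi [ffun i => addf (h n) (oppf (push g U N (h n) (cc n))) x i]).
    apply: bpsi; apply: Sol_addf => //; have [bf sy _ _] := sh n; apply: circN.
    exact: push_circ.
  have p0 := bpsi _ (sh n).
  have e : Psi (addf (h n) (push g U N (h n) (cc n))) + Psi (addf (h n) (oppf (push g U N (h n) (cc n))))
      + 2 * II nu (fun x => sq [ffun i => D n x i]) = 2 * Psi (h n).
    rewrite /Psi -!IIZ // -!IID //; last 2 first.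
      exact: bmD.
      by apply: bmM => //; exact: bm_cst.
    apply: eq_II => x; rewrite /psi /sq !mulr_sumr -!big_split /=; apply: eq_bigr => i _.
    rewrite !ffunE /addf /D /sgn; case: ifP => _; rewrite /oppf (_ : 2 = 2%:~R :> R) //;
      by rewrite -!intrM -!intrD; congr (_%:~R); ring.
  rewrite [h n.+1]/= {1}/sgn; case: ifP => c; first by lra.
  by move/negbT: c; rewrite -ltNge; lra.
(* A vertex where something changes contributes at least 1 to the drop of [Psi], and [Psi] stays
   nonnegative. *)
have tot n : (\sum_(0 <= k < n) nu (B k) <= (Psi f)%:E)%E.
  suff : (\sum_(0 <= k < n) nu (B k) <= (Psi f - Psi (h n))%:E)%E.
    move=> h1; apply: le_trans h1 _; rewrite lee_fin gerBl; apply: II_ge0 => x.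
    apply: sumr_ge0 => i _; rewrite ffunE ler0z; have [_ _ /(_ x i) + _] := sh n; nia.
  elim: n => [|n IH]; first by rewrite big_nil subrr.
  rewrite big_nat_recr //=.
  have mk : (nu (B n) <= (II nu (fun x => sq [ffun i => D n x i]))%:E)%E.
    rewrite -[leLHS]mul1e; apply: II_markov => //.
      by move=> x; apply: sumr_ge0 => i _; rewrite ffunE ler0z; nia.
    move=> x [i Di]; rewrite /sq (bigD1 i) //= ffunE.
    rewrite -[leLHS]addr0; apply: lerD; first by rewrite (_ : 1 = 1%:~R :> R) // ler_int; nia.
    by apply: sumr_ge0 => j _; rewrite ffunE ler0z; nia.
  apply: le_trans (leeD IH mk) _; rewrite -EFinD lee_fin.
  by have := drop n; lra.
have nul := summable_null mB tot.
pose st n x i := forall m, (n <= m)%N -> D m x i = 0.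
have [||||||f' [h1 h2 h3 h4]] := @settled_limit _ _ _ _ _ _ bg N kap h st V sh.
- move=> n i; apply: bor_all => m; apply: bor_imp; first exact: bor_cst.
  by have [+ _ _ _ _] := cD m; apply.
- move=> n x i; split => s m nm; have [_ sy _ _ _] := cD m; first by rewrite sy; exact: s.
  by rewrite -(sy x i); exact: s.
- move=> n x i s; split; first by move=> m nm; apply: s; exact: ltnW.
  by rewrite /= /addf -/(D n) s // addr0.
(* The code of such a cycle comes up again after stage [n], and the push would then move the settled
   dart. *)
- move=> n x i s [p [cp dp ps]]; have [c hc] := push_complete bg cp.
  have [m' [nm' cm']] : exists m', (n <= m')%N /\ cc m' = c.
    have inj (k : nat) : cc (pickle (c, k)) = c by rewrite /cc pickleK.
    have [k nk] : exists k : nat, (n <= pickle (c, k))%N.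
      apply: contrapT => hk.
      have ltk (k : nat) : (pickle (c, k) < n)%N by rewrite ltnNge; apply/negP => ?; apply: hk; exists k.
      have inj' : injective (fun k : 'I_n.+1 => Ordinal (ltk k)).
        by move=> k k' /(congr1 val) /= /(pcan_inj pickleK) [] /val_inj.
      by have := leq_card _ inj'; rewrite !card_ord ltnn.
    by exists (pickle (c, k)).
  have hm y j : y \in p -> h m' y j = h n y j.
    move=> yp; rewrite -(subnKC nm'); elim: (m' - n)%N => [|k IH]; first by rewrite addn0.
    by rewrite addnS /= /addf -/(D (n + k)%N) ps ?addr0 ?leq_addr.
  have cp' : cyc g N (h m') p by apply: cyc_mono cp => y j yp; rewrite /fractional hm.
  have xp : x \in p.
    by apply: contrapT => /negP/negbTE xp; apply: dp; rewrite /delta xp.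
  apply: dp; have := s m' nm'; rewrite /D /sgn cm' -(hc _ cp' x i xp).
  by case: ifP => _ //; rewrite /oppf => /eqP; rewrite oppr_eq0 => /eqP.
- exact: bV.
- exact: iV.
eexists; exists f'; split; [exact: h1|exact: h2| |by move=> x []|by split].
have mL : measurable (lim_sup_set B).
  by apply: bigcapT_measurable => n; apply: bigcup_measurable => k _.
have mS : measurable [set x | exists w, lim_sup_set B (act g w x)].
  apply: bor_ex => w; apply: (bor_comp (P := lim_sup_set B)) => //.
  by apply: (bfun_act bg); exact: bfun_id.
have mVC : measurable (~` [set x | V x]) by exact: measurableC.
apply/eqP; rewrite eq_le measure_ge0 andbT.
have <- : mu (~` [set x | V x] `|` [set x | exists w, lim_sup_set B (act g w x)]) = 0%E.
  apply: measure_negligible; first exact: measurableU.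
  apply: negligibleU; first exact/(negligibleP mu mVC).
  by apply/(negligibleP mu mS); exact: nu0.
apply: le_measure; rewrite ?inE.
- exact: measurableC.
- exact: measurableU.
- move=> x nV; apply: contrapT => /not_orP[/contrapT Vx nB]; apply: nV; split => // w i.
  apply: contrapT => ns; apply: nB; exists w => n _.
  have [m [nm Dm]] : exists m, (n <= m)%N /\ D m (act g w x) i <> 0.
    apply: contrapT => hm; apply: ns; exists n => m nm; apply: contrapT => Dm.
    by apply: hm; exists m.
  by exists m => //; exists i.
Qed.

End Pass1Measure.

(** * Forests of fractional edges *)

Section Forest.
Local Open Scope ring_scope.
Variables (disp : measure_display) (X : measurableType disp) (d : nat).
Variables (g : 'I_d -> X -> X) (U : nat -> set X) (lt : X -> X -> Prop).
Hypothesis bg : bgraph g U lt.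
Variables (N kap : nat) (f : X -> 'I_d -> int) (V : X -> Prop).
Hypothesis N0 : (0 < N)%N.
Hypothesis iV : inv g V.
Hypothesis sf : Sol bg N kap f V.
Hypothesis af : acyclic_on g N f V.
Implicit Types (x y z : X) (i j : 'I_d) (s : seq X).
Local Notation T := (fractional N f).

Definition tdeg (f : X -> 'I_d -> int) x := #|[pred i | fractional N f x i]|.
(* The number of fractional edges at [x] to be rounded up. *)
Definition kp x : nat := (absz (\sum_(i | T x i) f x i)%R %/ N)%N.

(** The non-fractional values are 0 or [N], so the fractional ones add up to a multiple of [N]. *)
Lemma kpE x : V x -> \sum_(i | T x i) f x i = (kp x * N)%:Z.
Proof.
move=> Vx; have [_ _ rf /(_ x Vx)] := sf; rewrite (bigID (T x)) /= => e.
have [m em] : exists m : nat, \sum_(i | ~~ T x i) f x i = (m * N)%:Z.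
  apply: (big_ind (fun v : int => exists m : nat, v = (m * N)%:Z)).
  - by exists 0%N.
  - by move=> a b [m ->] [m' ->]; exists (m + m')%N; rewrite mulnDl.
  - move=> i nT; have := rf x i; rewrite /fractional in nT => r.
    have [e0|e0] : f x i = 0 \/ f x i = N%:Z by lia.
      by exists 0%N.
    by exists 1%N; rewrite mul1n.
have s0 : 0 <= \sum_(i | T x i) f x i by apply: sumr_ge0 => i _; have := rf x i; lia.
have e2 : absz (\sum_(i | T x i) f x i) = ((kap - m) * N)%N.
  by move: e s0; rewrite em mulnBl; set S := \sum_(i | _) _; lia.
by rewrite /kp e2 mulnK // -e2 gez0_abs.
Qed.

Lemma sum_le_card (P : pred 'I_d) (F : 'I_d -> int) (c : int) :
  (forall i, P i -> F i <= c) -> \sum_(i | P i) F i <= #|P|%:Z * c.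
Proof.
move=> h; apply: le_trans (ler_sum _ h) _.
by rewrite sumr_const -mulr_natl natz.
Qed.

Lemma sum_ge_card (P : pred 'I_d) (F : 'I_d -> int) (c : int) :
  (forall i, P i -> c <= F i) -> #|P|%:Z * c <= \sum_(i | P i) F i.
Proof.
move=> h; apply: le_trans (ler_sum _ h).
by rewrite sumr_const -mulr_natl natz.
Qed.

(** Fractional values lie strictly between 0 and [N]. In particular a vertex with a fractional edge
    has at least two. *)
Lemma kp_bounds x : V x -> (0 < tdeg f x)%N -> (0 < kp x < tdeg f x)%N.
Proof.
move=> Vx d0; have e := kpE Vx.
have lb : (tdeg f x)%:Z * 1 <= \sum_(i | T x i) f x i.
  by apply: sum_ge_card => i; rewrite /= /fractional; lia.
have ub : \sum_(i | T x i) f x i <= (tdeg f x)%:Z * (N%:Z - 1).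
  by apply: sum_le_card => i; rewrite /= /fractional; lia.
by rewrite e in lb ub; apply/andP; split; nia.
Qed.

Lemma kp0 x : V x -> tdeg f x = 0%N -> kp x = 0%N.
Proof.
move=> Vx d0; have e := kpE Vx.
have ub : \sum_(i | T x i) f x i <= (tdeg f x)%:Z * (N%:Z - 1).
  by apply: sum_le_card => i; rewrite /= /fractional; lia.
by rewrite e d0 in ub; nia.
Qed.

Lemma dbor_kp : dbor kp.
Proof.
have [bf _ _ _] := sf; have := dbor_ffun bf.
have e x : kp x = (fun F : {ffun 'I_d -> int} =>
    absz (\sum_(i | (0 < F i) && (F i < N%:Z)) F i)%R %/ N)%N [ffun i => f x i].
  rewrite /kp /=; congr (absz _ %/ N)%N; apply: eq_big => [i|i _]; by rewrite ?ffunE.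
move=> h; have {}h := dbor_comp (fun F : {ffun 'I_d -> int} =>
    absz (\sum_(i | (0 < F i) && (F i < N%:Z)) F i)%R %/ N)%N h.
by move=> t; apply: bor_ext (h t) => x; rewrite e.
Qed.

Lemma dbor_if (A : Type) (b : X -> bool) (F F' : X -> A) :
  bor (fun x => b x) -> dbor F -> dbor F' -> dbor (fun x => if b x then F x else F' x).
Proof.
move=> bb bF bF' t; apply: (@bor_ext _ _ (fun x => b x /\ F x = t \/ ~ b x /\ F' x = t)).
  move=> x; case: (b x); split => //; first by case=> -[].
  - by left.
  - by case=> -[].
  - by right.
by apply: bor_or; apply: bor_and => //; exact: bor_not.
Qed.

Definition glue (c : X -> 'I_d -> int) x i := if `[< V x >] && T x i then c x i else f x i.

Lemma Sol_glue (c : X -> 'I_d -> int) : bor V -> (forall i, dbor (c^~ i)) ->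
  (forall x i, V x -> T x i -> c (g i x) (rv bg x i) = c x i) ->
  (forall x i, V x -> T x i -> 0 <= c x i <= N%:Z) ->
  (forall x, V x -> \sum_(i | T x i) c x i = (kp x * N)%:Z) ->
  Sol bg N kap (glue c) V.
Proof.
move=> bV bc sc rc zc; have [bf sy rf zf] := sf; split.
- move=> i; apply: dbor_if => //.
  apply: (@bor_ext _ _ (fun x => V x /\ T x i)).
    by move=> x; split => [[/asboolP -> ->]|/andP[/asboolP]].
  by apply: bor_and => //; apply: bor_T => //; exact: bfun_id.
- move=> x i; rewrite /glue T_sym //; case: (pselect (V x)) => Vx.
    have Vy : V (g i x) by exact: (iV x i).1.
    by rewrite !asboolT //=; case: ifP => // Ti; exact: sc.
  have Vy : ~ V (g i x) by move/(iV x i).2.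
  by rewrite !asboolF //=.
- by move=> x i; rewrite /glue; case: ifP => // /andP[/asboolP Vx Ti]; exact: rc.
- move=> x Vx; rewrite -(zf x Vx) (bigID (T x)) [RHS](bigID (T x)) /=; congr (_ + _).
    rewrite kpE // -zc //; apply: eq_bigr => i Ti; by rewrite /glue asboolT ?Ti.
  by apply: eq_bigr => i /negbTE Ti; rewrite /glue Ti andbF.
Qed.

Lemma T_glue (c : X -> 'I_d -> int) x i : V x -> fractional N (glue c) x i -> T x i /\ 0 < c x i < N%:Z.
Proof. by move=> Vx; rewrite /glue /fractional asboolT //=; case: ifP => // ->. Qed.

Definition eT x y := [exists i, (g i x == y) && T x i].

Lemma eTP x y : reflect (exists i, g i x = y /\ T x i) (eT x y).
Proof.
by apply: (iffP existsP) => -[i]; [move=> /andP[/eqP]|move=> [/eqP ? ?]]; exists i; rewrite ?H //; apply/andP.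
Qed.

Lemma eT_sym x y : eT x y = eT y x.
Proof.
by have [_ sy _ _] := sf; apply/eTP/eTP => h; exact: (adj_sym sy h).
Qed.

Lemma eT_neq x y : eT x y -> x != y.
Proof. by move=> /eTP[i [<- _]]; apply/eqP => /esym; exact: (g_neq bg). Qed.

Lemma eTV x y : V x -> eT x y -> V y.
Proof. by move=> Vx /eTP[i [<- _]]; exact: (iV _ _).1. Qed.

Lemma pathV x s y : V x -> path eT x s -> y \in s -> V y.
Proof.
elim: s x => [//|z s IH] x Vx /= /andP[xz zs]; have Vz := eTV Vx xz.
by rewrite inE => /orP[/eqP ->//|]; exact: IH zs.
Qed.

Definition edge_off x y := [rel u v | eT u v && ~~ ((u == x) && (v == y) || (u == y) && (v == x))].

(** A path from [x] to [y] that does not use the edge between them would close up to a cycle. *)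
Lemma bridge x y s : V x -> eT x y -> path (edge_off x y) x s -> last x s = y -> False.
Proof.
move=> Vx xy ps ls; case: (shortenP ps) ls => s' ps' us _ ls.
have ps'' : path eT x s' by apply: sub_path ps' => u v /andP[].
apply: (af (p := x :: s')).
  move=> z; rewrite inE => /orP[/eqP ->//|]; exact: pathV ps''.
case: s' => [|a [|b s']] in ps' us ls ps'' *.
- by move: (eT_neq xy); rewrite -ls eqxx.
- by move: ps'; rewrite /= in ls; rewrite /= ls !eqxx andbF.
split => // k kl; case: eqP => [e|ne].
  have -> : nth point [:: x, a, b & s'] k = y.
    have -> : k = size [:: a, b & s'] by move: e => [].
    by rewrite -[RHS]ls -[LHS]/(nth point (x :: [:: a, b & s']) (size [:: a, b & s'])) nth_last.
  by rewrite /=; apply/eTP; rewrite eT_sym.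
have kl' : (k < size [:: a, b & s'])%N by move: kl ne => /=; lia.
by have /(pathP point)/(_ k kl') := ps''; rewrite -[nth _ _ k.+1]/(nth point [:: a, b & s'] k) => /eTP.
Qed.

Definition tc x y := exists s, path eT x s /\ last x s = y.

Lemma tc_refl x : tc x x. Proof. by exists [::]. Qed.

Lemma tc_trans y x z : tc x y -> tc y z -> tc x z.
Proof.
by move=> [s [ps ls]] [t [pt lt']]; exists (s ++ t); rewrite cat_path last_cat ls ps pt.
Qed.

Lemma tc1 x y : eT x y -> tc x y. Proof. by move=> xy; exists [:: y]; rewrite /= xy. Qed.

Lemma tc_sym x y : tc x y -> tc y x.
Proof.
move=> [s [ps <-]]; elim: s x ps => [|z s IH] x /=; first by move=> _; exact: tc_refl.
by move=> /andP[xz /IH h]; apply: tc_trans h _; apply: tc1; rewrite eT_sym.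
Qed.

Lemma tcV x y : V x -> tc x y -> V y.
Proof.
move=> Vx [s [ps <-]]; case/lastP: s => [//|s z] in ps *; rewrite last_rcons.
by apply: pathV ps _ => //; rewrite mem_rcons mem_head.
Qed.

(** For an edge of the forest: the component of [y] after removal of the edge. *)
Definition side x y c := exists s, [/\ path eT y s, x \notin y :: s & last y s = c].

Lemma tc_uniq x c : tc x c -> exists s, [/\ path eT x s, uniq (x :: s) & last x s = c].
Proof. by move=> [s [ps ls]]; case: (shortenP ps) ls => s' ps' us _ ls; exists s'. Qed.

Lemma side_tc x y c : side x y c -> tc y c.
Proof. by move=> [s [ps _ ls]]; exists s. Qed.

Lemma avoid_off x y s : path eT y s -> x \notin y :: s -> path (edge_off x y) y s /\ path (edge_off y x) y s.
Proof.
move=> ps nx; have h a b : path eT y s -> x \notin y :: s -> path (edge_off a b) y s \/ ~ (a = x \/ b = x).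
  move=> _ _; have [h|h] := pselect (a = x \/ b = x); [left|by right].
  elim: s y ps nx => [//|z s IH] y /= /andP[yz zs]; rewrite !inE !negb_or => /and3P[xy xz xs].
  rewrite yz IH ?inE ?negb_or ?xz //= andbT.
  have yx : (y == x) = false by rewrite eq_sym (negbTE xy).
  have zx : (z == x) = false by rewrite eq_sym (negbTE xz).
  by case: h => ->; rewrite ?yx ?zx ?andbF.
split.
  by have [//|[]] := h x y ps nx; left.
by have [//|[]] := h y x ps nx; right.
Qed.

Lemma side_or x y c : eT x y -> tc x c -> side x y c \/ side y x c.
Proof.
move=> xy /tc_uniq[s [ps us ls]].
have [ys|ys] := boolP (y \in s); last first.
  by right; exists s; split => //; rewrite inE negb_or ys andbT eq_sym eT_neq.
left; case/splitPr: ys ps us ls => s1 s2; rewrite cat_path /= last_cat /=.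
move=> /and3P[_ _ p2] /andP[nx _] ls; exists s2; split => //.
by move: nx; rewrite mem_cat negb_or => /andP[].
Qed.

Lemma rev_path_off x y u s : path (edge_off x y) u s ->
  path (edge_off x y) (last u s) (rev (belast u s)).
Proof.
rewrite rev_path; congr (is_true _); apply: eq_path => a b /=.
by rewrite eT_sym; case: (a == x); case: (a == y); case: (b == x); case: (b == y).
Qed.

Lemma last_rev_belast (A : eqType) (u : A) (s : seq A) : last (last u s) (rev (belast u s)) = u.
Proof. by case: s => [//|a s] /=; rewrite rev_cons last_rcons. Qed.

Lemma side_not x y c : V x -> eT x y -> side x y c -> side y x c -> False.
Proof.
move=> Vx xy [s [ps ns ls]] [t [pt nt lt']].
have [p1 _] := avoid_off ps ns; have [_ p2] := avoid_off pt nt.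
apply: (bridge (s := t ++ rev (belast y s)) Vx xy).
  by rewrite cat_path p2 lt' -ls; exact: rev_path_off.
by rewrite last_cat lt' -ls last_rev_belast.
Qed.

Lemma side_inj x y y' c : V x -> eT x y -> eT x y' -> side x y c -> side x y' c -> y = y'.
Proof.
move=> Vx xy xy' [s [ps ns ls]] [t [pt nt lt']]; apply: contrapT => /eqP ne.
have yx : eT y x by rewrite eT_sym.
have off s' z : path eT z s' -> x \notin z :: s' -> path (edge_off y x) z s'.
  elim: s' z => [//|a s' IH] z /= /andP[za pa]; rewrite !inE !negb_or => /and3P[xz xa xs].
  rewrite za IH ?inE ?negb_or ?xa //= andbT.
  by rewrite [a == x]eq_sym [z == x]eq_sym (negbTE xz) (negbTE xa) !andbF.
apply: (bridge (s := s ++ rcons (rev (belast y' t)) x) (eTV Vx xy) yx).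
  rewrite cat_path off //= rcons_path ls -lt'.
  rewrite rev_path_off ?off //= last_rev_belast /edge_off /= eT_sym xy' /= eqxx andbT.
  by rewrite eq_sym (negbTE ne) /= [x == y](negbTE (eT_neq xy)) andbF.
by rewrite last_cat last_rcons.
Qed.

Lemma card_rank (P : pred 'I_d) r : (r <= #|P|)%N ->
  #|[pred j | P j & (index j (enum P) < r)%N]| = r.
Proof.
move=> rP; have u : uniq (take r (enum P)) by rewrite take_uniq ?enum_uniq.
have <- : #|take r (enum P)| = r by rewrite (card_uniqP u) size_takel // -cardE.
apply: eq_card => j; rewrite !inE (card_uniqP u) size_takel -?cardE //.
have [Pj|Pj] := boolP (P j); first by rewrite in_take ?mem_enum.
apply/esym/negbTE; apply: contra Pj => /mem_take; by rewrite mem_enum.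
Qed.

(* [pa x] is the edge from [x] to its parent, [co] marks the edges of the lines. *)
Section Solver.
Hypothesis bV : bor V.
Variables (pa : X -> option 'I_d) (co : X -> 'I_d -> bool).
Hypothesis bpa : dbor pa.
Hypothesis bco : forall i, bor (fun x => co x i).

Definition ch x i := T x i && (pa (g i x) == Some (rv bg x i)).

Hypothesis tri : forall x i, V x -> ((pa x == Some i) + ch x i + co x i = T x i)%N.
Hypothesis cor : forall x, V x -> if pa x then forall i, co x i = false
  else (#|co x| == 0%N) || (#|co x| == 2%N).

Definition rk y j : nat := index j (enum (ch y)).

Definition big_half x i := N%:Z < f x i *+ 2.

(** How many times [N] the core edges at [y] take up after rounding: to the nearest multiple of [N]
    if [N] is odd, to [N / 2] each if [N] is even. *)
Definition cs y : nat := if odd N then #|[pred i | co y i && big_half y i]| else #|co y|./2.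

(* The value of the edge from [x] to its parent, if [n] generations decide it. *)
Fixpoint vn n x : option bool :=
  if n is n'.+1 then
    if pa x is Some i then
      let r := rk (g i x) (rv bg x i) in
      if pa (g i x) == None then Some (r < kp (g i x) - cs (g i x))%N
      else if (r.+1 < kp (g i x))%N then Some true
      else if (kp (g i x) <= r)%N then Some false else omap negb (vn n' (g i x))
    else None
  else None.

Hypothesis fin : forall x, V x -> pa x -> exists n, vn n x.

Let vnS n x b : vn n x = Some b -> vn n.+1 x = Some b.
Proof.
elim: n x b => [//|n IH] x b; rewrite [vn n.+1 x]/= [vn n.+2 x]/=.
case: (pa x) => // i; case: ifP => // _; case: ifP => // _; case: ifP => // _.
case e : (vn n (g i x)) => [c|] //= <-.
by have /= -> := IH _ _ e.
Qed.

Let vn_ge n m x b : (n <= m)%N -> vn n x = Some b -> vn m x = Some b.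
Proof. by move=> /subnKC <- h; elim: (m - n)%N => [|k IH]; rewrite ?addn0 // addnS; exact: vnS. Qed.

Let v x := `[< exists n, vn n x = Some true >].

Let vE n x b : vn n x = Some b -> v x = b.
Proof.
move=> h; apply/asboolP; case: b h => h; first by exists n.
move=> [m h']; have := vn_ge (leq_maxl n m) h; by rewrite (vn_ge (leq_maxr n m) h').
Qed.

(** The number of child edges to be rounded up. At a vertex with a parent it is [kp] or [kp - 1], so
    only the child of rank [kp - 1] depends on the value of the parent edge; this is the recursive
    case of [vn]. *)
Let tgt y : nat := if pa y then (kp y - v y)%N else (kp y - cs y)%N.

Lemma pa_T x i : V x -> pa x = Some i -> T x i.
Proof. by move=> Vx e; have := tri i Vx; rewrite e eqxx; case: (T x i). Qed.

Lemma tdeg_split x : V x -> tdeg f x = (isSome (pa x) + #|ch x| + #|co x|)%N.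
Proof.
move=> Vx; rewrite /tdeg -!sum1_card.
have -> : isSome (pa x) = (\sum_(i < d) (pa x == Some i))%N :> nat.
  case: (pa x) => [i|] /=; last by rewrite big1.
  by rewrite (bigD1 i) //= eqxx big1 // => j ij; case: eqP => // -[e]; rewrite e eqxx in ij.
rewrite big_mkcond [in X in (_ + X + _)%N]big_mkcond [in X in (_ + _ + X)%N]big_mkcond /= -!big_split /=.
by apply: eq_bigr => i _; rewrite -!topredE /= -[if T x i then _ else _]/(nat_of_bool (T x i)) -tri.
Qed.

Let vrec x i : V x -> pa x = Some i -> v x = (rk (g i x) (rv bg x i) < tgt (g i x))%N.
Proof.
move=> Vx e; have Ti := pa_T Vx e.
have Vy : V (g i x) by exact: (iV _ _).1.
have [n] : exists n, vn n x by apply: fin; rewrite // e.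
case: n => // n; case e' : (vn n.+1 x) => [b|] // _; rewrite (vE e'); move: e'; rewrite /= e /tgt.
case: eqP => [->|]; first by case.
have d0 : (0 < tdeg f (g i x))%N.
  by apply/card_gt0P; exists (rv bg x i); rewrite inE T_sym //; have [_ + _ _] := sf.
have := kp_bounds Vy d0.
case: (pa (g i x)) => [j|] // /andP[k0 _] _ /=.
case: ifP => [lt1 [<-]|ge1]; first by case: (v _); lia.
case: ifP => [lt2 [<-]|ge2]; first by case: (v _); lia.
case e2 : (vn n (g i x)) => [c|] //= [<-]; rewrite (vE e2); case: (c); lia.
Qed.

(** For [N] odd and two core edges: two values below [N / 2] sum to less than [N], two above it to
    more than [N], and with one of each kind [0 < kp < tdeg] is enough. *)
Let core_ok x : V x -> pa x = None -> (cs x <= kp x)%N /\ (kp x - cs x <= #|ch x|)%N.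
Proof.
move=> Vx e; have dE := tdeg_split Vx; have := cor Vx; rewrite e /= in dE *.
move=> c02; have ct i : co x i -> T x i by move=> c; have := tri i Vx; rewrite c; case: (T x i); lia.
have [d0|d0] := posnP (tdeg f x).
  rewrite (kp0 Vx d0) d0 in dE *; rewrite sub0n; split => //; rewrite /cs.
  case: ifP => _; last by lia.
  have : (#|[pred i | co x i && big_half x i]| <= #|co x|)%N.
    by apply: subset_leq_card; apply/fintype.subsetP => i; rewrite !inE => /andP[].
  lia.
have kb := kp_bounds Vx d0.
rewrite /cs; case: ifP => oN; last by case/orP: c02 => /eqP c; rewrite c in dE *; lia.
have sub : (#|[pred i | co x i && big_half x i]| <= #|co x|)%N.
  by apply: subset_leq_card; apply/fintype.subsetP => i; rewrite !inE => /andP[].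
have kE := kpE Vx; have s2 : \sum_(i | T x i) f x i = \sum_(i | co x i) f x i + \sum_(i | T x i && ~~ co x i) f x i.
  rewrite (bigID (co x)) /=; congr (_ + _); apply: eq_bigl => i.
  by case c : (co x i); rewrite ?andbF ?andbT // ct.
have rest1 : \sum_(i | T x i && ~~ co x i) f x i <= #|[pred i | T x i && ~~ co x i]|%:Z * (N%:Z - 1).
  by apply: sum_le_card => i; rewrite /= /fractional; lia.
have rest0 : #|[pred i | T x i && ~~ co x i]|%:Z * 0 <= \sum_(i | T x i && ~~ co x i) f x i.
  by apply: sum_ge_card => i; rewrite /= /fractional; lia.
have cR : (#|co x| + #|[pred i | T x i && ~~ co x i]| = tdeg f x)%N.
  rewrite /tdeg -[RHS](cardID (co x)); congr (_ + _)%N; apply: eq_card => i; rewrite !inE -!topredE /=.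
    by case c : (co x i); rewrite ?andbF // (ct i c).
  by rewrite andbC.
case/orP: c02 => /eqP c; first by lia.
set k := #|[pred i | co x i && big_half x i]| in sub *.
have [k0|[k1|k2]] : k = 0%N \/ k = 1%N \/ k = 2%N by lia.
- have nb i : co x i -> ~~ big_half x i.
    move=> ci; apply/negP => bi; have : (0 < k)%N by apply/card_gt0P; exists i; rewrite inE ci.
    by rewrite k0.
  have : \sum_(i | co x i) f x i <= #|co x|%:Z * ((N.-1)./2)%:Z.
    by apply: sum_le_card => i /nb; rewrite /big_half mulr2n; lia.
  rewrite c; nia.
- lia.
- have ab i : co x i -> big_half x i.
    move=> ci; have : [pred i | co x i && big_half x i] =i co x.
      apply/subset_cardP; first by rewrite -/k c.
      by apply/fintype.subsetP => j; rewrite !inE => /andP[].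
    by move/(_ i); rewrite !inE -topredE /= ci.
  have : #|co x|%:Z * ((N.+1)./2)%:Z <= \sum_(i | co x i) f x i.
    by apply: sum_ge_card => i /ab; rewrite /big_half mulr2n; lia.
  rewrite c; nia.
Qed.

Let tgt_ok x : V x -> (tgt x <= #|ch x|)%N /\
  (kp x = tgt x + (if pa x then nat_of_bool (v x) else cs x))%N.
Proof.
move=> Vx; rewrite /tgt; case e : (pa x) => [i|] /=; last first.
  by have [h1 h2] := core_ok Vx e; rewrite subnK.
have := tdeg_split Vx; rewrite e /=; have Ti := pa_T Vx e.
have d0 : (0 < tdeg f x)%N by apply/card_gt0P; exists i.
have := kp_bounds Vx d0; have := cor Vx; rewrite e /= => c0.
have -> : #|co x| = 0%N by apply/eqP; rewrite cards_eq0 || apply/eqP/eq_card0 => j; rewrite -topredE /= c0.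
case: (v x); lia.
Qed.

Let sol x i : int :=
  if pa x == Some i then (N * v x)%:Z
  else if ch x i then (N * v (g i x))%:Z
  else if odd N then (if big_half x i then N%:Z else 0) else (N./2)%:Z.

Lemma bor_ch i : bor (fun x => ch x i).
Proof.
have [bf sy _ _] := sf.
apply: (@bor_ext _ _ (fun x => T x i /\ exists j, pa (g i x) = Some j /\ rv bg x i = j)).
  move=> x; split => [[Ti [j [e1 e2]]]|/andP[Ti /eqP e]]; first by rewrite /ch Ti e1 e2 eqxx.
  by split => //; exists (rv bg x i).
apply: bor_and; first by apply: bor_T => //; exact: bfun_id.
apply: bor_ex => j; apply: bor_and; last exact: bor_rv.
apply: (bor_comp (P := fun x => pa x = Some j)); last exact: bpa.
exact: (bg_borel bg).
Qed.

Let bbh i : bor (fun x => big_half x i).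
Proof. by have [bf _ _ _] := sf; apply: (dbor_pre (fun n : int => is_true (N%:Z < n *+ 2)) (bf i)). Qed.

Let dffun_bool (b : X -> 'I_d -> bool) : (forall i, bor (fun x => b x i)) ->
  dbor (fun x => [ffun i => b x i]).
Proof.
move=> bb t; apply: (@bor_ext _ _ (fun x => forall i, b x i = t i)).
  move=> x; split => [h|<- i]; last by rewrite ffunE.
  by apply/ffunP => i; rewrite ffunE.
by apply: bor_all => i; exact: (dbor_bool (bb i)).
Qed.

Lemma dbor_rk j : dbor (fun x => rk x j).
Proof.
have h := dbor_comp (fun F : {ffun 'I_d -> bool} => index j (enum [pred i | F i])) (dffun_bool bor_ch).
move=> t; apply: bor_ext (h t) => x.
suff -> : enum [pred i | [ffun i => ch x i] i] = enum (ch x) by [].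
by apply: eq_enum => i; rewrite -!topredE /= ffunE.
Qed.

Let dcs : dbor cs.
Proof.
have h := dbor_pair (dffun_bool bco) (dffun_bool bbh).
have {}h := dbor_comp (fun F : {ffun 'I_d -> bool} * {ffun 'I_d -> bool} =>
  if odd N then #|[pred i | F.1 i && F.2 i]| else #|[pred i | F.1 i]|./2) h.
move=> t; apply: bor_ext (h t) => x; rewrite /cs /=.
suff -> : #|[pred i | [ffun i => co x i] i]| = #|co x|.
  suff -> : #|[pred i | [ffun i => co x i] i && [ffun i => big_half x i] i]| =
    #|[pred i | co x i && big_half x i]| by [].
  by apply: eq_card => i; rewrite !inE !ffunE.
by apply: eq_card => i; rewrite -!topredE /= ffunE.
Qed.

Let dvn n : dbor (vn n).
Proof.
elim: n => [|n IH] t; first exact: (@bor_cst _ _ (None = t)).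
pose L (q : nat * option 'I_d * (nat * nat) * option bool) :=
  if q.1.1.2 == None then Some (q.1.1.1 < q.1.2.1 - q.1.2.2)%N
  else if (q.1.1.1.+1 < q.1.2.1)%N then Some true
  else if (q.1.2.1 <= q.1.1.1)%N then Some false else omap negb q.2.
apply: (@bor_ext _ _ (fun x => (exists i j, pa x = Some i /\ rv bg x i = j /\
   L (rk (g i x) j, pa (g i x), (kp (g i x), cs (g i x)), vn n (g i x)) = t) \/ pa x = None /\ None = t)).
  move=> x; rewrite /=; case e : (pa x) => [i|]; split.
  - by case=> [[i' [j [[<-] [<-]]]]|[]].
  - by left; exists i, (rv bg x i).
  - by case=> [[i' [j []]]|[]].
  - by right.
apply: bor_or; last by apply: bor_and; [exact: bpa|exact: bor_cst].
apply: bor_ex => i; apply: bor_ex => j; apply: bor_and; first exact: bpa.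
apply: bor_and; first exact: bor_rv.
have bgi : bfun (g i) by exact: (bg_borel bg).
have H : dbor (fun x => (rk (g i x) j, pa (g i x), (kp (g i x), cs (g i x)), vn n (g i x))).
  apply: dbor_pair; last exact: (dbor_fun bgi IH).
  apply: dbor_pair; first by apply: dbor_pair; [exact: (dbor_fun bgi (dbor_rk j))|exact: (dbor_fun bgi bpa)].
  by apply: dbor_pair; [exact: (dbor_fun bgi dbor_kp)|exact: (dbor_fun bgi dcs)].
exact: (dbor_comp L H t).
Qed.

Let bv : bor (fun x => v x).
Proof.
apply: (@bor_ext _ _ (fun x => exists n, vn n x = Some true)); first by move=> x; split => /asboolP.
by apply: bor_ex => n; exact: dvn.
Qed.

Lemma solver : exists f', Sol bg N kap f' V /\
  forall x, V x -> (tdeg f' x == 0%N) || (tdeg f' x == 2%N).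
Proof.
have [bf sy rf _] := sf.
have chV x i : V x -> ch x i -> v (g i x) = (rk x i < tgt x)%N.
  move=> Vx /andP[Ti /eqP e]; have Vy : V (g i x) by exact: (iV _ _).1.
  by have := vrec Vy e; rewrite rvK rv_rv.
have tris x i : V x -> T x i -> [|| pa x == Some i, ch x i | co x i].
  by move=> Vx Ti; have := tri i Vx; rewrite Ti; case: (pa x == _); case: (ch x i); case: (co x i).
exists (glue sol); split.
  apply: Sol_glue => //.
  - move=> i; rewrite /sol; apply: dbor_if; first by apply: bor_ext (bpa (Some i)) => x; split => /eqP.
      exact: (dbor_comp (fun b : bool => (N * b)%:Z) (dbor_bool bv)).
    apply: dbor_if; first exact: bor_ch.
      exact: (dbor_comp (fun b : bool => (N * b)%:Z) (dbor_fun (bg_borel bg i) (dbor_bool bv))).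
    case: (odd N); last by move=> t; exact: bor_cst.
    by apply: dbor_if; [exact: bbh| |] => t; exact: bor_cst.
  - move=> x i Vx Ti; have Vy : V (g i x) by exact: (iV _ _).1.
    have t1 := tri i Vx; have t2 := tri (rv bg x i) Vy.
    have Ty : T (g i x) (rv bg x i) by rewrite T_sym.
    have e1 : ch x i = (pa (g i x) == Some (rv bg x i)) by rewrite /ch Ti.
    have e2 : ch (g i x) (rv bg x i) = (pa x == Some i) by rewrite /ch Ty rvK rv_rv.
    have e3 : big_half (g i x) (rv bg x i) = big_half x i by rewrite /big_half sy.
    rewrite /sol -e1 e2 rvK e3 Ti in t1 *.
    by case: (ch x i) t1; case: (pa x == Some i) => //; lia.
  - move=> x i Vx Ti; rewrite /sol; case: ifP => _; first by case: (v x); lia.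
    case: ifP => _; first by case: (v _); lia.
    by case: ifP => _; [case: ifP|]; lia.
  - move=> x Vx; have [t1 ->] := tgt_ok Vx.
    have part i : T x i -> sol x i = (N * v x)%:Z * (pa x == Some i)%:Z + N%:Z * (ch x i && (rk x i < tgt x)%N)%:Z
        + (if odd N then N%:Z * (co x i && big_half x i)%:Z else (N./2)%:Z * (co x i)%:Z).
      move=> Ti; have := tri i Vx; have := chV x i Vx; rewrite /sol Ti.
      case: (pa x == Some i); case: (ch x i); case: (co x i) => //= h _.
      - by rewrite mulr1 mulr0 !addr0; case: ifP; rewrite ?mulr0 addr0.
      - rewrite h // mulr0 add0r PoszM; by case: ifP; rewrite ?mulr0 addr0.
      - by rewrite !mulr0 !add0r; case: ifP => //; rewrite ?mulr1 //; case: ifP; rewrite ?mulr1 ?mulr0.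
    rewrite (eq_bigr _ part) !big_split /= -!mulr_sumr.
    have tot (b : 'I_d -> bool) : (forall i, b i -> T x i) -> \sum_(i | T x i) (b i)%:Z = #|b|%:Z.
      move=> bT; rewrite -sum1_card big_mkcond [in RHS]big_mkcond /= -natz natr_sum.
      apply: eq_bigr => i _; rewrite -topredE /=; case bi : (b i); first by rewrite bT.
      by case: ifP.
    have Tc i : ch x i -> T x i by case/andP.
    have Tco i : co x i -> T x i by move=> c; have := tri i Vx; rewrite c; case: (T x i) => //; lia.
    have -> : \sum_(i | T x i) (ch x i && (rk x i < tgt x)%N)%:Z = (tgt x)%:Z.
      rewrite (tot (fun i => ch x i && (rk x i < tgt x)%N)); last by move=> i /andP[/Tc].
      by congr Posz; rewrite -[RHS](card_rank t1); apply: eq_card => i; rewrite !inE.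
    have -> : \sum_(i | T x i) (if odd N then N%:Z * (co x i && big_half x i)%:Z else (N./2)%:Z * (co x i)%:Z)
        = if odd N then N%:Z * #|[pred i | co x i && big_half x i]|%:Z else (N./2)%:Z * #|co x|%:Z.
      case: ifP => _; rewrite -mulr_sumr; first rewrite (tot (fun i => co x i && big_half x i)) //.
        by move=> i /andP[/Tco].
      by rewrite tot.
    have := cor Vx; rewrite /cs; case e : (pa x) => [i0|] /= c0.
      have -> : \sum_(i | T x i) (Some i0 == Some i)%:Z = 1.
        rewrite (bigD1 i0) /= ?eqxx; last exact: pa_T.
        by rewrite big1 ?addr0 // => j /andP[_ ij]; case: eqP => // -[e']; rewrite e' eqxx in ij.
      have -> : #|co x| = 0%N by apply: eq_card0 => j; rewrite -topredE /= c0.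
      have -> : #|[pred i | co x i && big_half x i]| = 0%N by apply: eq_card0 => j; rewrite !inE c0.
      by rewrite !mulr0 if_same addr0; lia.
    rewrite big1 //.
    case: ifP => oN; first by nia.
    by case/orP: c0 => /eqP ->; rewrite /= ?uphalf_half; lia.
move=> x Vx; have [oN|eN] := boolP (odd N).
  have -> // : tdeg (glue sol) x = 0%N.
  apply: eq_card0 => i; rewrite !inE; apply/negbTE/negP => /(T_glue Vx)[Ti].
  rewrite /sol oN; case: ifP => _; first by case: (v x); lia.
  case: ifP => _; first by case: (v _); lia.
  by case: ifP; lia.
have Tco i : fractional N (glue sol) x i = co x i.
  apply/idP/idP => [/(T_glue Vx)[Ti]|ci].
    have := tris x i Vx Ti; rewrite /sol; case: ifP => _; first by case: (v x); lia.
    by case: ifP => _ //; case: (v _); lia.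
  have Ti : T x i by have := tri i Vx; rewrite ci; case: (T x i) => //; lia.
  have := tri i Vx; rewrite ci Ti; rewrite /fractional /glue asboolT // Ti /= /sol (negbTE eN).
  case: (pa x == _); case: (ch x i) => // _; have := N0.
  by move: Ti; rewrite /fractional; lia.
have -> : tdeg (glue sol) x = #|co x| by apply: eq_card => i; rewrite !inE Tco -topredE.
have := cor Vx; case: (pa x) => [i0|] //= c0.
by have -> : #|co x| = 0%N by apply: eq_card0 => j; rewrite -topredE /= c0.
Qed.

End Solver.

(** * Moving the undecided chains into the core *)

Section Lines.
Hypothesis bV : bor V.
Variables (pa : X -> option 'I_d) (co : X -> 'I_d -> bool).
Hypothesis bpa : dbor pa.
Hypothesis bco : forall i, bor (fun x => co x i).
Hypothesis tri : forall x i, V x -> ((pa x == Some i) + ch pa x i + co x i = T x i)%N.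
Hypothesis cor : forall x, V x -> if pa x then forall i, co x i = false
  else (#|co x| == 0%N) || (#|co x| == 2%N).

(* The last child of its parent that may receive the value 1: its value depends
   on that of the parent. *)
Definition fav x := exists i j j', [/\ pa x = Some i, pa (g i x) = Some j,
  rv bg x i = j' & (rk pa (g i x) j').+1 = kp (g i x)].

Fixpoint favn n x : Prop :=
  if n is n'.+1 then fav x /\ exists i, pa x = Some i /\ favn n' (g i x) else True.

(** The vertices for which the recursion [vn] would never end: at every generation the value is
    asked of the next ancestor. *)
Definition Lam x := forall n, favn n x.

Let bLam : bor Lam.
Proof.
have bgi i : bfun (g i) by exact: (bg_borel bg).
apply: bor_all; elim => [|n IH]; first exact: bor_cst.
apply: bor_and.
  apply: bor_ex => i; apply: bor_ex => j; apply: bor_ex => j'.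
  apply: (@bor_ext _ _ (fun x => (pa x = Some i /\ pa (g i x) = Some j) /\
    (rv bg x i = j' /\ (rk pa (g i x) j').+1 = kp (g i x)))).
    by move=> x; split => [[[? ?] [? ?]]|[]].
  apply: bor_and; first by apply: bor_and; [exact: bpa|exact: (dbor_fun (bgi i) bpa)].
  apply: bor_and; first exact: bor_rv.
  apply: (dbor_pre (F := fun x => (rk pa (g i x) j', kp (g i x))) (fun q : nat * nat => q.1.+1 = q.2)).
  by apply: dbor_pair; [exact: (dbor_fun (bgi i) (dbor_rk bpa j'))|exact: (dbor_fun (bgi i) dbor_kp)].
apply: bor_ex => i; apply: bor_and; first exact: bpa.
exact: (bor_comp (P := favn n)).
Qed.

Let LamE x : Lam x <-> fav x /\ forall i, pa x = Some i -> Lam (g i x).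
Proof.
split=> [L|[fx L] [|n] //=].
  split; first by have [] := L 1%N.
  by move=> i e n; have [_ [j [e' +]]] := L n.+1; move: e'; rewrite e => -[->].
by split => //; have [i [j [j' [e _ _ _]]]] := fx; exists i; split => //; exact: L.
Qed.

(** Cutting the undecided chains out of the parent relation makes the recursion finite at every
    remaining vertex that has a parent. *)
Let pa' x := if `[< Lam x >] then None else pa x.
Let co' x i := co x i || T x i && ((pa x == Some i) && `[< Lam x >]
  || (pa (g i x) == Some (rv bg x i)) && `[< Lam (g i x) >]).

Let chLam x i : ch pa x i -> Lam (g i x) -> Lam x.
Proof.
by move=> /andP[_ /eqP e] /LamE[_ /(_ _ e)]; rewrite rvK.
Qed.

Let ch'E x i : ch pa' x i = ch pa x i && ~~ `[< Lam (g i x) >].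
Proof. by rewrite /ch /pa'; case: ifP => _; rewrite ?andbF ?andbT. Qed.

Let rk'E x j : ~ Lam x -> rk pa' x j = rk pa x j.
Proof.
move=> nL; rewrite /rk; congr index; apply: eq_enum => i; rewrite -!topredE /= ch'E.
case c : (ch pa x i) => //=; apply/negP => /asboolP; by move/(chLam c).
Qed.

Let fin' x n : V x -> pa' x -> ~ favn n x -> vn pa' co' n x.
Proof.
elim: n x => [|n IH] x Vx; first by move=> _ [].
rewrite {1}/pa'; case: asboolP => // nL; case e : (pa x) => [i|] // _ nf.
have Vy : V (g i x) by exact: (iV x i).1.
have e' : pa' x = Some i by rewrite /pa' asboolF.
rewrite /= e'; case: eqP => // /eqP pn; case: ifP => // r1; case: ifP => // r2.
have nLy : ~ Lam (g i x) by move=> L; move/negP: pn; apply; rewrite /pa' asboolT.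
have pay : pa' (g i x) = pa (g i x) by rewrite /pa' asboolF.
rewrite rk'E // in r1 r2.
have fx : fav x.
  case e2 : (pa (g i x)) => [j|]; last by rewrite pay e2 in pn.
  by exists i, j, (rv bg x i); split => //; lia.
have : vn pa' co' n (g i x).
  apply: IH => //; first by case: (pa' _) pn.
  by move=> fn; apply: nf; split => //; exists i.
by case: (vn pa' co' n (g i x)).
Qed.

(** [Lam] passes from a child to its parent, and from a parent to its child of rank [kp - 1] and to
    no other child. So a [Lam] vertex has exactly two core edges, to its parent and to that child,
    and any other vertex keeps its core edges. *)
Let cor' x : V x -> if pa' x then forall i, co' x i = false
  else (#|co' x| == 0%N) || (#|co' x| == 2%N).
Proof.
move=> Vx; rewrite {1}/pa'; case: asboolP => L /=; last first.
  have nch i : T x i && ((pa (g i x) == Some (rv bg x i)) && `[< Lam (g i x) >]) = false.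
    by rewrite andbA; apply/negP => /andP[c /asboolP /(chLam c)].
  have co'E i : co' x i = co x i by rewrite /co' (asboolF L) andbF /= nch orbF.
  have -> : co' x = co x by apply/funext.
  by have := cor Vx; case: (pa x).
have [[i0 [j [j' [e0 e1 e2 e3]]]] L'] := (LamE x).1 L.
have c0 : forall i, co x i = false by have := cor Vx; rewrite e0.
have Ti0 := pa_T tri Vx e0.
have d0 : (0 < tdeg f x)%N by apply/card_gt0P; exists i0.
have kb := kp_bounds Vx d0; have := tdeg_split tri Vx; rewrite e0 /=.
have -> : #|co x| = 0%N by apply: eq_card0 => i; rewrite -topredE /= c0.
(* A child of rank [kp - 1] exists because [kp < tdeg] and [tdeg = 1 + #|ch pa x|]. *)
move=> dE; have sz : ((kp x).-1 < size (enum (ch pa x)))%N by rewrite -cardE; move: kb; rewrite dE => /andP[k0 k1]; rewrite prednK //; move: k1; rewrite addn0 add1n ltnS.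
pose i1 := nth i0 (enum (ch pa x)) (kp x).-1.
have ci1 : ch pa x i1 by have := mem_nth i0 sz; rewrite mem_enum.
have ri1 : rk pa x i1 = (kp x).-1 by rewrite /rk index_uniq // enum_uniq.
have LamC i : ch pa x i -> `[< Lam (g i x) >] = (i == i1).
  move=> ci; have /andP[_ /eqP ei] := ci; apply/asboolP/eqP => [Li|->].
    have [[a [b [b' [ea eb eb' ek]]]] _] := (LamE _).1 Li.
    move: ea; rewrite ei => -[ea]; subst a; move: eb eb' ek; rewrite rvK rv_rv => _ <- ek.
    have ri : rk pa x i = (kp x).-1 by lia.
    have ii : i \in enum (ch pa x) by rewrite mem_enum.
    by rewrite -(nth_index i0 ii) -/(rk pa x i) ri.
  have /andP[_ /eqP ei1] := ci1; apply/LamE; split.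
    exists (rv bg x i1), i0, i1; rewrite rvK rv_rv; split => //; rewrite ri1; lia.
  by move=> a; rewrite ei1 => -[<-]; rewrite rvK.
apply/orP; right; have -> : #|co' x| = #|pred2 i0 i1|.
  apply: eq_card => i; rewrite -!topredE /= /co' c0 /= (asboolT L) andbT e0 andb_orr andbA.
  rewrite -/(ch pa x i); have [->|ne] := eqVneq i i0; first by rewrite eqxx Ti0.
  have -> : (Some i0 == Some i) = false by apply/eqP => -[e]; rewrite e eqxx in ne.
  rewrite andbF /=; case ci : (ch pa x i); first by rewrite LamC.
  by symmetry; apply/negP => /eqP e; rewrite e ci1 in ci.
rewrite card2; suff -> : i0 != i1 by [].
apply/eqP => e; have := tri i0 Vx; rewrite {2}e ci1 e0 eqxx; case: (T x i0) => //; lia.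
Qed.

Lemma lines_solver : exists f', Sol bg N kap f' V /\
  forall x, V x -> (tdeg f' x == 0%N) || (tdeg f' x == 2%N).
Proof.
have [bf sy _ _] := sf; have bgi i : bfun (g i) by exact: (bg_borel bg).
have bL : bor (fun x => `[< Lam x >]) by apply: bor_ext bLam => x; split => /asboolP.
have bpr i : bor (fun x => pa (g i x) == Some (rv bg x i)).
  apply: (@bor_ext _ _ (fun x => exists j, pa (g i x) = Some j /\ rv bg x i = j)).
    by move=> x; split => [[j [-> ->]]//|/eqP e]; exists (rv bg x i).
  by apply: bor_ex => j; apply: bor_and; [exact: (dbor_fun (bgi i) bpa)|exact: bor_rv].
apply: (@solver bV pa' co').
- by apply: dbor_if => // t; exact: bor_cst.
- move=> i; apply: (@bor_ext _ _ (fun x => co x i \/ (T x i /\ ((pa x = Some i /\ `[< Lam x >]) \/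
    (pa (g i x) == Some (rv bg x i) /\ `[< Lam (g i x) >]))))).
    move=> x; rewrite /co'; split.
      by case=> [->//|[-> [[-> ->]|[-> ->]]]]; rewrite ?eqxx ?orbT.
    case/orP => [|/andP[Ti /orP[/andP[/eqP]|/andP[]]]]; first by left.
      by right; split => //; left.
    by right; split => //; right.
  apply: bor_or => //; apply: bor_and; first by apply: bor_T => //; exact: bfun_id.
  apply: bor_or; first by apply: bor_and => //; exact: bpa.
  by apply: bor_and => //; apply: (bor_comp (P := fun x => is_true `[< Lam x >])).
- move=> x i Vx; rewrite ch'E /co' /pa'; have := tri i Vx.
  have pc : T x i -> (pa (g i x) == Some (rv bg x i)) = ch pa x i by move=> Ti; rewrite /ch Ti.
  case Ti : (T x i) pc => pc; last first.
    case: asboolP => _; case: (pa x == _); case: (ch pa x i); case: (co x i) => //=.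
  rewrite pc //; case: (asboolP (Lam x)) => Lx; case: (asboolP (Lam (g i x))) => Ly;
    by case: (pa x == _); case: (ch pa x i); case: (co x i).
- exact: cor'.
- move=> x Vx px; have nL : ~ Lam x by move=> L; move: px; rewrite /pa' asboolT.
  have [n nf] : exists n, ~ favn n x by apply: contrapT => hn; apply: nL => n; apply: contrapT => nf; apply: hn; exists n.
  by exists n; exact: fin'.
Qed.

End Lines.
End Forest.

(** * Borel descriptions of paths in the forest *)

Section BorelPaths.
Local Open Scope ring_scope.
Variables (disp : measure_display) (X : measurableType disp) (d : nat).
Variables (g : 'I_d -> X -> X) (U : nat -> set X) (lt : X -> X -> Prop).
Hypothesis bg : bgraph g U lt.
Variables (N : nat) (f : X -> 'I_d -> int).
Hypothesis bf : forall i, dbor (f^~ i).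
Local Notation T := (fractional N f).

(** A path from [y] avoiding [x], coded by its word of slots: there are countably many words, so
    existence of a path becomes Borel. *)
Fixpoint okw x y (w : seq 'I_d) : Prop :=
  y <> x /\ if w is i :: w' then T y i /\ okw x (g i y) w' else True.

Fixpoint tkw y (w : seq 'I_d) : Prop :=
  if w is i :: w' then T y i /\ tkw (g i y) w' else True.

Lemma sideE x y c : side g N f x y c <-> exists w, okw x y w /\ act g w y = c.
Proof.
split=> [[s [ps ns <-]]|[w [ow <-]]].
  elim: s y ps ns => [|z s IH] y /=.
    by move=> _; rewrite inE eq_sym => /eqP n; exists [::].
  move=> /andP[/eTP[i [e Ti]] ps]; rewrite inE negb_or eq_sym => /andP[/eqP n ns].
  by have [w [ow aw]] := IH z ps ns; exists (i :: w); rewrite /= e.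
elim: w y ow => [|i w IH] y /=; first by move=> [n _]; exists [::]; rewrite /= inE eq_sym; split => //; apply/eqP.
move=> [n [Ti /IH[s [ps ns ls]]]]; exists (g i y :: s); split => //=.
  by rewrite ps andbT; apply/eTP; exists i.
by rewrite inE negb_or ns andbT eq_sym; apply/eqP.
Qed.

Lemma tcE x c : tc g N f x c <-> exists w, tkw x w /\ act g w x = c.
Proof.
split=> [[s [ps <-]]|[w [ow <-]]].
  elim: s x ps => [|z s IH] y /=; first by exists [::].
  move=> /andP[/eTP[i [e Ti]] ps].
  by have [w [ow aw]] := IH z ps; exists (i :: w); rewrite /= e.
elim: w x ow => [|i w IH] y /=; first by exists [::].
move=> [Ti /IH[s [ps ls]]]; exists (g i y :: s); split => //=.
by rewrite ps andbT; apply/eTP; exists i.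
Qed.

Lemma tc_act x c : tc g N f x c -> exists w, act g w x = c.
Proof. by move=> /tcE[w [_ e]]; exists w. Qed.

Lemma bor_tkw w h : bfun h -> bor (fun x => tkw (h x) w).
Proof.
elim: w h => [|i w IH] h bh /=; first exact: bor_cst.
by apply: bor_and; [exact: bor_T|apply: IH; exact: (bfun_g bg)].
Qed.

Lemma bor_okw w h h' : bfun h -> bfun h' -> bor (fun x => okw (h x) (h' x) w).
Proof.
elim: w h' => [|i w IH] h' bh bh' /=.
  by apply: bor_and; [apply: bor_not; exact: (bor_eq bg)|exact: bor_cst].
apply: bor_and; first by apply: bor_not; exact: (bor_eq bg).
by apply: bor_and; [exact: bor_T|apply: IH => //; exact: (bfun_g bg)].
Qed.

Lemma bor_side h1 h2 h3 : bfun h1 -> bfun h2 -> bfun h3 ->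
  bor (fun x => side g N f (h1 x) (h2 x) (h3 x)).
Proof.
move=> b1 b2 b3.
apply: (@bor_ext _ _ (fun x => exists w, okw (h1 x) (h2 x) w /\ act g w (h2 x) = h3 x)).
  by move=> x; split => /sideE.
apply: bor_ex => w; apply: bor_and; first exact: bor_okw.
by apply: (bor_eq bg) => //; exact: (bfun_act bg).
Qed.

Lemma bor_tc h1 h2 : bfun h1 -> bfun h2 -> bor (fun x => tc g N f (h1 x) (h2 x)).
Proof.
move=> b1 b2.
apply: (@bor_ext _ _ (fun x => exists w, tkw (h1 x) w /\ act g w (h1 x) = h2 x)).
  by move=> x; split => /tcE.
apply: bor_ex => w; apply: bor_and; first exact: bor_tkw.
by apply: (bor_eq bg) => //; exact: (bfun_act bg).
Qed.

End BorelPaths.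

(* [up x i]: edge [i] points towards the end or vertex chosen by [x]; [tie]: its two
   endpoints do not prefer either direction. *)
Section Ends.
Local Open Scope ring_scope.
Variables (disp : measure_display) (X : measurableType disp) (d : nat).
Variables (g : 'I_d -> X -> X) (U : nat -> set X) (lt : X -> X -> Prop).
Hypothesis bg : bgraph g U lt.
Variables (N kap : nat) (f : X -> 'I_d -> int) (V : X -> Prop).
Hypothesis N0 : (0 < N)%N.
Hypothesis bV : bor V.
Hypothesis iV : inv g V.
Hypothesis sf : Sol bg N kap f V.
Hypothesis af : acyclic_on g N f V.
Local Notation T := (fractional N f).
Local Notation eT := (eT g N f).
Local Notation tc := (tc g N f).
Local Notation side := (side g N f).

Variables up tie : X -> 'I_d -> bool.
Hypothesis bup : forall i, bor (fun x => up x i).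
Hypothesis btie : forall i, bor (fun x => tie x i).
Hypothesis upT : forall x i, V x -> up x i -> T x i.
Hypothesis tieT : forall x i, V x -> tie x i -> T x i.
Hypothesis ut1 : forall x i, V x -> T x i ->
  (up x i + up (g i x) (rv bg x i) + tie x i = 1)%N.
Hypothesis tieC : forall x i, V x -> tie (g i x) (rv bg x i) = tie x i.
Hypothesis up1 : forall x i j, V x -> up x i -> up x j -> i = j.
Hypothesis upt : forall x i j, V x -> up x i -> tie x j = false.
Hypothesis tie2 : forall x, V x -> (#|tie x| <= 2)%N.

Let upv x y := [exists i, (g i x == y) && up x i].
Let tiev x y := [exists i, (g i x == y) && tie x i].
Let np x := [forall i, ~~ up x i].
(** In each tree the vertices without an up edge, if any, form a path of ties that may be finite,
    half-infinite or infinite both ways; [ep] marks its endpoints. *)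
Let ep x := np x && (#|tie x| <= 1)%N.

Let upvE x i : upv x (g i x) = up x i.
Proof.
apply/existsP/idP => [[j /andP[/eqP /(bg_inj bg) ->]]//|ui].
by exists i; rewrite eqxx.
Qed.

Let tievE x i : tiev x (g i x) = tie x i.
Proof.
apply/existsP/idP => [[j /andP[/eqP /(bg_inj bg) ->]]//|ui].
by exists i; rewrite eqxx.
Qed.

Let upvE' x i : upv (g i x) x = up (g i x) (rv bg x i).
Proof. by rewrite -upvE rvK. Qed.

Let tri x y : V x -> eT x y -> (upv x y + upv y x + tiev x y = 1)%N.
Proof. by move=> Vx /eTP[i [<- Ti]]; rewrite upvE upvE' tievE ut1. Qed.

Let tievC x y : V x -> tiev x y -> tiev y x.
Proof.
by move=> Vx /existsP[i /andP[/eqP <- ti]]; rewrite -{2}(rvK bg x i) tievE tieC.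
Qed.

Let tiev_eT x y : V x -> tiev x y -> eT x y.
Proof. by move=> Vx /existsP[i /andP[/eqP <- ti]]; apply/eTP; exists i; rewrite tieT. Qed.

Let tie_np x y : V x -> tiev x y -> np x.
Proof.
move=> Vx /existsP[i /andP[_ ti]]; apply/forallP => j; apply/negP => uj.
by rewrite (upt i Vx uj) in ti.
Qed.

(** The only up edge of [b] goes back to [a] and excludes ties at [b], so the next edge must point
    back to [b], and so on along the path. *)
Let up_chain s a b : V b -> eT a b -> upv b a -> path eT b s -> uniq [:: a, b & s] ->
  ~~ np (last b s).
Proof.
elim: s a b => [|c s IH] a b Vb ab ub.
  by move=> _ _; apply/negP => /forallP h; case/existsP: ub => i /andP[_ ui]; have := h i; rewrite ui.
move=> /= /andP[bc ps] /andP[na ub']; apply: (IH b c) => //; first exact: (eTV iV Vb bc).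
have := tri Vb bc; case/existsP: ub => i /andP[/eqP ei ui].
have -> : upv b c = false.
  apply/existsP => -[j /andP[/eqP ej uj]]; move: na.
  by rewrite -ei -ej (up1 Vb ui uj) !inE eqxx orbT.
have -> : tiev b c = false.
  by apply/existsP => -[j /andP[_ tj]]; rewrite (upt j Vb ui) in tj.
by case: (upv c b).
Qed.

(** The first edge is not up from [x], and if it pointed to [x], then by [up_chain] the far end
    would have an up edge. *)
Let np_path s x : V x -> path eT x s -> uniq (x :: s) -> np x -> np (last x s) -> path tiev x s.
Proof.
elim: s x => [//|y s IH] x Vx /= /andP[xy ps] /andP[nx us] px pl.
have Vy := eTV iV Vx xy.
have ty : tiev x y.
  have := tri Vx xy.
  have -> : upv x y = false.
    by apply/existsP => -[j /andP[_ uj]]; move/forallP/(_ j): px; rewrite uj.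
  case uy : (upv y x); last by case: (tiev x y).
  by have := up_chain Vy xy uy ps; rewrite pl /= nx us => /(_ isT).
rewrite ty /=; apply: IH => //; exact: tie_np (tievC Vx ty).
Qed.

Let tie_card y l : uniq l -> all (tiev y) l -> (size l <= #|tie y|)%N.
Proof.
move=> ul /allP tl; rewrite cardE -(size_map (g^~ y)); apply: uniq_leq_size => // z /tl.
by move=> /existsP[i /andP[/eqP <- ti]]; apply: map_f; rewrite mem_enum.
Qed.

(** By [tie2] the way on is unique at each vertex, and a path of ties that could still go on has not
    reached a vertex with a single tie. *)
Let ep_path s t x y : V x -> tiev x y -> path tiev y s -> path tiev y t ->
  uniq [:: x, y & s] -> uniq [:: x, y & t] ->
  (#|tie (last y s)| <= 1)%N -> (#|tie (last y t)| <= 1)%N -> last y s = last y t.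
Proof.
elim: s t x y => [|z s IH] [|z' t] x y Vx xy //.
- move=> _ /= /andP[yz _] _ /andP[]; rewrite !inE !negb_or => /and3P[_ xz _] _ c1 _.
  have := @tie_card y [:: x; z']; rewrite /= (tievC Vx xy) yz !inE xz => /(_ isT isT) c2.
  by have := leq_trans c2 c1.
- move=> /= /andP[yz _] _ /andP[]; rewrite !inE !negb_or => /and3P[_ xz _] _ _ _ c1.
  have := @tie_card y [:: x; z]; rewrite /= (tievC Vx xy) yz !inE xz => /(_ isT isT) c2.
  by have := leq_trans c2 c1.
move=> /= /andP[yz ps] /andP[yz' pt] us ut.
have Vy := eTV iV Vx (tiev_eT Vx xy).
have zz : z = z'.
  apply: contrapT => /eqP ne; move: us ut => /andP[]; rewrite !inE !negb_or => /and3P[_ xz _] _.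
  move=> /andP[/and3P[_ xz' _] _].
  have := @tie_card y [:: x; z; z']; rewrite /= (tievC Vx xy) yz yz' !inE negb_or xz xz' ne.
  by move=> /(_ isT isT) c3; have := leq_trans c3 (tie2 Vy).
subst z'; move: us ut => /andP[_ us] /andP[_ ut]; exact: (IH t y z).
Qed.

Let sideU x y c : side x y c -> exists s, [/\ path eT y s, uniq [:: x, y & s] & last y s = c].
Proof.
move=> [s [ps ns ls]]; case: (shortenP ps) ls => s' ps' us sub ls; exists s'; split => //=.
move: us => /= ->; rewrite andbT; apply: contra ns; rewrite !inE => /orP[->//|/sub ->].
by rewrite orbT.
Qed.

Let beyond x y b := side x y b /\ ep b.

Let beyond_uniq x y b b' : V x -> tiev x y -> beyond x y b -> beyond x y b' -> b = b'.
Proof.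
move=> Vx xy [/sideU[s [ps us <-]] /andP[n1 c1]] [/sideU[t [pt ut <-]] /andP[n2 c2]].
have xy' := tiev_eT Vx xy; have Vy := eTV iV Vx xy'.
have ny : np y by exact: tie_np (tievC Vx xy).
by apply: (ep_path (x := x)) => //; apply: np_path => //; [case/andP: us|case/andP: ut].
Qed.

(** The tie points to an endpoint of its path. If there are two, the [lt]-larger one wins, so that
    all ties of the path point to the same vertex. *)
Let ori x y := exists b, beyond x y b /\ forall a, beyond y x a -> lt a b.

Let has_ep x := exists c, tc x c /\ ep c.

Let ori_ex x y : V x -> tiev x y -> has_ep x -> ori x y \/ ori y x.
Proof.
move=> Vx xy; have xy' := tiev_eT Vx xy; have Vy := eTV iV Vx xy'.
have yx := tievC Vx xy.
wlog : x y Vx Vy xy xy' yx / exists b, beyond x y b.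
  move=> wl [c [xc pc]]; have [s|s] := side_or bg xy' xc.
    by apply: wl => //; [exists c|exists c].
  rewrite or_comm; apply: wl => //; first by rewrite (eT_sym sf).
    by exists c.
  by exists c; split => //; apply: tc_trans xc; apply: tc1; rewrite (eT_sym sf).
move=> [b xb] _; have [[a ya]|na] := pselect (exists a, beyond y x a); last first.
  by left; exists b; split => // a ya; case: na; exists a.
have ab : a <> b.
  by move=> e; case: xb => + _; case: ya => + _; rewrite e => h1 h2; exact: (side_not N0 iV sf af Vx xy' h2 h1).
have [l|l] := bg_ltC bg ab; [left; exists b|right; exists a]; split => //.
  by move=> a' /(beyond_uniq Vy yx ya) <-.
by move=> b' /(beyond_uniq Vx xy xb) <-.
Qed.

Let ori_anti x y : ori x y -> ori y x -> False.
Proof.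
move=> [b [xb hb]] [a [ya ha]]; have := bg_ltT bg (hb _ ya) (ha _ xb).
exact: (bg_ltI bg).
Qed.

Let ori_has x y : V x -> tiev x y -> ori x y -> has_ep x.
Proof.
move=> Vx xy [b [[sb pb] _]]; exists b; split => //.
by apply: tc_trans (side_tc sb); apply: tc1; exact: tiev_eT.
Qed.

Let ori_inj x y z : V x -> tiev x y -> tiev x z -> ori x y -> ori x z -> y = z.
Proof.
move=> Vx xy xz [b [xb hb]] [c [xc hc]]; apply: contrapT => ne.
have ey := tiev_eT Vx xy; have ez := tiev_eT Vx xz.
have [[sb pb] [sc pc]] := (xb, xc).
have tb : tc x b by apply: tc_trans (side_tc sb); exact: tc1.
have tcc : tc x c by apply: tc_trans (side_tc sc); exact: tc1.
have yc : beyond y x c.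
  split => //; have [s|//] := side_or bg ey tcc.
  by case: ne; exact: (side_inj N0 iV sf af Vx ey ez s sc).
have zb : beyond z x b.
  split => //; have [s|//] := side_or bg ez tb.
  by case: ne; exact: (side_inj N0 iV sf af Vx ey ez sb s).
exact: (bg_ltI bg (bg_ltT bg (hb _ yc) (hc _ zb))).
Qed.

Let arrow x i := up x i || tie x i && `[< ori x (g i x) >].
Let pa x := [pick i | arrow x i].
(** Without endpoints the ties form a line, which has no preferred direction. *)
Let co x i := tie x i && `[< ~ has_ep x >].

Let arrow1 x i j : V x -> arrow x i -> arrow x j -> i = j.
Proof.
move=> Vx /orP[ui|/andP[ti /asboolP oi]] /orP[uj|/andP[tj /asboolP oj]].
- exact: up1 ui uj.
- by rewrite (upt j Vx ui) in tj.
- by rewrite (upt i Vx uj) in ti.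
- by apply: (bg_inj bg (x := x)); apply: ori_inj oi oj => //; rewrite tievE.
Qed.

Let paE x i : V x -> (pa x == Some i) = arrow x i.
Proof.
move=> Vx; rewrite /pa; case: pickP => [j aj|na]; last by rewrite na.
by apply/eqP/idP => [[<-]//|ai]; rewrite (arrow1 Vx ai aj).
Qed.

Let bor_np h : bfun h -> bor (fun x => np (h x)).
Proof.
move=> bh; apply: (@bor_ext _ _ (fun x => forall i, ~ up (h x) i)).
  by move=> x; split => [u|/forallP u] => [|i]; [apply/forallP => i; apply/negP; exact: u|apply/negP].
by apply: bor_all => i; apply: bor_not; apply: (bor_comp (P := fun x => is_true (up x i))).
Qed.

Let bor_ep h : bfun h -> bor (fun x => ep (h x)).
Proof.
move=> bh; apply: (@bor_ext _ _ (fun x => np (h x) /\ (#|tie (h x)| <= 1)%N)).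
  by move=> x; split => /andP.
apply: bor_and; first exact: bor_np.
apply: (bor_comp (P := fun x => is_true (#|tie x| <= 1)%N)) => //.
have dt : dbor (fun x => [ffun i => tie x i]).
  move=> t; apply: (@bor_ext _ _ (fun x => forall i, tie x i = t i)).
    move=> x; split => [e|<- i]; last by rewrite ffunE.
    by apply/ffunP => i; rewrite ffunE.
  by apply: bor_all => i; exact: (dbor_bool (btie i)).
apply: bor_ext (dbor_pre (fun F : {ffun 'I_d -> bool} => is_true (#|[pred i | F i]| <= 1)%N) dt) => x.
by rewrite (_ : #|[pred i | [ffun i => tie x i] i]| = #|tie x|) //; apply: eq_card => i; rewrite -!topredE /= ffunE.
Qed.

Let bor_ori i : bor (fun x => ori x (g i x)).
Proof.
have [bf _ _ _] := sf; have bid := @bfun_id _ X; have bgi : bfun (g i) by exact: (bg_borel bg).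
have ba w : bfun (act g w) by exact: (bfun_act bg w bid).
apply: (@bor_ext _ _ (fun x => exists w, beyond x (g i x) (act g w x) /\
  forall w', beyond (g i x) x (act g w' x) -> lt (act g w' x) (act g w x))).
  move=> x; split => [[w [bw hw]]|[b [xb hb]]].
    exists (act g w x); split => // a xa; have [[sa _] ] := (xa, tt).
    by have [w' e] := tc_act (side_tc sa); move: (hw w'); rewrite e => /(_ xa).
  have [[sb _] _] := (xb, tt); have [w e] := tc_act (side_tc sb).
  by exists (i :: w); rewrite /= e; split => // w' /hb.
apply: bor_ex => w; apply: bor_and.
  by apply: bor_and; [exact: (bor_side bg N bf)|exact: bor_ep].
apply: bor_all => w'; apply: bor_imp; last exact: (bg_ltB bg).
by apply: bor_and; [exact: (bor_side bg N bf)|exact: bor_ep].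
Qed.

Let bor_has : bor has_ep.
Proof.
have [bf _ _ _] := sf; have bid := @bfun_id _ X.
have ba w : bfun (act g w) by exact: (bfun_act bg w bid).
apply: (@bor_ext _ _ (fun x => exists w, tc x (act g w x) /\ ep (act g w x))).
  move=> x; split => [[w [t p]]|[c [t p]]]; first by exists (act g w x).
  by have [w e] := tc_act t; exists w; rewrite e.
by apply: bor_ex => w; apply: bor_and; [exact: (bor_tc bg N bf)|exact: bor_ep].
Qed.

Lemma ends_solver : exists f', Sol bg N kap f' V /\
  forall x, V x -> (tdeg N f' x == 0%N) || (tdeg N f' x == 2%N).
Proof.
have ba i : bor (fun x => arrow x i).
  apply: (@bor_ext _ _ (fun x => up x i \/ tie x i /\ ori x (g i x))).
    move=> x; rewrite /arrow; split => [[->//|[-> o]]|]; first by rewrite asboolT ?orbT.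
    by case/orP => [|/andP[? /asboolP]]; [left|right].
  by apply: bor_or => //; apply: bor_and => //; exact: bor_ori.
apply: (@lines_solver _ _ _ _ _ _ bg N kap f V N0 iV sf bV pa co).
- have dt : dbor (fun x => [ffun i => arrow x i]).
    move=> t; apply: (@bor_ext _ _ (fun x => forall i, arrow x i = t i)).
      move=> x; split => [e|<- i]; last by rewrite ffunE.
      by apply/ffunP => i; rewrite ffunE.
    by apply: bor_all => i; exact: (dbor_bool (ba i)).
  have {}dt := dbor_comp (fun F : {ffun 'I_d -> bool} => [pick i | F i]) dt.
  move=> t; apply: bor_ext (dt t) => x; rewrite /pa.
  by rewrite (_ : [pick i | [ffun i => arrow x i] i] = [pick i | arrow x i]) //; apply: eq_pick => i; rewrite ffunE.
- move=> i; apply: (@bor_ext _ _ (fun x => tie x i /\ ~ has_ep x)).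
    by move=> x; rewrite /co; split => [[-> /asboolT ->]|/andP[? /asboolP]].
  by apply: bor_and => //; apply: bor_not; exact: bor_has.
- move=> x i Vx; rewrite paE // /ch /co.
  have Vy : V (g i x) by exact: (iV x i).1.
  case Ti : (T x i); last first.
    have -> : arrow x i = false.
      by apply/negP => /orP[/(upT Vx)|/andP[/(tieT Vx)]]; rewrite Ti.
    by have -> : tie x i = false by apply/negP => /(tieT Vx); rewrite Ti.
  have := ut1 Vx Ti; rewrite paE // /arrow rvK tieC //.
  case t : (tie x i); last by case: (up x i); case: (up _ _).
  have xy : tiev x (g i x) by rewrite tievE.
  have [E|nE] := pselect (has_ep x).
    rewrite (@asboolF (~ has_ep x)); last by move=> /(_ E).
    have := ori_ex Vx xy E; have an := @ori_anti x (g i x).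
    by case: (asboolP (ori x _)) => o1; case: (asboolP (ori (g i x) _)) => o2;
      case: (up x i); case: (up _ _) => //; tauto.
  have o1 : ~ ori x (g i x) by move=> o; apply: nE; exact: ori_has o.
  have o2 : ~ ori (g i x) x.
    move=> o; apply: nE; have [c [yc pc]] := ori_has Vy (tievC Vx xy) o.
    by exists c; split => //; apply: tc_trans yc; apply: tc1; exact: tiev_eT.
  by rewrite (asboolT nE) (asboolF o1) (asboolF o2); case: (up x i); case: (up _ _).
- move=> x Vx; rewrite /pa; case: pickP => [i ai|na] /=.
    move=> j; apply/negP => /andP[tj /asboolP nE].
    case/orP: ai => [ui|/andP[ti /asboolP o]]; first by rewrite (upt j Vx ui) in tj.
    by apply: nE; apply: ori_has o => //; rewrite tievE.
  have [E|nE] := pselect (has_ep x).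
    have -> // : #|co x| = 0%N.
    by apply: eq_card0 => i; rewrite -topredE /= /co (@asboolF (~ _)) ?andbF // => /(_ E).
  have -> : #|co x| = #|tie x| by apply: eq_card => i; rewrite -!topredE /= /co asboolT ?andbT.
  have nx : np x by apply/forallP => i; have := na i; rewrite /arrow; case: (up x i).
  have : ~ ep x by move=> p; apply: nE; exists x; split => //; exact: tc_refl.
  by rewrite /ep nx /= => /negP; have := tie2 Vx; lia.
Qed.

End Ends.

(** * Mean directions in a hyperfinite forest *)

Lemma Sol_sub (disp : measure_display) (X : measurableType disp) (d : nat)
    (g : 'I_d -> X -> X) (U : nat -> set X) (lt : X -> X -> Prop)
    (bg : bgraph g U lt) (N kap : nat) f (V V' : X -> Prop) :
  (forall x, V' x -> V x) -> Sol bg N kap f V -> Sol bg N kap f V'.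
Proof. by move=> s [h1 h2 h3 h4]; split => // x /s; exact: h4. Qed.

Lemma acyclic_sub (disp : measure_display) (X : measurableType disp) (d : nat)
    (g : 'I_d -> X -> X) (N : nat) f (V V' : X -> Prop) :
  (forall x, V' x -> V x) -> acyclic_on g N f V -> acyclic_on g N f V'.
Proof. by move=> s h p pV; apply: h => x /pV /s. Qed.

Lemma least_in (X : eqType) (lt : X -> X -> Prop) (P : X -> Prop) (s : seq X) :
  (forall x, ~ lt x x) -> (forall x y z, lt x y -> lt y z -> lt x z) ->
  (exists2 y, y \in s & P y) ->
  exists2 c, P c & forall c', c' \in s -> P c' -> ~ lt c' c.
Proof.
move=> I Tr; elim: s => [[y]//|a s IH] [y].
have [hs _|ns] := pselect (exists2 y, y \in s & P y).
  have [c Pc hc] := IH hs; move=> _; have [[Pa ac]|n] := pselect (P a /\ lt a c).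
    exists a => // c'; rewrite inE => /orP[/eqP -> _|c's Pc' c'a]; first exact: I.
    exact: (hc c' c's Pc' (Tr _ _ _ c'a ac)).
  by exists c => // c'; rewrite inE => /orP[/eqP -> Pa l|/hc//]; apply: n.
rewrite inE => /orP[/eqP -> Pa|ys Py]; last by case: ns; exists y.
exists a => // c'; rewrite inE => /orP[/eqP -> _|c's Pc']; first exact: I.
by case: ns; exists c'.
Qed.

Section Mean.
Local Open Scope ring_scope.
Variables (R : realType) (disp : measure_display) (X : measurableType disp).
Variable mu : probability X R.
Variables (d : nat) (g : 'I_d -> X -> X) (U : nat -> set X) (lt : X -> X -> Prop).
Hypothesis bg : bgraph g U lt.
Variables (N kap : nat) (f : X -> 'I_d -> int) (V : X -> Prop).
Hypothesis N0 : (0 < N)%N.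
Hypothesis bV : bor V.
Hypothesis iV : inv g V.
Hypothesis cV : conull mu V.
Hypothesis sf : Sol bg N kap f V.
Hypothesis af : acyclic_on g N f V.
Local Notation T := (fractional N f).
Local Notation tc := (tc g N f).
Local Notation side := (side g N f).

Variable E : nat -> X -> X -> Prop.
Hypothesis bE : forall n h h', bfun h -> bfun h' -> bor (fun x => E n (h x) (h' x)).
Hypothesis Erefl : forall n x, E n x x.
Hypothesis Esym : forall n x y, E n x y -> E n y x.
Hypothesis Etrans : forall n x y z, E n x y -> E n y z -> E n x z.
Hypothesis Efin : forall n x, exists s : seq X, forall y, E n x y -> y \in s.
Hypothesis Emon : forall x i, V x -> exists n0, forall n, (n0 <= n)%N -> E n x (g i x).

(** The target of [x]: the [lt]-least vertex of its finite class inside its tree. Vertices of one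
    tree in the same class share it. *)
Let cn n x c := [/\ E n x c, tc x c & forall c', E n x c' -> tc x c' -> ~ lt c' c].

Let cn_ex n x : exists c, cn n x c.
Proof.
have [s hs] := Efin n x.
have [|c [h1 h2] h3] := @least_in X lt (fun y => E n x y /\ tc x y) s (bg_ltI bg) (bg_ltT bg).
  by exists x; [exact: hs|split => //; exact: tc_refl].
by exists c; split => // c' e t; apply: h3 => //; exact: hs.
Qed.

Let cn_uniq n x c c' : cn n x c -> cn n x c' -> c = c'.
Proof.
move=> [h1 h2 h3] [h1' h2' h3']; apply: contrapT => /(bg_ltC bg)[l|l].
  exact: (h3' c).
exact: (h3 c').
Qed.

Let cn_eq n x y c : E n x y -> tc x y -> cn n x c -> cn n y c.
Proof.
move=> e t [h1 h2 h3]; have t' := tc_sym sf t; split.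
- exact: Etrans (Esym e) h1.
- exact: tc_trans t' h2.
- by move=> c' e' tc'; apply: h3; [exact: Etrans e e'|exact: tc_trans t tc'].
Qed.

Let D n x i := T x i && `[< exists c, cn n x c /\ side x (g i x) c >].

Let bD n i : bor (fun x => D n x i).
Proof.
have [bf _ _ _] := sf; have bid := @bfun_id _ X; have bgi : bfun (g i) by exact: (bg_borel bg).
have ba w : bfun (act g w) by exact: (bfun_act bg w bid).
apply: (@bor_ext _ _ (fun x => T x i /\ exists w, ((E n x (act g w x) /\ tc x (act g w x)) /\
   forall w', E n x (act g w' x) -> tc x (act g w' x) -> ~ lt (act g w' x) (act g w x)) /\
   side x (g i x) (act g w x))).
  move=> x; rewrite /D; split.
    move=> [-> [w [[[h1 h2] h3] sw]]]; apply/asboolP; exists (act g w x); split => //.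
    by split => // c' e t; have [w' ew] := tc_act t; rewrite -ew; apply: h3; rewrite ew.
  move=> /andP[-> /asboolP[c [[h1 h2 h3] sc]]]; split => //.
  by have [w ew] := tc_act h2; exists w; rewrite ew; split => //; split => // w'; exact: h3.
apply: bor_and; first exact: (bor_T N i bf bid).
apply: bor_ex => w; apply: bor_and; last exact: (bor_side bg N bf).
apply: bor_and; first by apply: bor_and; [exact: bE|exact: (bor_tc bg N bf)].
apply: bor_all => w'; apply: bor_imp; first exact: bE.
by apply: bor_imp; [exact: (bor_tc bg N bf)|apply: bor_not; exact: (bg_ltB bg)].
Qed.

Let eTi x i : T x i -> eT g N f x (g i x).
Proof. by move=> Ti; apply/eTP; exists i. Qed.

Let D_uniq n x i j : V x -> D n x i -> D n x j -> i = j.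
Proof.
move=> Vx /andP[Ti /asboolP[c [hc sc]]] /andP[Tj /asboolP[c' [hc' sc']]].
rewrite (cn_uniq hc' hc) in sc'.
apply: (bg_inj bg (x := x)); exact: (side_inj N0 iV sf af Vx (eTi Ti) (eTi Tj) sc sc').
Qed.

(** Both ends have the same target, which lies on exactly one side of the edge. *)
Let D_rev n x i : V x -> T x i -> E n x (g i x) ->
  (D n x i + D n (g i x) (rv bg x i) = 1)%N.
Proof.
move=> Vx Ti e; have [_ sy _ _] := sf; have [c hc] := cn_ex n x.
have t := tc1 (eTi Ti); have hc' := cn_eq e t hc.
rewrite /D Ti T_sym // Ti rvK /=.
have [_ tcc _] := hc.
have e1 z i' : cn n z c -> `[< exists c, cn n z c /\ side z i' c >] = `[< side z i' c >].
  move=> hz; apply/asboolP/asboolP => [[c' [h s]]|s]; last by exists c.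
  by rewrite (cn_uniq hz h).
rewrite !e1 //; have := side_or bg (eTi Ti) tcc.
have := side_not N0 iV sf af Vx (eTi Ti) (c := c).
by case: (asboolP (side x _ _)) => s1; case: (asboolP (side (g i x) _ _)) => s2 //; tauto.
Qed.

(* Dyadic convex combinations of the directions [D n] with [i <= n]. *)
Inductive hull (i : nat) : (X -> 'I_d -> R) -> Prop :=
| hull_base n : (i <= n)%N -> hull i (fun x j => (D n x j)%:R)
| hull_mid a b : hull i a -> hull i b -> hull i (fun x j => (a x j + b x j) / 2).

Let hull_mono i i' a : (i <= i')%N -> hull i' a -> hull i a.
Proof.
move=> ii; elim => [n hn|b c _ h1 _ h2]; first by apply: hull_base; exact: leq_trans hn.
exact: hull_mid.
Qed.

Let hull_bm i a : hull i a -> (forall j, bm (a^~ j)) /\ forall x j, 0 <= a x j <= 1.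
Proof.
elim => [n _|b c _ [b1 b2] _ [c1 c2]]; split.
- move=> j; apply: (@bm_dbor _ _ _ _ (fun x => D n x j) (fun b : bool => b%:R) 1).
    exact: (dbor_bool (bD n j)).
  by move=> x; case: (D n x j); rewrite ?normr1 ?normr0 ?ler01.
- by move=> x j; case: (D n x j); rewrite ?lexx ?ler01.
- by move=> j; apply: bmM; [exact: bmD|exact: bm_cst].
- by move=> x j; have := b2 x j; have := c2 x j; lra.
Qed.

Let hull_sum i a x : hull i a -> V x -> \sum_j a x j <= 1.
Proof.
move=> ha Vx; elim: ha => [n _|b c _ h1 _ h2].
  have [[j Dj]|nD] := pselect (exists j, D n x j); last first.
    by rewrite big1 ?ler01 // => j _; case e : (D n x j) => //; case: nD; exists j.
  rewrite (bigD1 j) //= Dj big1 ?addr0 // => j' jj.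
  by case e : (D n x j') => //; move: jj; rewrite (D_uniq Vx e Dj) eqxx.
rewrite -mulr_suml big_split /=; lra.
Qed.

Let hull_rev i a x j : hull i a -> V x -> T x j -> (forall n, (i <= n)%N -> E n x (g j x)) ->
  a x j + a (g j x) (rv bg x j) = 1.
Proof.
move=> ha Vx Tj hE; elim: ha => [n hn|b c _ h1 _ h2]; last by lra.
have := D_rev Vx Tj (hE n hn).
by case: (D n x j); case: (D n (g j x) _) => //= _; rewrite ?addr0 ?add0r.
Qed.

Variable nu : {measure set X -> \bar R}.
Hypothesis nuT : (nu setT < +oo)%E.
Hypothesis nu0 : forall A, measurable A -> nu A = 0%E ->
  mu [set x | exists w, A (act g w x)] = 0%E.

Let Q (a : X -> 'I_d -> R) := II nu (fun x => \sum_j a x j * a x j).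

Let bm_sum (a : X -> 'I_d -> R) : (forall j, bm (a^~ j)) -> bm (fun x => \sum_j a x j).
Proof.
move=> h; have : forall s : seq 'I_d, bm (fun x => \sum_(j <- s) a x j).
  elim=> [|j s IH].
    by have := @bm_cst R _ X 0; congr bm; apply/funext => x; rewrite big_nil.
  by have := bmD (h j) IH; congr bm; apply/funext => x; rewrite big_cons.
exact.
Qed.

Let bmQ (a : X -> 'I_d -> R) : (forall j, bm (a^~ j)) -> bm (fun x => \sum_j a x j * a x j).
Proof. by move=> h; apply: (@bm_sum (fun x j => a x j * a x j)) => j; exact: bmM. Qed.

Let bmB (a b : X -> 'I_d -> R) : (forall j, bm (a^~ j)) -> (forall j, bm (b^~ j)) ->
  forall j, bm (fun x => a x j - b x j).
Proof.
move=> ha hb j; have := bmD (ha j) (bmM (@bm_cst R _ X (-1)) (hb j)).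
by congr bm; apply/funext => x; rewrite mulN1r.
Qed.

Let parallelogram (a b : X -> 'I_d -> R) : (forall j, bm (a^~ j)) -> (forall j, bm (b^~ j)) ->
  Q (fun x j => a x j - b x j) = 2 * Q a + 2 * Q b - 4 * Q (fun x j => (a x j + b x j) / 2).
Proof.
move=> ha hb; have hm j : bm (fun x => (a x j + b x j) / 2).
  by apply: bmM; [exact: bmD|exact: bm_cst].
have q1 := bmQ ha; have q2 := bmQ hb; have q3 := @bmQ (fun x j => (a x j + b x j) / 2) hm.
have q4 := @bmQ (fun x j => a x j - b x j) (bmB ha hb).
suff : Q (fun x j => a x j - b x j) + 4 * Q (fun x j => (a x j + b x j) / 2) = 2 * Q a + 2 * Q b by lra.
have bz c h : bm h -> bm (fun x : X => c * h x) by move=> ?; apply: bmM => //; exact: bm_cst.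
rewrite /Q -!IIZ // -!IID //; try exact: bz.
apply: eq_II => x; rewrite !mulr_sumr -!big_split /=; apply: eq_bigr => j _; by field.
Qed.

(** The infima over the tail hulls increase to [q]. By the parallelogram law two elements of late
    hulls with norms close to [q] are close to each other, which yields convergence without a weak
    limit. *)
Let qi i := inf [set Q a | a in hull i].

Let has_qi i : has_inf [set Q a | a in hull i].
Proof.
split.
  by exists (Q (fun x j => (D i x j)%:R)); exists (fun x j => (D i x j)%:R) => //; exact: hull_base.
by exists 0 => _ [a _ <-]; apply: II_ge0 => x; apply: sumr_ge0 => j _; rewrite -expr2 sqr_ge0.
Qed.

Let qi_le i a : hull i a -> qi i <= Q a.
Proof. by move=> ha; apply: ge_inf; [exact: (has_qi i).2|exists a]. Qed.

Let qi_mono i i' : (i <= i')%N -> qi i <= qi i'.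
Proof.
move=> ii; apply: lb_le_inf; first exact: (has_qi i').1.
by move=> _ [a ha <-]; apply: qi_le; exact: hull_mono ha.
Qed.

Let has_q : has_sup [set qi i | i in setT].
Proof.
split; first by exists (qi 0); exists 0%N.
exists (II nu (fun=> d%:R)) => _ [i _ <-].
have hb := @hull_base i i (leqnn i); apply: le_trans (qi_le hb) _.
have [h1 h2] := hull_bm hb; apply: II_le => //; [exact: (bmQ h1)|exact: bm_cst|move=> x].
apply: (@le_trans _ _ (\sum_(j < d) 1)); last by rewrite sumr_const card_ord.
by apply: ler_sum => j _; have := h2 x j; nra.
Qed.

Let q := sup [set qi i | i in setT].

Let qi_q i : qi i <= q.
Proof. by apply: sup_upper_bound; [exact: has_q|exists i]. Qed.

(** With errors [16^-j] the squared distance of consecutive choices is at most [8 * 16^-j]. Markov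
    at the threshold [2^-j] then leaves measure at most [8 * 4^-j], which is summable. *)
Let ep (j : nat) : R := (1 / 16) ^+ j.

Let ep_gt0 j : 0 < ep j. Proof. by rewrite exprn_gt0. Qed.

Let pick_ex j : exists p : nat * (X -> 'I_d -> R),
  [/\ (j <= p.1)%N, hull p.1 p.2, q - ep j <= qi p.1 & Q p.2 <= q + ep j].
Proof.
have [_ [i0 _ <-] h0] := sup_adherent (ep_gt0 j) has_q.
pose i := maxn i0 j.
have [_ [a ha <-] h1] := inf_adherent (ep_gt0 j) (has_qi i).
exists (i, a); split => //=.
- exact: leq_maxr.
- by apply: le_trans (ltW h0) _; apply: qi_mono; exact: leq_maxl.
- by have := qi_q i; rewrite /qi; lra.
Qed.

Let bor_ge (c : R) (h : X -> R) : bm h -> bor (fun x => c <= h x).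
Proof.
move=> [m _]; have := m measurableT `[c, +oo[%classic (measurable_itv _).
by rewrite setTI; apply: bor_ext => x /=; rewrite in_itv /= andbT.
Qed.

Lemma mean_arrows : exists a : nat -> X -> 'I_d -> R,
  [/\ forall j, hull j (a j) &
   exists B : nat -> set X, [/\ forall j, measurable (B j), nu (lim_sup_set B) = 0%E
    & forall j x i, ~ B j x -> `|a j x i - a j.+1 x i| < (1 / 2) ^+ j]].
Proof.
have [p hp] := choice pick_ex; pose a j := (p j).2; exists a.
have ha j : hull j (a j) by have [h1 h2 _ _] := hp j; exact: hull_mono h2.
split => //; pose B j := [set x | exists i, (1 / 2) ^+ j <= `|a j x i - a j.+1 x i|].
have bma j i : bm (a j ^~ i) by have [+ _] := hull_bm (ha j); apply.
have bmd j i : bm (fun x => a j x i - a j.+1 x i) by apply: bmB.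
have bmd' j i : bm (fun x => a j.+1 x i - a j x i) by apply: bmB.
have mB j : measurable (B j).
  apply: (bor_ex (P := fun i x => is_true ((1 / 2) ^+ j <= `|a j x i - a j.+1 x i|))) => i.
  apply: bor_ext (bor_or (bor_ge ((1 / 2) ^+ j) (bmd j i)) (bor_ge ((1 / 2) ^+ j) (bmd' j i))) => x.
  by rewrite ler_normr opprB; split => [[->//|->]|/orP//]; rewrite orbT.
have Qd j : Q (fun x i => a j x i - a j.+1 x i) <= 8 * ep j.
  rewrite parallelogram //; have [h1 h2 h3 h4] := hp j; have [h1' h2' h3' h4'] := hp j.+1.
  have ee : ep j.+1 <= ep j by rewrite /ep exprS; have := ep_gt0 j; rewrite /ep; lra.
  have : q - ep j <= Q (fun x i => (a j x i + a j.+1 x i) / 2).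
    (* The midpoint lies in the hull with the smaller index, and both infima are at least
       [q - ep j]. *)
    have [l|l] := leqP (p j).1 (p j.+1).1.
      apply: le_trans h3 _; apply: qi_le; apply: hull_mid => //; exact: hull_mono h2'.
    apply: (@le_trans _ _ (qi (p j.+1).1)); first by lra.
    by apply: qi_le; apply: hull_mid => //; apply: hull_mono h2; exact: ltnW.
  rewrite -/(a j) -/(a j.+1) in h4 h4'; lra.
exists B; split => //; last first.
  by move=> j x i nB; rewrite ltNge; apply/negP => l; apply: nB; exists i.
apply: (@summable_null R _ X nu B 16) => // n.
(* The increment of this bound is [8 * 2^-n], which dominates [8 * 4^-n]. *)
apply: (@le_trans _ _ (16 - 16 * (1 / 2) ^+ n)%:E); last first.
  by rewrite lee_fin gerBl mulr_ge0 // exprn_ge0 // divr_ge0.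
elim: n => [|n IH]; first by rewrite big_nil expr0 mulr1 subrr.
rewrite big_nat_recr //=; have fB : nu (B n) \is a fin_num.
  rewrite ge0_fin_numE //; apply: le_lt_trans nuT; apply: le_measure; rewrite ?inE //.
have bq : bm (fun x => \sum_i (a n x i - a n.+1 x i) * (a n x i - a n.+1 x i)).
  by apply: (@bmQ (fun x i => a n x i - a n.+1 x i)) => i.
have mk0 : (((1 / 4) ^+ n)%:E * nu (B n) <=
    (II nu (fun x => \sum_i (a n x i - a n.+1 x i) * (a n x i - a n.+1 x i)))%:E)%E.
  apply: II_markov => //.
  - by move=> x; apply: sumr_ge0 => i _; rewrite -expr2 sqr_ge0.
  - move=> x [i hi]; rewrite (bigD1 i) //= -[leLHS]addr0; apply: lerD; last first.
      by apply: sumr_ge0 => j _; rewrite -expr2 sqr_ge0.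
    rewrite -expr2 -real_normK ?num_real //.
    rewrite (_ : (1 / 4) ^+ n = ((1 / 2) ^+ n) ^+ 2).
      by rewrite ler_sqr // nnegrE ?exprn_ge0 // divr_ge0.
    by rewrite -exprM mulnC exprM; congr (_ ^+ n); field.
have Ie := Qd n; rewrite /Q in Ie; rewrite -(fineK fB) -EFinM lee_fin in mk0; have mk := mk0.
rewrite -(fineK fB).
apply: le_trans (leeD IH (lexx _)) _; rewrite -EFinD lee_fin.
have e4 : (1 / 4 : R) ^+ n * (1 / 4) ^+ n = ep n by rewrite -exprMn /ep; congr (_ ^+ n); field.
have p4 : 0 < (1 / 4 : R) ^+ n by rewrite exprn_gt0.
have le2 : (1 / 4 : R) ^+ n <= (1 / 2) ^+ n by apply: lerXn2r; rewrite ?nnegrE; lra.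
have fb : fine (nu (B n)) <= 8 * (1 / 4) ^+ n.
  by rewrite -(ler_pM2l p4); apply: le_trans mk _; apply: le_trans Ie _; rewrite -e4; lra.
rewrite exprS; lra.
Qed.

Lemma pass2_measure_aux : exists V' f', [/\ bor V', inv g V', conull mu V',
  (forall x, V' x -> V x) & Sol bg N kap f' V' /\
  forall x, V' x -> (tdeg N f' x == 0%N) || (tdeg N f' x == 2%N)].
Proof.
have [a [ha [B [mB nB hB]]]] := mean_arrows.
have [bf sy _ _] := sf.
pose L := lim_sup_set B; pose V' x := V x /\ forall w, ~ L (act g w x).
have mL : measurable L by apply: bigcapT_measurable => n; apply: bigcup_measurable => k _.
have bact w : bfun (act g w) by apply: (bfun_act bg); exact: bfun_id.
have bV' : bor V'.
  by apply: bor_and => //; apply: bor_all => w; apply: bor_not; apply: (bor_comp (P := L)).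
have iV' : inv g V' by apply: inv_and => //; exact: (inv_forall bg (fun x => ~ L x)).
have V'V x : V' x -> V x by case.
have V'L x : V' x -> ~ L x by move=> [_ /(_ [::])].
have cV' : conull mu V'.
  have mS : measurable [set x | exists w, L (act g w x)].
    by apply: bor_ex => w; apply: (bor_comp (P := L)).
  have mVC : measurable (~` [set x | V x]) by exact: measurableC.
  apply/eqP; rewrite eq_le measure_ge0 andbT.
  have <- : mu (~` [set x | V x] `|` [set x | exists w, L (act g w x)]) = 0%E.
    apply: measure_negligible; first exact: measurableU.
    apply: negligibleU; first exact/(negligibleP mu mVC).
    by apply/(negligibleP mu mS); exact: nu0.
  apply: le_measure; rewrite ?inE; [exact: measurableC|exact: measurableU|].
  move=> x nV; apply: contrapT => /not_orP[/contrapT Vx nL]; apply: nV; split => // w Lw.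
  by apply: nL; exists w.
have cau x : ~ L x -> exists J, forall j k i, (J <= j)%N -> (j <= k)%N ->
    `|a j x i - a k x i| <= 2 * (1 / 2) ^+ j.
  move=> nL; have [J hJ] : exists J, forall j, (J <= j)%N -> ~ B j x.
    apply: contrapT => nJ; apply: nL => n _; apply: contrapT => nb; apply: nJ; exists n => j nj Bj.
    by apply: nb; exists j.
  exists J => j k i Jj /subnKC <-; set m := (k - j)%N.
  have : `|a j x i - a (j + m)%N x i| <= 2 * (1 / 2) ^+ j - 2 * (1 / 2) ^+ (j + m).
    elim: m => [|m IH]; first by rewrite addn0 !subrr normr0.
    have /(hB _ _ i) := hJ (j + m)%N (leq_trans Jj (leq_addr _ _)).
    rewrite addnS exprS; have := ler_normD (a j x i - a (j + m)%N x i) (a (j + m)%N x i - a (j + m).+1 x i).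
    rewrite addrA subrK; lra.
  by have : 0 <= (1 / 2 : R) ^+ (j + m) by [rewrite exprn_ge0 // divr_ge0]; lra.
have rev x i : V x -> T x i -> exists J, forall j, (J <= j)%N -> a j x i + a j (g i x) (rv bg x i) = 1.
  move=> Vx Ti; have [n0 hn] := Emon i Vx; exists n0 => j nj.
  by apply: hull_rev (ha j) Vx Ti _ => n jn; apply: hn; exact: leq_trans nj jn.
(* The limit exceeds 1/2, expressed by the terms of the sequence so that it is visibly Borel. *)
pose upP x i := exists n J, forall j, (J <= j)%N -> 1 / 2 + (1 / 2) ^+ n <= a j x i.
pose up x i := T x i && `[< upP x i >].
pose tie x i := [&& T x i, ~~ up x i & ~~ up (g i x) (rv bg x i)].
have bma j i : bm (a j ^~ i) by have [+ _] := hull_bm (ha j); apply.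
have bid := @bfun_id _ X.
have bup i h : bfun h -> bor (fun x => up (h x) i).
  move=> bh; apply: (bor_comp (P := fun x => is_true (up x i))) => //.
  apply: (@bor_ext _ _ (fun x => T x i /\ upP x i)).
    by move=> x; rewrite /up; split => [[-> /asboolT ->]|/andP[? /asboolP]].
  apply: bor_and; first exact: (bor_T N i bf bid).
  apply: bor_ex => n; apply: bor_ex => J; apply: bor_all => j; apply: bor_imp; first exact: bor_cst.
  exact: bor_ge.
have btie i : bor (fun x => tie x i).
  apply: (@bor_ext _ _ (fun x => T x i /\ (~ up x i /\ forall j, rv bg x i = j -> ~ up (g i x) j))).
    move=> x; rewrite /tie; split => [[-> [/negP -> hj]]|/and3P[-> /negP u1 /negP u2]].
      by apply/negP; exact: hj.
    by split => //; split => // j <-.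
  apply: bor_and; first exact: (bor_T N i bf bid).
  apply: bor_and; first by apply: bor_not; exact: bup.
  apply: bor_all => j; apply: bor_imp; first exact: bor_rv.
  by apply: bor_not; apply: bup; exact: (bg_borel bg).
have p2 n : 0 < (1 / 2 : R) ^+ n by rewrite exprn_gt0.
(* On a tie neither of the two limits exceeds 1/2 and they add up to 1, so both are 1/2. *)
have low x i n : V' x -> tie x i -> exists J, forall j, (J <= j)%N -> 1 / 2 - (1 / 2) ^+ n < a j x i.
  move=> Vx /and3P[Ti _ nu']; have [J1 h1] := rev x i (V'V x Vx) Ti.
  have Vy : V' (g i x) by exact: (iV' x i).1.
  have [J0 h0] := cau _ (V'L _ Vy).
  exists (maxn (maxn J0 J1) n.+2) => j; rewrite !geq_max => /andP[/andP[j0 j1] jn].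
  rewrite ltNge; apply/negP => al; move/negP: nu'; apply; rewrite /up T_sym // Ti /=.
  apply/asboolP; exists n.+1, j => k jk; have := h0 j k (rv bg x i) j0 jk; have := h1 j j1.
  have : (1 / 2 : R) ^+ j <= (1 / 2) ^+ n.+2 by rewrite ler_wiXn2l //; lra.
  by rewrite !exprS ler_norml; have := p2 n; lra.
have sum2 x i j k : V' x -> i != j -> a k x i + a k x j <= 1.
  move=> Vx ij; apply: le_trans (hull_sum (ha k) (V'V x Vx)).
  rewrite (bigD1 i) //= (bigD1 j) /=; last by rewrite eq_sym.
  rewrite addrA lerDl; apply: sumr_ge0 => l _.
  by have [_ /(_ x l)/andP[]] := hull_bm (ha k).
exists V'.
have [f' [s1 s2]] : exists f', Sol bg N kap f' V' /\
    forall x, V' x -> (tdeg N f' x == 0%N) || (tdeg N f' x == 2%N).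
  apply: (@ends_solver _ _ _ _ _ _ bg N kap f V' N0 bV' iV' (Sol_sub V'V sf) (acyclic_sub V'V af) up tie).
  - by move=> i; exact: bup.
  - exact: btie.
  - by move=> x i _ /andP[].
  - by move=> x i _ /andP[].
  - move=> x i Vx Ti; rewrite /tie Ti /=.
    case u1 : (up x i); case u2 : (up (g i x) (rv bg x i)) => //=.
    move/andP: u1 => [_ /asboolP[n1 [J1 h1]]]; move/andP: u2 => [_ /asboolP[n2 [J2 h2]]].
    have [J3 h3] := rev x i (V'V x Vx) Ti; set J := maxn (maxn J1 J2) J3.
    have := h1 J (leq_trans (leq_maxl _ _) (leq_maxl _ _)).
    have := h2 J (leq_trans (leq_maxr _ _) (leq_maxl _ _)); have := h3 J (leq_maxr _ _).
    by move=> e3 e2 e1; exfalso; have := p2 n1; have := p2 n2; lra.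
  - by move=> x i _; rewrite /tie T_sym // rvK rv_rv; congr andb; rewrite andbC.
  - move=> x i j Vx /andP[_ /asboolP[n1 [J1 h1]]] /andP[_ /asboolP[n2 [J2 h2]]].
    apply: contrapT => /eqP ij; have := sum2 x i j (maxn J1 J2) Vx ij.
    have := h1 _ (leq_maxl J1 J2); have := h2 _ (leq_maxr J1 J2).
    by have := p2 n1; have := p2 n2; lra.
  - move=> x i j Vx ui; apply/negP => tj; have ij : i != j.
      by apply/eqP => e; case/and3P: tj; rewrite -e ui.
    case/andP: ui => _ /asboolP[n1 [J1 h1]]; have [J2 h2] := low x j n1.+1 Vx tj.
    have := sum2 x i j (maxn J1 J2) Vx ij.
    have := h1 _ (leq_maxl J1 J2); have := h2 _ (leq_maxr J1 J2).
    by rewrite exprS; have := p2 n1; lra.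
  (* Three ties would eventually carry more than [3 * (1/2 - 1/8) = 9/8], while the total at a
     vertex is at most 1. *)
  - move=> x Vx; rewrite leqNgt; apply/negP => t3.
    have /choice[J hJ] : forall i, exists J, tie x i -> forall j, (J <= j)%N -> 1 / 2 - (1 / 2) ^+ 3 < a j x i.
      move=> i; have [ti|nt] := boolP (tie x i); last by exists 0%N.
      by have [J hJ] := low x i 3 Vx ti; exists J.
    pose k := (\max_i J i)%N.
    have := hull_sum (ha k) (V'V x Vx); rewrite (bigID (tie x)) /=.
    have s0 : 0 <= \sum_(i | ~~ tie x i) a k x i.
      by apply: sumr_ge0 => i _; have [_ /(_ x i)/andP[]] := hull_bm (ha k).
    have s3 : \sum_(i | tie x i) (3 / 8 : R) <= \sum_(i | tie x i) a k x i.
      apply: ler_sum => i ti; have := hJ i ti k (leq_bigmax i).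
      by rewrite !exprS expr0; lra.
    rewrite sumr_const in s3.
    have s3' : (3 / 8 : R) *+ #|tie x| <= \sum_(i | tie x i) a k x i := s3.
    have : (3 / 8 : R) *+ 3 <= (3 / 8) *+ #|tie x|.
      by rewrite -[leLHS]mulr_natr -[leRHS]mulr_natr ler_pM2l ?ler_nat // divr_gt0.
    have e9 : (3 / 8 : R) *+ 3 = 9 / 8 by rewrite -[LHS]mulr_natr; field.
    rewrite e9; lra.
by exists f'.
Qed.

End Mean.

Lemma pass2_measure (R : realType) (disp : measure_display) (X : measurableType disp)
    (mu : probability X R) (d : nat) (g : 'I_d -> X -> X) (U : nat -> set X)
    (lt : X -> X -> Prop) (bg : bgraph g U lt) (N kap : nat) (f : X -> 'I_d -> int)
    (V : X -> Prop) (E : nat -> X -> X -> Prop) :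
  (0 < N)%N -> bor V -> inv g V -> conull mu V -> Sol bg N kap f V -> acyclic_on g N f V ->
  (forall n h h', bfun h -> bfun h' -> bor (fun x => E n (h x) (h' x))) ->
  (forall n x, E n x x) -> (forall n x y, E n x y -> E n y x) ->
  (forall n x y z, E n x y -> E n y z -> E n x z) ->
  (forall n x, exists s : seq X, forall y, E n x y -> y \in s) ->
  (forall x i, V x -> exists n0, forall n, (n0 <= n)%N -> E n x (g i x)) ->
  exists V' f', [/\ bor V', inv g V', conull mu V',
  (forall x, V' x -> V x) & Sol bg N kap f' V' /\
  forall x, V' x -> (tdeg N f' x == 0%N) || (tdeg N f' x == 2%N)].
Proof.
move=> N0 bV iV cV sf af bE E1 E2 E3 E4 E5.
have [nu [nuT nu0]] := saturated_measure mu bg.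
exact: (pass2_measure_aux N0 bV iV cV sf af bE E1 E2 E3 E4 E5 nuT nu0).
Qed.

(** * Extending partial roundings *)

(** The source of the constant [2 * N]: two commitments, each reached from a common vertex through
    fewer than [N] branch vertices, are joined by at most [2 * N - 1]. *)
Lemma two_short (a b n : nat) (t : bool) :
  (a < n)%N -> (b < n)%N -> (2 * n <= a + (t + b))%N -> False.
Proof. by case: t => /=; lia. Qed.

(** Two prescribed values can be completed to [k] ones among [t] edges when their sum is at most [k]
    and the other [t - 2] edges suffice for the rest. Opposite values always can. *)
Lemma alt_bounds (b : bool) k t : (0 < k < t)%N ->
  (b + ~~ b <= k)%N /\ (k + 2 <= t + (b + ~~ b))%N.
Proof. by case: b => /=; lia. Qed.

Lemma brk_bounds (b : bool) k t : (0 < k < t)%N -> (if b then 2 <= k else k + 2 <= t)%N ->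
  (b + b <= k)%N /\ (k + 2 <= t + (b + b))%N.
Proof. by case: b => /=; lia. Qed.

Section Extension.
Variables (disp : measure_display) (X : measurableType disp) (d : nat).
Variables (g : 'I_d -> X -> X) (U : nat -> set X) (lt : X -> X -> Prop).
Hypothesis bg : bgraph g U lt.
Variables (N kap : nat) (f : X -> 'I_d -> int) (V : X -> Prop).
Hypothesis N0 : (0 < N)%N.
Hypothesis iV : inv g V.
Hypothesis sf : Sol bg N kap f V.
Hypothesis af : acyclic_on g N f V.
Local Notation T := (fractional N f).
Local Notation eT := (eT g N f).
Local Notation tc := (tc g N f).
Local Notation tdeg := (tdeg N f).
Local Notation kp := (kp N f).
Local Notation asg := {ffun 'I_d -> bool}.

Definition br x := (2 < tdeg x)%N.

Lemma upath_inj a s s' : V a -> path eT a s -> uniq (a :: s) -> path eT a s' ->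
  uniq (a :: s') -> last a s = last a s' -> s = s'.
Proof.
elim: s a s' => [|y s IH] a [|y' s'] Va //=.
- by move=> _ _ _ /andP[/negP na _] e; case: na; rewrite e mem_last.
- by move=> _ /andP[/negP na _] _ _ e; case: na; rewrite -e mem_last.
move=> /andP[ay ps] /andP[na us] /andP[ay' ps'] /andP[na' us'] e.
have yy : y = y'.
  apply: (side_inj N0 iV sf af Va ay ay'); first by exists s.
  by exists s'.
by subst y'; rewrite (IH y s') //; exact: (eTV iV Va ay).
Qed.

Lemma fill x (A : pred 'I_d) (u0 : 'I_d -> bool) (k : nat) :
  (forall i, A i -> T x i) ->
  (#|[pred i | A i && u0 i]| <= k <= #|[pred i | A i && u0 i]| + #|[pred i | T x i && ~~ A i]|)%N ->
  exists u : asg, [/\ forall i, u i -> T x i, forall i, A i -> u i = u0 i & #|[pred i | u i]| = k].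
Proof.
move=> AT /andP[k1 k2]; set B := [pred i | T x i && ~~ A i] in k2 *.
set a := #|[pred i | A i && u0 i]| in k1 k2 *.
exists [ffun i => if A i then u0 i else B i && (index i (enum B) < k - a)%N]; split.
- by move=> i; rewrite ffunE; case: ifP => [/AT//|_ /andP[/andP[]]].
- by move=> i; rewrite ffunE => ->.
have kB : (k - a <= #|(B : pred 'I_d)|)%N by rewrite leq_subLR; exact: k2.
rewrite -[RHS](subnKC k1) -[in RHS](card_rank kB).
rewrite -(cardID A); congr (_ + _)%N; apply: eq_card => i; rewrite !inE ffunE.
  by rewrite -topredE /= andbC; case: (A i).
by rewrite -topredE /=; case: (A i); rewrite ?andbF.
Qed.

Lemma card_pred2_and (i j : 'I_d) (u0 : 'I_d -> bool) : i != j ->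
  #|[pred k | ((k == i) || (k == j)) && u0 k]| = (u0 i + u0 j)%N.
Proof.
move=> ij; rewrite -sum1_card big_mkcond (bigD1 i) //= (bigD1 j) /=; last by rewrite eq_sym.
rewrite !inE !eqxx orbT /= big1 ?addn0; first by case: (u0 i); case: (u0 j).
by move=> k /andP[/negbTE ki /negbTE kj]; rewrite !inE ki kj.
Qed.

Lemma card_pred1_and (i : 'I_d) (u0 : 'I_d -> bool) : #|[pred k | (k == i) && u0 k]| = u0 i.
Proof.
rewrite -sum1_card big_mkcond (bigD1 i) //= !inE !eqxx /= big1 ?addn0; first by case: (u0 i).
by move=> k /negbTE ki; rewrite !inE ki.
Qed.

Lemma card_minus x (A : pred 'I_d) : (forall i, A i -> T x i) ->
  (#|A| + #|[pred i | T x i && ~~ A i]| = tdeg x)%N.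
Proof.
move=> AT; rewrite /tdeg -[RHS](cardID A); congr (_ + _)%N; apply: eq_card => i; rewrite !inE -!topredE /=.
  by case c : (A i); rewrite ?andbF // (AT i c).
by rewrite andbC.
Qed.

Lemma fill1 x i (b : bool) : V x -> T x i ->
  exists u : asg, [/\ forall j, u j -> T x j, u i = b & #|[pred j | u j]| = kp x].
Proof.
move=> Vx Ti; have d0 : (0 < tdeg x)%N by apply/card_gt0P; exists i.
have kb := kp_bounds N0 sf Vx d0.
have AT j : pred1 i j -> T x j by move/eqP ->.
have := card_minus AT; rewrite card1 => c1.
have [|u [h1 h2 h3]] := @fill x (pred1 i) (fun=> b) (kp x) AT.
  rewrite (@card_pred1_and i (fun=> b)).
  by move: c1; rewrite /=; case: b; lia.
by exists u; split => //; apply: h2; exact: eqxx.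
Qed.

Lemma fill2 x i j (b b' : bool) : V x -> T x i -> T x j -> i != j ->
  (b + b' <= kp x)%N -> (kp x + 2 <= tdeg x + (b + b'))%N ->
  exists u : asg, [/\ forall j, u j -> T x j, u i = b, u j = b' & #|[pred j | u j]| = kp x].
Proof.
move=> Vx Ti Tj ij k1 k2; have AT l : pred2 i j l -> T x l by case/orP => /eqP ->.
have := card_minus AT; rewrite card2 ij => c1.
have [|u [h1 h2 h3]] := @fill x (pred2 i j) (fun l => if l == i then b else b') (kp x) AT.
  have -> : #|[pred l | pred2 i j l && (if l == i then b else b')]| = (b + b')%N.
    by rewrite (@card_pred2_and i j (fun l => if l == i then b else b')) // eqxx eq_sym (negbTE ij).
  by move: c1 => /=; lia.
exists u; split => //; first by rewrite h2 /= ?eqxx.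
by rewrite h2 /= ?eqxx ?orbT // eq_sym (negbTE ij).
Qed.

Lemma fill0 x : V x ->
  exists u : asg, (forall j, u j -> T x j) /\ #|[pred j | u j]| = kp x.
Proof.
move=> Vx; have [d0|d0] := posnP (tdeg x).
  exists [ffun=> false]; split; first by move=> j; rewrite ffunE.
  by rewrite (kp0 N0 sf Vx d0); apply: eq_card0 => j; rewrite !inE ffunE.
have /card_gt0P[i Ti] := d0.
by have [u [h1 _ h3]] := fill1 true Vx Ti; exists u.
Qed.

(* At a vertex entered with value [b], the value [b] may leave again. *)
Definition brk x (b : bool) := if b then (2 <= kp x)%N else (kp x + 2 <= tdeg x)%N.

(** Whether the value [b] on the first edge of a path with inner vertices [P] can lead to [t] on its
    last edge, when values alternate except at vertices that allow a break. *)
Fixpoint okp (b : bool) (P : seq X) (t : bool) : bool :=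
  if P is z :: P' then okp (~~ b) P' t || brk z b && okp b P' t else b == t.

(** Pure alternation starting from [b] and from [~~ b] ends in opposite values. *)
Lemma okp_either P b t : okp b P t || okp (~~ b) P t.
Proof.
elim: P b => [|z P IH] b /=; first by case: b; case: t.
by case/orP: (IH (~~ b)); rewrite ?negbK => ->; rewrite ?orbT.
Qed.

Let fe x y : int := if [pick i | g i x == y] is Some i then f x i else 0%R.

Let feE x i : fe x (g i x) = f x i.
Proof.
rewrite /fe; case: pickP => [j /eqP/(bg_inj bg) ->//|/(_ i)].
by rewrite eqxx.
Qed.

Let wt (b : bool) x y : int := (if b then N%:Z - fe x y else fe x y)%R.

Let wt_gt0 b x y : eT x y -> (0 < wt b x y < N%:Z)%R.
Proof. by move=> /eTP[i [<- Ti]]; rewrite /wt feE; move: Ti; rewrite /fractional; case: b; lia. Qed.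

Let feC x y : eT x y -> fe y x = fe x y.
Proof.
move=> /eTP[i [<- Ti]]; have [_ sy _ _] := sf.
by rewrite feE -{2}(rvK bg x i) feE sy.
Qed.

(** The other [tdeg x - 2] fractional values lie between 1 and [N - 1]. *)
Let two_slots x y z : V x -> eT x y -> eT x z -> y != z ->
  (fe x y + fe x z + (tdeg x - 2)%N%:Z <= (kp x * N)%N%:Z)%R /\
  ((kp x * N)%N%:Z <= fe x y + fe x z + (tdeg x - 2)%N%:Z * (N%:Z - 1))%R /\ (2 <= tdeg x)%N.
Proof.
move=> Vx /eTP[i [<- Ti]] /eTP[j [<- Tj]] ne; rewrite !feE -(kpE N0 sf Vx).
have ij : i != j by apply: contra ne => /eqP ->.
have AT l : pred2 i j l -> T x l by case/orP => /eqP ->.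
have cm := card_minus AT; rewrite card2 ij in cm.
have -> : (\sum_(l | T x l) f x l = f x i + f x j + \sum_(l | T x l && ~~ pred2 i j l) f x l)%R.
  rewrite (bigD1 i) //= (bigD1 j) /=; last by rewrite Tj eq_sym.
  by rewrite addrA; congr (_ + _)%R; apply: eq_bigl => l; rewrite negb_or andbA.
have e : (tdeg x - 2)%N = #|[pred l | T x l && ~~ pred2 i j l]| by rewrite -cm; lia.
have l1 : (#|[pred l | T x l && ~~ pred2 i j l]|%:Z * 1 <= \sum_(l | T x l && ~~ pred2 i j l) f x l)%R.
  by apply: sum_ge_card => l /= /andP[]; rewrite /fractional; lia.
have l2 : (\sum_(l | T x l && ~~ pred2 i j l) f x l <= #|[pred l | T x l && ~~ pred2 i j l]|%:Z * (N%:Z - 1))%R.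
  by apply: sum_le_card => l /= /andP[]; rewrite /fractional; lia.
rewrite e; split; first by lia.
by split; [lia|rewrite -cm; lia].
Qed.

(* [wt], the distance of [f] from the value [b], drops at every branch vertex
   where a break is not allowed. *)
Let okp_wt P y u b t : V y -> path eT y (rcons P u) -> uniq (y :: rcons P u) ->
  (wt b y (head u P) <= (count br P)%:Z)%R -> okp b P t.
Proof.
elim: P y b => [|z P IH] y b Vy; first by rewrite /= andbT => /(wt_gt0 b); lia.
rewrite [rcons _ _]/= [path _ _ _]/= => /andP[yz pz] uz; rewrite [head _ _]/= [count _ _]/= => wl.
have Vz := eTV iV Vy yz.
have [bz|nb] := boolP (brk z b).
  by rewrite /= bz /= orbC; exact: okp_either.
apply/orP; left; apply: (IH z) => //; first by case/andP: uz.
have zn : eT z (head u P) by move: pz; case: (P) => [|a P'] /= /andP[].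
have yn : y != head u P.
  move: uz; rewrite /=; case: (P) => [|a P'] /=; rewrite !inE !negb_or => /andP[/andP[_ +] _] //.
  by move=> /andP[].
have zy : eT z y by rewrite (eT_sym sf).
have [h1 [h2 h3]] := two_slots Vz zy zn yn; rewrite feC // in h1 h2.
have bd : (br z <= tdeg z - 2)%N by rewrite /br; case: ltnP => //=; lia.
have d0 : (0 < tdeg z)%N by lia.
have kb := kp_bounds N0 sf Vz d0.
move: nb wl; rewrite /brk /wt; case: b => /= nb wl; rewrite -?ltnNge in nb.
  (* With [kp z = 1] all fractional values at [z] sum to [N], so the distance drops by at least
     [tdeg z - 2]. The case [kp z = tdeg z - 1] below is the mirror image. *)
  have k1 : kp z = 1%N by lia.
  by rewrite k1 mul1n in h1; lia.
have k1 : kp z = (tdeg z).-1 by lia.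
have e1 : ((kp z * N)%N%:Z = (tdeg z - 2)%N%:Z * N%:Z + N%:Z)%R by rewrite k1; nia.
rewrite e1 in h2; nia.
Qed.

Lemma okp_long P y u b t : V y -> path eT y (rcons P u) -> uniq (y :: rcons P u) ->
  (N <= count br P)%N -> okp b P t.
Proof.
move=> Vy p1 p2 l; apply: (okp_wt (y := y) (u := u)) => //.
have : eT y (head u P) by move: p1; case: (P) => [|a P'] /= /andP[].
by move=> /(wt_gt0 b); lia.
Qed.

Variable c : X -> option asg.
Hypothesis cT : forall x u i, V x -> c x = Some u -> u i -> T x i.
Hypothesis cK : forall x u, V x -> c x = Some u -> #|[pred i | u i]| = kp x.
Hypothesis cS : forall x u i u', V x -> T x i -> c x = Some u -> c (g i x) = Some u' ->
  u' (rv bg x i) = u i.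
Hypothesis gap : forall a s y, V a -> path eT a (rcons s y) -> c a -> c y ->
  all (fun z => ~~ c z) s -> s != [::] -> a <> y -> (2 * N <= count br s)%N.

(** The value [b] on slot [i] of [z] can still be continued to every commitment that is met first
    beyond this slot. *)
Let safe z i b := forall P u cu j, path eT z (rcons P u) -> uniq (z :: rcons P u) ->
  head u P = g i z -> all (fun z => ~~ c z) P -> c u = Some cu -> g j u = last z P ->
  okp b P (cu j).

Let valid z (C : asg) := [/\ forall j, C j -> T z j, #|[pred j | C j]| = kp z
  & forall u, c z = Some u -> C = u].

Let stp y (C : asg) z (C' : asg) := [/\ valid z C', forall i, g i y = z -> C' (rv bg y i) = C i
  & forall j, g j z <> y -> safe z j (C' j)].

(** The next commitment is either adjacent, where [cS] applies, or by [gap] so far away that every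
    value can be continued to it. *)
Let safe_M z u j : V z -> c z = Some u -> safe z j (u j).
Proof.
move=> Vz cz P u' cu j' pP uP hP aP cu' gl; case: P => [|a P] in pP uP hP aP gl *.
  have e : u' = g j z by [].
  move: gl; rewrite /= e => gl; rewrite e in cu'.
  have -> : j' = rv bg z j by apply: (rv_uniq bg).
  have /eTP[k [ek Tk]] : eT z (g j z) by move: pP; rewrite /= e andbT.
  by rewrite (cS Vz _ cz cu') //; move: Tk; rewrite (bg_inj bg ek).
apply: (okp_long (y := z) (u := u')) => //; apply: leq_trans (gap Vz pP _ _ aP _ _) => //.
- by lia.
- by rewrite cz.
- by rewrite cu'.
- by move=> e; move: uP; rewrite e /= inE mem_rcons inE eqxx orbT.
Qed.

(** If [z] is not committed, [gap] leaves at most one commitment that is fewer than [N] branch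
    vertices away from it. It prescribes one further slot, which is reached by alternation or by a
    break; all other commitments are handled by [okp_long]. *)
Let step y (C : asg) z : V y -> eT y z -> (forall i, g i y = z -> safe y i (C i)) ->
  exists C', stp y C z C'.
Proof.
move=> Vy yz sC; have Vz := eTV iV Vy yz; have /eTP[i [ei Ti]] := yz.
have [_ sy _ _] := sf; have si := sC i ei; set b := C i in si.
have ii k : g k y = z -> k = i by move=> ek; apply: (bg_inj bg (x := y)); rewrite /= ek ei.
set i' := rv bg y i; have gi' : g i' z = y by rewrite -ei rvK.
have Ti' : T z i' by rewrite -ei T_sym.
have nyz : y != z by exact: (eT_neq bg yz).
case cz : (c z) => [u|].
  exists u; split; first by split; [by move=> j; exact: (cT Vz cz)|exact: (cK Vz cz)|move=> u'; rewrite cz => -[]].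
    move=> k /ii ->; have := si [::] z u i'; rewrite /= yz inE nyz ei cz gi' => /(_ isT isT erefl isT erefl erefl).
    by move/eqP.
  by move=> j _; exact: safe_M.
have d0 : (0 < tdeg z)%N by apply/card_gt0P; exists i'.
have kb := kp_bounds N0 sf Vz d0.
have lift P u : path eT z (rcons P u) -> uniq (z :: rcons P u) -> head u P <> y ->
    y \notin rcons P u.
  move=> pP uP hP; apply/negP => yP; apply: hP.
  have : exists s, [/\ path eT z s, uniq (z :: s), last z s = y & head y s = head u P].
    case/splitPr e : {1}(rcons P u) / yP => [p1 p2]; exists (rcons p1 y).
    have e' : rcons P u = rcons p1 y ++ p2 by rewrite e -cat_rcons.
    move: pP uP; rewrite e' cat_path -cat_cons cat_uniq => /andP[-> _] /and3P[-> _ _].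
    rewrite last_rcons; split => //.
    have : head y (rcons P u) = head u P by case: (P).
    by rewrite e' => <-; case: (p1).
  case=> s [ps us ls <-]; have zy : eT z y by rewrite (eT_sym sf).
  have -> // : s = [:: y].
  by apply: (upath_inj Vz ps us); rewrite /= ?zy ?inE 1?eq_sym ?nyz.
have okz P u cu j : path eT z (rcons P u) -> uniq (z :: rcons P u) -> head u P <> y ->
    all (fun z => ~~ c z) P -> c u = Some cu -> g j u = last z P -> okp b (z :: P) (cu j).
  move=> pP uP hP aP cu' gj; apply: (si (z :: P) u cu j) => //=.
  - by rewrite yz.
  - by have ny := lift P u pP uP hP; move: uP => /= ->; rewrite inE negb_or nyz ny.
  - by rewrite cz.
pose urg j P u cu k := [/\ path eT z (rcons P u), uniq (z :: rcons P u), head u P = g j z,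
  all (fun z => ~~ c z) P & [/\ c u = Some cu, g k u = last z P & (count br P < N)%N]].
have urg_uniq j P u cu k j' P' u' cu' k' : urg j P u cu k -> urg j' P' u' cu' k' ->
    [/\ j = j', P = P', u = u', cu = cu' & k = k'].
  move=> [p1 q1 h1 a1 [c1 g1 n1]] [p2 q2 h2 a2 [c2 g2 n2]].
  have uu : u = u'.
    apply: contrapT => ne.
    have Vu : V u by apply: (pathV iV Vz p1); rewrite mem_rcons mem_head.
    have pw : path eT u (rcons (rev P ++ z :: P') u').
      rewrite -cat_rcons rcons_cat cat_path last_rcons p2 andbT.
      have : path eT (last z (rcons P u)) (rev (belast z (rcons P u))).
        rewrite rev_path; congr (is_true _): p1; apply: eq_path => s t; exact: (eT_sym sf).
      by rewrite last_rcons belast_rcons rev_cons.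
    have := gap Vu pw; rewrite c1 c2 => /(_ isT isT).
    rewrite all_cat all_rev a1 /= cz a2 count_cat count_rev /= => /(_ isT _ ne).
    have -> : rev P ++ z :: P' != [::] by case: (rev P).
    by move=> /(_ isT); exact: two_short.
  subst u'; have eP : rcons P u = rcons P' u by apply: (upath_inj Vz) => //; rewrite !last_rcons.
  have [eP'] := rcons_inj eP; subst P'.
  split => //; first by apply: (bg_inj bg (x := z)); rewrite /= -h1 -h2.
    by move: c1; rewrite c2 => -[].
  by apply: (bg_inj bg (x := u)); rewrite /= g1 g2.
have nonurg j (b' : bool) : (forall P u cu k, urg j P u cu k -> okp b' P (cu k)) -> safe z j b'.
  move=> h P u cu k pP uP hP aP cu' gk; have [l|l] := ltnP (count br P) N; first exact: (h P u).
  exact: (okp_long (y := z) (u := u)).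
have fin (C' : asg) : (forall j, C' j -> T z j) -> C' i' = b -> #|[pred j | C' j]| = kp z ->
    (forall j P u cu k, j != i' -> urg j P u cu k -> okp (C' j) P (cu k)) -> stp y C z C'.
  move=> h1 h2 h3 h4; split; first by split => // u; rewrite cz.
    by move=> k /ii ->.
  move=> j nj; apply: nonurg => P u cu k; apply: h4; apply/eqP => e.
  by apply: nj; rewrite e gi'.
have [[j [P [u [cu [k [ji uj]]]]]]|nu] := pselect (exists j P u cu k, j != i' /\ urg j P u cu k).
  have [p1 q1 h1 a1 [c1 g1 n1]] := uj.
  have Tj : T z j.
    have /eTP[j2 [e2]] : eT z (head u P) by move: p1; case: (P) => [|a P'] /= /andP[].
    by rewrite h1 in e2; rewrite (bg_inj bg e2).
  have hy : head u P <> y by rewrite h1 => e; move/eqP: ji; apply; apply: (bg_inj bg (x := z)); rewrite /= e gi'.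
  have ok := okz P u cu k p1 q1 hy a1 c1 g1.
  have [b' [ob k1 k2]] : exists b', [/\ okp b' P (cu k), (b + b' <= kp z)%N & (kp z + 2 <= tdeg z + (b + b'))%N].
    move: ok => /= /orP[ho|/andP[bk ho]].
      by have [h2 h3] := alt_bounds b kb; exists (~~ b).
    by have [h2 h3] := brk_bounds kb bk; exists b.
  have ij : i' != j by rewrite eq_sym.
  have [C' [f1 f2 f3 f4]] := fill2 Vz Ti' Tj ij k1 k2.
  exists C'; apply: fin => // j2 P2 u2 cu2 k2' _ uj2.
  by have [<- <- _ <- <-] := urg_uniq _ _ _ _ _ _ _ _ _ _ uj uj2; rewrite f3.
have [C' [f1 f2 f4]] := fill1 b Vz Ti'.
exists C'; apply: fin => // j P u cu k ji uj; case: nu; by exists j, P, u, cu, k.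
Qed.

Lemma extension x0 : V x0 -> exists v : X -> asg, forall y, tc x0 y ->
  [/\ forall i, v y i -> T y i, #|[pred i | v y i]| = kp y,
      forall i, T y i -> v (g i y) (rv bg y i) = v y i & forall u, c y = Some u -> v y = u].
Proof.
move=> V0.
(* The root is a commitment if the tree has one; otherwise [safe] holds vacuously. *)
have [r [C0 [tr v0 s0]]] : exists r C0, [/\ tc x0 r, valid r C0 & forall i, safe r i (C0 i)].
  have [[r [tr cr]]|nr] := pselect (exists r, tc x0 r /\ c r).
    case e : (c r) cr => [u|] // _; have Vr := tcV iV V0 tr.
    exists r, u; split => //; last by move=> i; exact: safe_M.
    by split; [by move=> j; exact: (cT Vr e)|exact: (cK Vr e)|move=> u'; rewrite e => -[]].
  have [C0 [h1 h2]] := fill0 V0; exists x0, C0; split; [exact: tc_refl|split => //|].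
    by move=> u e; case: nr; exists x0; rewrite e; split => //; exact: tc_refl.
  move=> i P u cu j pP _ _ _ cu' _; case: nr; exists u; rewrite cu'; split => //.
  by exists (rcons P u); rewrite last_rcons.
have Vr := tcV iV V0 tr.
(* The choice is a function of the previous vertex, its values and the next vertex, so values
   computed along paths with a common beginning agree there. *)
pose rule y C z := if pselect (exists C', stp y C z C') is left e then sval (cid e) else C.
pose Cf s := (foldl (fun yC z => (z, rule yC.1 yC.2 z)) (r, C0) s).
have Cf1 s : (Cf s).1 = last r s.
  by rewrite /Cf; elim: s (r) (C0) => [//|z s IH] r' C' /=; rewrite IH.
have Cfr s z : Cf (rcons s z) = (z, rule (last r s) (Cf s).2 z).
  by rewrite /Cf foldl_rcons -/(Cf s) Cf1.
have main s : path eT r s -> uniq (r :: s) -> valid (last r s) (Cf s).2 /\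
    forall z, path eT r (rcons s z) -> uniq (r :: rcons s z) ->
      forall i, g i (last r s) = z -> safe (last r s) i ((Cf s).2 i).
  elim/last_ind: s => [|s y IH] ps us; first by split => // z _ _ i _; exact: s0.
  have := ps; rewrite rcons_path => /andP[ps' ey].
  have us' : uniq (r :: s) by move: us; rewrite -rcons_cons rcons_uniq => /andP[].
  have [vs ss] := IH ps' us'; have Vl : V (last r s).
    by apply: (tcV (N := N) (f := f) iV Vr); exists s.
  have [C' hC] := step Vl ey (ss y ps us).
  have st : stp (last r s) (Cf s).2 y (Cf (rcons s y)).2.
    rewrite Cfr /= /rule; case: pselect => [e|[]]; last by exists C'.
    by case: (cid e).
  rewrite last_rcons; have [w1 w2 w3] := st; split => // z pz uz i gi; apply: w3 => e.
  move: uz; rewrite -gi e -rcons_cons rcons_uniq => /andP[/negP + _]; apply.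
  by rewrite inE mem_rcons inE; have := mem_last r s; rewrite inE => /orP[->//|->]; rewrite !orbT.
have main2 s z : path eT r (rcons s z) -> uniq (r :: rcons s z) ->
    forall i, g i (last r s) = z -> (Cf (rcons s z)).2 (rv bg (last r s) i) = (Cf s).2 i.
  move=> ps us; have := ps; rewrite rcons_path => /andP[ps' ey].
  have us' : uniq (r :: s) by move: us; rewrite -rcons_cons rcons_uniq => /andP[].
  have [vs ss] := main s ps' us'; have Vl : V (last r s) by apply: (tcV (N := N) (f := f) iV Vr); exists s.
  have [C' hC] := step Vl ey (ss z ps us).
  have : stp (last r s) (Cf s).2 z (Cf (rcons s z)).2.
    rewrite Cfr /= /rule; case: pselect => [e|[]]; last by exists C'.
    by case: (cid e).
  by case.
have /choice[pt hpt] : forall y, exists s, tc r y -> [/\ path eT r s, uniq (r :: s) & last r s = y].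
  move=> y; have [/tc_uniq[s h]|n] := pselect (tc r y); first by exists s.
  by exists [::].
exists (fun y => (Cf (pt y)).2) => y ty.
have {}ty : tc r y by apply: tc_trans ty; exact: (tc_sym sf).
have [ps us ls] := hpt y ty; have [[w1 w2 w3] _] := main _ ps us.
rewrite ls in w1 w2 w3; split => //.
move=> i Ti; have yz : eT y (g i y) by apply/eTP; exists i.
have tz : tc r (g i y) by apply: tc_trans ty _; exact: tc1.
have [pz uz lz] := hpt _ tz.
(* One of the two ends has a path from the root that prolongs the path of the other. *)
have [zin|nz] := boolP (g i y \in r :: pt y); last first.
  have e : pt (g i y) = rcons (pt y) (g i y).
    apply: (upath_inj Vr) => //; last by rewrite lz last_rcons.
      by rewrite rcons_path ps ls.
    by rewrite -rcons_cons rcons_uniq nz us.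
  rewrite e; have := main2 (pt y) (g i y); rewrite -e => /(_ pz uz i).
  by rewrite ls => /(_ erefl).
have yn : y \notin r :: pt (g i y).
  apply/negP => yin.
  have [s1 [p1 u1 l1 sub1]] : exists s1, [/\ path eT r s1, uniq (r :: s1), last r s1 = g i y & {subset r :: s1 <= belast r (pt y)}].
    case/splitPl e : {1}(pt y) / zin => [q1 q2 lq]; exists q1.
    move: ps us; rewrite e cat_path -cat_cons cat_uniq => /andP[-> _] /and3P[-> _ _]; split => // t.
    rewrite belast_cat mem_cat; case/lastP: q2 => [|q2 q3] in e *.
      move: ls; rewrite e cats0 lq => ee; by have := eT_neq bg yz; rewrite ee eqxx.
    rewrite belast_rcons; case/lastP: q1 => [|q1 q4] in lq e *; first by rewrite /= !inE => ->.
    rewrite belast_rcons last_rcons -rcons_cons mem_rcons in_cons => /orP[/eqP ->|->] //.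
    by rewrite mem_head orbT.
  have e1 : s1 = pt (g i y) by apply: (upath_inj Vr) => //; rewrite l1 lz.
  have := sub1 y; rewrite e1 => /(_ yin).
  case/lastP: (pt y) us ls => [|s' y'] us ls; first by [].
  rewrite belast_rcons; move: us ls; rewrite last_rcons => us e; subst y'.
  by move: us; rewrite -rcons_cons rcons_uniq => /andP[/negP].
have e : pt y = rcons (pt (g i y)) y.
  apply: (upath_inj Vr) => //; last by rewrite ls last_rcons.
    by rewrite rcons_path pz lz (eT_sym sf).
  by rewrite -rcons_cons rcons_uniq yn uz.
have := main2 (pt (g i y)) y; rewrite -e => /(_ ps us (rv bg y i)); rewrite lz rvK rv_rv => /(_ erefl).
by [].
Qed.

End Extension.

(** * Commitments that are far apart *)

Section Toast.
Variables (disp : measure_display) (X : measurableType disp) (d : nat).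
Variables (g : 'I_d -> X -> X) (U : nat -> set X) (lt : X -> X -> Prop).
Hypothesis bg : bgraph g U lt.
Variables (N kap : nat) (f : X -> 'I_d -> int) (V : X -> Prop).
Hypothesis N0 : (0 < N)%N.
Hypothesis iV : inv g V.
Hypothesis sf : Sol bg N kap f V.
Hypothesis af : acyclic_on g N f V.
Local Notation T := (fractional N f).
Local Notation eT := (eT g N f).
Local Notation tc := (tc g N f).
Local Notation br := (br N f).
Implicit Types (M Q A B C : X -> Prop).

(* Walks from [A] to [B] inside [C] meet many branch vertices. *)
Definition sepr A B C := forall a s y, V a -> path eT a (rcons s y) -> A a -> B y ->
  (forall t, t \in s -> C t) -> (2 * N <= count br s)%N.

(** Committing [Q] creates no short gap to the part of [M] outside [Q]. *)
Definition closed_for M Q := sepr Q (fun y => M y /\ ~ Q y) (fun t => ~ M t /\ ~ Q t).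

(** [Q'] contains the branch vertices near [Q], so connected sets that contain a branch vertex and
    avoid [Q'] are far from [Q]. *)
Definition moat Q Q' := sepr Q (fun z => br z /\ ~ Q' z) (fun t => ~ Q t).

Definition gapped M := forall a s y, V a -> path eT a (rcons s y) -> M a -> M y ->
  (forall t, t \in s -> ~ M t) -> s <> [::] -> a <> y -> (2 * N <= count br s)%N.

Definition cset o Q := Q o /\ forall a, Q a ->
  exists s, [/\ path eT o s, last o s = a & forall t, t \in s -> Q t].

(** The invariant that keeps further commitments possible: whatever has been committed, any finite
    part of a tree with a branch vertex fits into a finite set that can be committed. *)
Definition absorbing M := forall o (F : seq X), V o -> (forall t, t \in F -> tc o t) ->
  (exists z, z \in F /\ br z) -> exists Q : seq X,
  [/\ cset o (fun y => y \in Q), closed_for M (fun y => y \in Q) & forall t, t \in F -> t \in Q].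

Lemma rev_eT a s : path eT a s -> path eT (last a s) (rev (belast a s)).
Proof. by rewrite rev_path; congr is_true; apply: eq_path => u v; exact: (eT_sym sf). Qed.

Lemma rev_walk a s y : path eT a (rcons s y) -> path eT y (rcons (rev s) a).
Proof. by move/rev_eT; rewrite last_rcons belast_rcons rev_cons. Qed.

Lemma cset_conn o Q a b : cset o Q -> Q a -> Q b ->
  exists s, [/\ path eT a s, last a s = b & forall t, t \in s -> Q t].
Proof.
move=> [Qo hQ] /hQ[s [ps ls qs]] /hQ[t [pt lt' qt]].
exists (rev (belast o s) ++ t); split.
- by rewrite cat_path -ls rev_eT // last_rev_belast.
- by rewrite last_cat -ls last_rev_belast.
- move=> z; rewrite mem_cat mem_rev => /orP[/mem_belast|/qt//].
  by rewrite inE => /orP[/eqP ->//|/qs].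
Qed.

Lemma off_path a y b q : path eT b q -> y \notin b :: q -> path (edge_off g N f y a) b q.
Proof.
elim: q b => [//|z q IH] b /= /andP[bz pz]; rewrite !inE !negb_or => /and3P[yb yz yq].
rewrite bz IH ?inE ?negb_or ?yz //= andbT.
by rewrite [b == y]eq_sym (negbTE yb) [z == y]eq_sym (negbTE yz) /= andbF.
Qed.

(** Leaving a connected set and returning to it at another vertex would close a cycle. *)
Lemma no_loop o Q a b s : V a -> cset o Q -> Q a -> Q b -> path eT a (rcons s b) ->
  (forall t, t \in s -> ~ Q t) -> s <> [::] -> a = b.
Proof.
move=> Va cQ Qa Qb; case: s => [//|y s] /= /andP[ay ps] nQ _; apply: contrapT => ab.
have Vy := eTV iV Va ay; have nQy : ~ Q y by apply: nQ; rewrite mem_head.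
have [q [pq lq qq]] := cset_conn cQ Qb Qa.
have na : a \notin y :: rcons s b.
  rewrite inE mem_rcons inE !negb_or (eT_neq bg ay) /=; apply/andP; split; first exact/eqP.
  by apply/negP => as_; apply: (nQ a) => //; rewrite inE as_ orbT.
have ny : y \notin b :: q.
  by rewrite inE negb_or; apply/andP; split; [apply/eqP => e; rewrite e in nQy|apply/negP => /qq].
have ya : eT y a by rewrite (eT_sym sf).
have [_ p1] := avoid_off ps na.
apply: (bridge N0 iV sf af (s := rcons s b ++ q) Vy ya).
  by rewrite cat_path p1 last_rcons off_path.
by rewrite last_cat last_rcons.
Qed.

Lemma first_branch_path a s : path eT a s -> br (last a s) ->
  exists p, [/\ path eT a p, forall t, t \in p -> t \in s, br (last a p) & count br (a :: p) = 1%N].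
Proof.
elim: s a => [|y s IH] a /=; first by move=> _ ba; exists [::]; rewrite /= ba.
move=> /andP[ay ps] bl; have [ba|nb] := boolP (br a); first by exists [::]; rewrite /= ba.
have [p [pp sp bp cp]] := IH y ps bl; exists (y :: p); split => //=.
- by rewrite ay.
- by move=> t; rewrite !inE => /orP[->//|/sp ->]; rewrite orbT.
Qed.

Lemma first_branch o Q a : cset o Q -> Q a -> (exists z, Q z /\ br z) ->
  exists p, [/\ path eT a p, forall t, t \in p -> Q t, br (last a p) & count br (a :: p) = 1%N].
Proof.
move=> cQ Qa [z [Qz bz]]; have [s [ps ls qs]] := cset_conn cQ Qa Qz.
have [|p [h1 h2 h3 h4]] := first_branch_path ps; first by rewrite ls.
by exists p; split => // t /h2 /qs.
Qed.

(** The walk is prolonged by [p] to a branch vertex, where the moat applies; [p] adds no branch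
    vertex before its end. *)
Lemma moat_use Q Q' a s b p : V a -> moat Q Q' -> Q a -> path eT a (rcons s b) ->
  (forall t, t \in s -> ~ Q t) -> path eT b p ->
  (forall t, t \in b :: p -> ~ Q t /\ ~ Q' t) -> br (last b p) -> count br (b :: p) = 1%N ->
  (2 * N <= count br s)%N.
Proof.
move=> Va mQ Qa pa ns pb nb bl cb.
have e : rcons s b ++ p = rcons (s ++ belast b p) (last b p).
  by rewrite -cats1 -catA /= lastI rcons_cat.
have c0 : count br (belast b p) = 0%N.
  by move: cb; rewrite lastI -cats1 count_cat /= bl; lia.
have -> : count br s = count br (s ++ belast b p) by rewrite count_cat c0 addn0.
apply: (mQ a _ (last b p)) => //.
- by rewrite -e cat_path pa last_rcons.
- by split => //; have [] := nb _ (mem_last b p).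
- move=> t; rewrite mem_cat => /orP[/ns//|/mem_belast /nb[]//].
Qed.

(** * Committing a disjoint family of sets at once *)

Section Family.
Variables (M A : X -> Prop) (Qf Qp : X -> X -> Prop).
Hypothesis AV : forall x, A x -> V x.
Hypothesis cf : forall x, A x -> cset x (Qf x).
Hypothesis cp : forall x, A x -> cset x (Qp x).
Hypothesis fp : forall x y, A x -> Qf x y -> Qp x y.
Hypothesis kf : forall x, A x -> closed_for M (Qf x).
Hypothesis kq : forall x, A x -> closed_for M (Qp x).
Hypothesis mt : forall x, A x -> moat (Qf x) (Qp x).
Hypothesis bf : forall x, A x -> exists z, Qf x z /\ br z.
Hypothesis dj : forall x x' y, A x -> A x' -> Qp x y -> Qp x' y -> x = x'.

Let M' y := M y \/ exists x, A x /\ Qf x y.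

Let V_walk a s y : V a -> path eT a (rcons s y) -> V y.
Proof. by move=> Va pa; apply: (pathV iV Va pa); rewrite mem_rcons mem_head. Qed.

(** Distances to [M] come from [closed_for], distances between two new sets from the moat of one of
    them, and [no_loop] excludes a return to the same set elsewhere. *)
Lemma gapped_family : gapped M -> gapped M'.
Proof.
move=> gM.
have half a s y x : V a -> path eT a (rcons s y) -> A x -> Qf x a -> M' y ->
    (forall t, t \in s -> ~ M' t) -> s <> [::] -> a <> y -> (2 * N <= count br s)%N.
  move=> Va pa Ax Qa My ns s0 ay.
  have nM t : t \in s -> ~ M t by move=> /ns h h'; apply: h; left.
  have nQ t x' : A x' -> t \in s -> ~ Qf x' t by move=> Ax' /ns h h'; apply: h; right; exists x'.
  have [Qy|nQy] := pselect (Qf x y).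
    by case: ay; apply: (no_loop Va (cf Ax) Qa Qy pa) => // t; exact: nQ.
  case: My => [My|[x' [Ax' Qy]]].
    by apply: (kf Ax Va pa Qa) => // t ts; split; [exact: nM|exact: nQ].
  have xx : x <> x' by move=> e; apply: nQy; rewrite e.
  have [p [pp qp bp c1]] := first_branch (cf Ax') Qy (bf Ax').
  apply: (moat_use Va (mt Ax) Qa pa _ pp _ bp c1) => [t|t tp]; first exact: nQ.
  have Qt : Qf x' t by move: tp; rewrite inE => /orP[/eqP ->//|/qp].
  have nP : ~ Qp x t by move=> h; apply: xx; exact: (dj Ax Ax' h (fp Ax' Qt)).
  by split => // /(fp Ax).
move=> a s y Va pa Ma My ns s0 ay.
case: (Ma) => [Ma'|[x [Ax Qa]]]; last exact: half Qa My ns s0 ay.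
case: (My) => [My'|[x [Ax Qy]]].
  by apply: (gM a s y) => // t /ns h h'; apply: h; left.
rewrite -count_rev; apply: (half y (rev s) a x) => //.
- exact: V_walk pa.
- exact: rev_walk.
- by move=> t; rewrite mem_rev; exact: ns.
- by move/(congr1 rev); rewrite revK.
- by move/esym.
Qed.

(** The set [Q0] obtained for [M] is enlarged by all [Qp x] that it meets. If [Qf x] is not
    contained in the result, then [Qp x] is disjoint from it, and the moat of [Qf x] provides the
    distance. *)
Lemma absorbing_family : (forall x, A x -> exists l : seq X, forall y, Qp x y <-> y \in l) ->
  absorbing M -> absorbing M'.
Proof.
move=> fin aM o F Vo oF bF; have [Q0 [c0 k0 s0]] := aM o F Vo oF bF.
have /choice[L hL] : forall y, exists l : seq X, forall t, t \in l <->
    exists x, [/\ A x, Qp x y & Qp x t].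
  move=> y; have [[x [Ax Qy]]|n] := pselect (exists x, A x /\ Qp x y); last first.
    by exists [::] => t; split => // -[x [h1 h2 _]]; case: n; exists x.
  have [l hl] := fin x Ax; exists l => t; split => [/hl h|[x' [Ax' Qy' Qt]]]; first by exists x.
  by apply/hl; rewrite (dj Ax Ax' Qy Qy').
pose Q1 := Q0 ++ flatten [seq L y | y <- Q0].
have Q1P t : t \in Q1 <-> t \in Q0 \/ exists x y, [/\ A x, y \in Q0, Qp x y & Qp x t].
  rewrite /Q1 mem_cat; split => [/orP[|/flatten_mapP[y y0 /hL[x [h1 h2 h3]]]]|]; first by left.
    by right; exists x, y.
  case=> [->//|[x [y [h1 h2 h3 h4]]]]; apply/orP; right; apply/flatten_mapP; exists y => //.
  by apply/hL; exists x.
have c1 : cset o (fun y => y \in Q1).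
  split; first by apply/Q1P; left; case: c0.
  move=> a /Q1P[a0|[x [y [Ax y0 Qy Qa]]]].
    by have [_ /(_ a a0)[s [ps ls qs]]] := c0; exists s; split => // t /qs ?; apply/Q1P; left.
  have [_ /(_ y y0)[s [ps ls qs]]] := c0.
  have [q [pq lq qq]] := cset_conn (cp Ax) Qy Qa.
  exists (s ++ q); split; [by rewrite cat_path ps ls|by rewrite last_cat ls|].
  move=> t; rewrite mem_cat => /orP[/qs ?|/qq Qt]; apply/Q1P; [by left|right].
  by exists x, y.
exists Q1; split => //; last by move=> t /s0 ?; apply/Q1P; left.
move=> a s y Va pa Qa [My nQy] ns.
case: My => [My|[x [Ax Qy]]].
  move/Q1P: (Qa) => [a0|[x [z [Ax z0 Qz Qxa]]]].
    apply: (k0 a s y) => //.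
      by split => // y0; apply: nQy; apply/Q1P; left.
    move=> t /ns[h1 h2]; split; first by move=> h; apply: h1; left.
    by move=> h; apply: h2; apply/Q1P; left.
  apply: (kq Ax Va pa Qxa).
    by split => // Qy; apply: nQy; apply/Q1P; right; exists x, z.
  move=> t /ns[h1 h2]; split; first by move=> h; apply: h1; left.
  by move=> h; apply: h2; apply/Q1P; right; exists x, z.
have nx t : t \in Q1 -> ~ Qp x t.
  move=> /Q1P[t0|[x' [z [Ax' z0 Qz Qt]]]] Qxt; apply: nQy; apply/Q1P; right.
    by exists x, t; split => //; exact: fp.
  by exists x', z; rewrite -(dj Ax Ax' Qxt Qt); split => //; [rewrite (dj Ax Ax' Qxt Qt)|exact: fp].
have bQ : exists z, z \in Q1 /\ br z.
  by have [z [zF bz]] := bF; exists z; split => //; apply/Q1P; left; exact: s0.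
have [p [pp qp bp c1']] := first_branch c1 Qa bQ.
rewrite -count_rev.
apply: (moat_use (V_walk Va pa) (mt Ax) Qy (rev_walk pa) _ pp _ bp c1') => t.
  by rewrite mem_rev => /ns[h1 _] h; apply: h1; right; exists x.
move=> tp; have tQ : t \in Q1 by move: tp; rewrite inE => /orP[/eqP ->//|/qp].
by split; [move=> h; apply: (nx t tQ); exact: fp|exact: nx].
Qed.

End Family.

Lemma finite_connected o (F : seq X) : (forall t, t \in F -> tc o t) ->
  exists Q : seq X, cset o (fun y => y \in Q) /\ forall t, t \in F -> t \in Q.
Proof.
move=> oF; have /choice[p hp] : forall t, exists s, t \in F -> path eT o s /\ last o s = t.
  by move=> t; have [/oF[s h]|n] := boolP (t \in F); [exists s|exists [::]].
exists (o :: flatten [seq p t | t <- F]); split; last first.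
  move=> t tF; have [pt lt'] := hp t tF; have := mem_last o (p t); rewrite lt' !inE => /orP[->//|h].
  by apply/orP; right; apply/flatten_mapP; exists t.
split; first by rewrite mem_head.
move=> a; rewrite inE => /orP[/eqP ->|/flatten_mapP[t tF]]; first by exists [::].
have [pt lt'] := hp t tF => at_; case/splitPr e : {1}(p t) / at_ => [p1 p2]; exists (rcons p1 a).
have e' : p t = rcons p1 a ++ p2 by rewrite e cat_rcons.
move: pt; rewrite e' cat_path => /andP[-> _]; split => //; first by rewrite last_rcons.
move=> z zp; rewrite inE; apply/orP; right; apply/flatten_mapP; exists t => //.
by rewrite e' mem_cat zp.
Qed.

Lemma absorbing0 M : (forall x, ~ M x) -> absorbing M.
Proof.
move=> nM o F Vo oF _; have [Q [h1 h2]] := finite_connected oF.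
by exists Q; split => // a s y _ _ _ [/nM].
Qed.

Lemma deg_card y l : uniq l -> all (eT y) l -> (size l <= tdeg N f y)%N.
Proof.
move=> ul /allP tl; rewrite /tdeg cardE -(size_map (g^~ y)); apply: uniq_leq_size => // z /tl.
by move=> /eTP[i [<- ti]]; apply: map_f; rewrite mem_enum.
Qed.

(** Through a vertex that is not a branch vertex there is at most one way on. *)
Let nb_det p p' a y : V a -> eT a y -> path eT y p -> path eT y p' ->
  uniq [:: a, y & p] -> uniq [:: a, y & p'] -> br (last y p) -> br (last y p') ->
  count br (belast y p) = 0%N -> count br (belast y p') = 0%N -> last y p = last y p'.
Proof.
elim: p p' a y => [|z p IH] [|z' p'] a y Va ay //.
- by move=> _ _ _ _ /= by_; rewrite /= by_.
- by move=> _ _ _ _ /= _ by_; rewrite by_.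
move=> /= /andP[yz pz] /andP[yz' pz'] u1 u2 b1 b2 c1 c2.
have nby : ~~ br y by move: c1; case: (br y).
have Vy := eTV iV Va ay.
have zz : z = z'.
  apply: contrapT => /eqP ne; move: u1 u2 => /andP[]; rewrite !inE !negb_or => /and3P[_ az _] _.
  move=> /andP[/and3P[_ az' _] _].
  have := @deg_card y [:: a; z; z']; rewrite /= (eT_sym sf) ay yz yz' !inE negb_or az az' ne => /(_ isT isT).
  by move: nby; rewrite /br -leqNgt; lia.
subst z'; move: u1 u2 => /andP[_ u1] /andP[_ u2]; apply: (IH p' y z) => //.
- by move: c1; rewrite (negbTE nby).
- by move: c2; rewrite (negbTE nby).
Qed.

Let next_branches a : V a -> exists l : seq X, forall s z, path eT a (rcons s z) -> br z ->
  count br s = 0%N -> z \in l.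
Proof.
move=> Va; pose good i z := exists p, [/\ path eT (g i a) p, uniq [:: a, g i a & p],
  last (g i a) p = z, br z & count br (belast (g i a) p) = 0%N].
have /choice[nz hnz] : forall i, exists z, forall z', good i z' -> eT a (g i a) -> z' = z.
  move=> i; have [[z [p [h1 h2 h3 h4 h5]]]|n] := pselect (exists z, good i z); last first.
    by exists a => z' h; case: n; exists z'.
  exists z => z' [p' [h1' h2' h3' h4' h5']] ai; rewrite -h3 -h3'.
  by apply: (nb_det Va ai); rewrite ?h3 ?h3'.
exists (a :: [seq nz i | i <- enum 'I_d]) => s z pa bz c0.
have c0' t : t \in s -> ~~ br t.
  by move=> ts; apply/negP => bt; have : has br s by [apply/hasP; exists t]; rewrite has_count c0.
case: (shortenP pa) (last_rcons a s z) => s' ps' us sub ls.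
case: s' => [|y p] in ps' us sub ls *; first by rewrite -ls mem_head.
move: ps' => /= /andP[ay py]; have /eTP[i [ei _]] := ay.
have gz : good i z.
  exists p; rewrite ei; split => //.
  apply/eqP; rewrite -leqn0 leqNgt -has_count; apply/hasPn => t tb.
  have : t \in rcons s z by apply: sub; exact: mem_belast tb.
  rewrite mem_rcons inE => /orP[/eqP e|/c0'//]; exfalso.
  move: us => /= /andP[_]; rewrite -[_ && _]/(uniq (y :: p)) lastI rcons_uniq -[last y p]/(last a (y :: p)) ls -e tb.
  by [].
by rewrite (hnz i z gz) ?ei // inE; apply/orP; right; apply: map_f; rewrite mem_enum.
Qed.

(** Between consecutive branch vertices the way is forced by its first edge, so finitely many of
    them come next, and one iterates. This keeps protected sets finite. *)
Lemma near_branches k a : V a -> exists l : seq X, forall s z, path eT a (rcons s z) -> br z ->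
  (count br s < k)%N -> z \in l.
Proof.
elim: k a => [|k IH] a Va; first by exists [::].
have [l1 h1] := next_branches Va.
have /choice[L hL] : forall y, exists l : seq X, V y -> forall s z, path eT y (rcons s z) -> br z ->
    (count br s < k)%N -> z \in l.
  by move=> y; have [Vy|n] := pselect (V y); [have [l h] := IH y Vy; exists l|exists [::]].
exists (l1 ++ flatten [seq L y | y <- l1]) => s z pa bz cs.
have [hs|nh] := boolP (has br s); last first.
  rewrite mem_cat (h1 s z) //; apply/eqP; rewrite -leqn0 leqNgt -has_count; exact: nh.
have e := split_find hs; move: e pa cs; move: (take _ _) (drop _ _) => s1 s2 e.
case: e => y {}s1 {}s2 by_ ns1; rewrite rcons_cat cat_path last_rcons => /andP[ps1 p2] cs.
have c1 : count br s1 = 0%N by apply/eqP; rewrite -leqn0 leqNgt -has_count.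
have yl : y \in l1 by exact: h1 ps1 by_ c1.
rewrite mem_cat; apply/orP; right; apply/flatten_mapP; exists y => //.
have Vy : V y by apply: (pathV iV Va ps1); rewrite mem_rcons mem_head.
apply: (hL y Vy s2) => //.
by move: cs; rewrite count_cat -cats1 count_cat c1 /= by_ add0n addn0 add1n.
Qed.

End Toast.

Lemma words_size (d m : nat) (w : seq 'I_d) : w \in words d m -> (size w <= m)%N.
Proof.
move=> /flattenP[s /mapP[k]]; rewrite mem_iota add0n => /andP[_ km] -> /mapP[t _ ->].
by rewrite size_tuple.
Qed.

(** * Commitment operations and their invariant *)

Section Commit.
Variables (disp : measure_display) (X : measurableType disp) (d : nat).
Variables (g : 'I_d -> X -> X) (U : nat -> set X) (lt : X -> X -> Prop).
Hypothesis bg : bgraph g U lt.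
Variables (N kap : nat) (f : X -> 'I_d -> int) (V : X -> Prop).
Hypothesis N0 : (0 < N)%N.
Hypothesis bV : bor V.
Hypothesis iV : inv g V.
Hypothesis sf : Sol bg N kap f V.
Hypothesis af : acyclic_on g N f V.
Local Notation T := (fractional N f).
Local Notation eT := (eT g N f).
Local Notation tc := (tc g N f).
Local Notation tdeg := (tdeg N f).
Local Notation kp := (kp N f).
Local Notation br := (br N f).
Local Notation tkw := (tkw g N f).
Local Notation act := (act g).
Local Notation asg := {ffun 'I_d -> bool}.

Fixpoint trj y (w : seq 'I_d) : seq X := if w is i :: w' then g i y :: trj (g i y) w' else [::].

Lemma trj_rcons y w i : trj y (rcons w i) = rcons (trj y w) (act (rcons w i) y).
Proof. by elim: w y => [//|j w IH] y /=; rewrite IH. Qed.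

Lemma tkw_rcons y w i : tkw y (rcons w i) <-> tkw y w /\ T (act w y) i.
Proof.
elim: w y => [|j w IH] y /=; first by split=> [[]|[]].
by rewrite IH; split => [[? []]|[[]]].
Qed.

Lemma path_trj y w : tkw y w -> path eT y (trj y w).
Proof. by elim: w y => [//|i w IH] y /= [Ti /IH ->]; rewrite andbT; apply/eTP; exists i. Qed.

Lemma trj_path y p : path eT y p -> exists w, tkw y w /\ trj y w = p.
Proof.
elim: p y => [|z p IH] y /=; first by exists [::].
move=> /andP[/eTP[i [<- Ti]] /IH[w [tw <-]]]; by exists (i :: w).
Qed.

Lemma last_trj y w : last y (trj y w) = act w y.
Proof. by elim: w y => [//|i w IH] y /=; rewrite IH. Qed.

Lemma act_rcons w i x : act (rcons w i) x = g i (act w x).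
Proof. by rewrite /act foldl_rcons. Qed.

Let bact w : bfun (act w). Proof. by apply: (bfun_act bg); exact: bfun_id. Qed.

Fixpoint allt (C : X -> Prop) y (w : seq 'I_d) : Prop :=
  if w is i :: w' then C (g i y) /\ allt C (g i y) w' else True.

Let alltP C y w : allt C y w <-> forall t, t \in trj y w -> C t.
Proof.
elim: w y => [|i w IH] y /=; first by [].
rewrite IH; split => [[c1 c2] t|h]; first by rewrite inE => /orP[/eqP ->//|/c2].
by split => [|t tw]; apply: h; rewrite inE ?eqxx ?tw ?orbT.
Qed.

Lemma bor_br w : bor (fun x => br (act w x)).
Proof.
have [bf _ _ _] := sf.
have h := dbor_comp (fun F : {ffun 'I_d -> int} => (2 < #|[pred i | (0 < F i)%R && (F i < N%:Z)%R]|)%N) (dbor_ffun bf).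
apply: (bor_comp (P := fun x => is_true (br x))) => //.
apply: bor_ext (h true) => x.
rewrite /br /tdeg (_ : #|[pred i | (0 < [ffun i => f x i] i)%R && ([ffun i => f x i] i < N%:Z)%R]| = #|[pred i | T x i]|) //.
by apply: eq_card => i; rewrite !inE ffunE.
Qed.

(** Walks that start in [A x] are coded by words read from [x], which turns the condition into a
    countable one. *)
Let bor_sepr (A B C : X -> X -> Prop) : (forall w, bor (fun x => A x (act w x))) ->
  (forall w, bor (fun x => B x (act w x))) -> (forall w, bor (fun x => C x (act w x))) ->
  (forall x a, A x a -> exists w, a = act w x) ->
  bor (fun x => V x -> sepr g N f V (A x) (B x) (C x)).
Proof.
move=> bA bB bC hA; have [bf _ _ _] := sf.
apply: (@bor_ext _ _ (fun x => V x -> forall w u i, A x (act w x) -> tkw (act w x) (rcons u i) ->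
  B x (act (w ++ rcons u i) x) -> allt (C x) (act w x) u -> (2 * N <= count br (trj (act w x) u))%N)).
  move=> x; split => [h Vx a s y Va pa Aa By Cs|h Vx w u i Aw tw Bw Cw].
    have [w ea] := hA x a Aa; subst a; have [u [tu eu]] := trj_path pa.
    case/lastP: u => [|u i] in tu eu *; first by case: (s) eu.
    move: eu; rewrite trj_rcons => /rcons_inj[es ey]; rewrite -es.
    apply: (h Vx w u i) => //; first by rewrite act_cat ey.
    by apply/alltP; rewrite es.
  apply: (h Vx (act w x) (trj (act w x) u) (act (w ++ rcons u i) x)) => //.
  - exact: (inv_act w x iV).1.
  - by rewrite act_cat -trj_rcons; exact: path_trj.
  - exact/alltP.
have bal u w : bor (fun x => allt (C x) (act w x) u).
  elim: u w => [|i u IH] w /=; first exact: bor_cst.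
  apply: bor_and; first by apply: bor_ext (bC (rcons w i)) => x; rewrite act_rcons.
  by apply: bor_ext (IH (rcons w i)) => x; rewrite act_rcons.
have dct u w : dbor (fun x => count br (trj (act w x) u)).
  elim: u w => [|i u IH] w; first by move=> t; exact: (@bor_cst _ _ (0%N = t)).
  have h := dbor_comp (fun p : bool * nat => (p.1 + p.2)%N)
    (dbor_pair (dbor_bool (bor_br (rcons w i))) (IH (rcons w i))).
  by move=> t; apply: bor_ext (h t) => x /=; rewrite act_rcons.
apply: bor_imp => //; apply: bor_all => w; apply: bor_all => u; apply: bor_all => i.
apply: bor_imp => //; apply: bor_imp; first exact: (bor_tkw bg N bf).
apply: bor_imp => //; apply: bor_imp => //.
exact: (dbor_pre (fun n : nat => is_true (2 * N <= n)%N) (dct u w)).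
Qed.

(** Words with the values to be committed at their ends, words for the protected set, and the index
    of an isolating set: a countable type, as [generic_sequence] requires. *)
Definition opT : Type := (seq (seq 'I_d * asg) * seq (seq 'I_d) * nat)%type.
Implicit Types (c : X -> option asg) (o : opT) (x y : X).

Definition oQ o x y := exists p, p \in o.1.1 /\ act p.1 x = y.
Definition oQ' o x y := exists w, w \in o.1.2 /\ act w x = y.

(** Closure under prefixes makes the set of endpoints connected. *)
Definition pclosed (S : seq (seq 'I_d)) := [::] \in S /\ forall w i, rcons w i \in S -> w \in S.

Definition opm o := (\max_(w <- o.1.2) size w)%N.

(* Operation [o] may commit its values around [x]: the set [oQ o x] gets them, and
   [oQ' o x] keeps it away from the other sets committed by [o]. *)
Definition check c o x : Prop :=
  V x /\ (U o.2 x /\ ((forall w, (size w <= opm o + opm o)%N -> U o.2 (act w x) -> act w x = x) /\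
  ((pclosed (unzip1 o.1.1) /\ (pclosed o.1.2 /\ {subset unzip1 o.1.1 <= o.1.2})) /\
  ((forall w, w \in o.1.2 -> tkw x w) /\
  ((V x -> closed_for g N f V (fun y => c y) (oQ o x)) /\
  ((V x -> closed_for g N f V (fun y => c y) (oQ' o x)) /\
  ((V x -> moat g N f V (oQ o x) (oQ' o x)) /\
  ((exists p, p \in o.1.1 /\ br (act p.1 x)) /\
  (forall p, p \in o.1.1 -> (forall i, p.2 i -> T (act p.1 x) i) /\
    (#|[pred i | p.2 i]| = kp (act p.1 x) /\
    ((forall u, c (act p.1 x) = Some u -> p.2 = u) /\
    (forall p', p' \in o.1.1 -> (act p.1 x = act p'.1 x -> p.2 = p'.2) /\
      (forall i j, T (act p.1 x) i -> g i (act p.1 x) = act p'.1 x ->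
         rv bg (act p.1 x) i = j -> p'.2 j = p.2 i))))))))))))).

Let bor_check c o : dbor c -> bor (check c o).
Proof.
move=> bc; have [bf _ _ _] := sf.
have bid := @bfun_id _ X.
have bM w : bor (fun x => c (act w x)).
  exact: (dbor_pre (fun b : option asg => is_true (isSome b)) (dbor_fun (bact w) bc)).
have bQ w : bor (fun x => oQ o x (act w x)).
  by apply: bor_ex => p; apply: bor_and; [exact: bor_cst|exact: (bor_eq bg)].
have bQ' w : bor (fun x => oQ' o x (act w x)).
  by apply: bor_ex => p; apply: bor_and; [exact: bor_cst|exact: (bor_eq bg)].
have exQ x a : oQ o x a -> exists w, a = act w x by move=> [p [_ <-]]; exists p.1.
have exQ' x a : oQ' o x a -> exists w, a = act w x by move=> [p [_ <-]]; exists p.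
have bk w : dbor (fun x => kp (act w x)) by exact: (dbor_fun (bact w) (dbor_kp sf)).
apply: bor_and => //; apply: bor_and; first exact: (bor_U bg o.2 bid).
apply: bor_and.
  apply: bor_all => w; apply: bor_imp; first exact: bor_cst.
  by apply: bor_imp; [exact: (bor_U bg)|exact: (bor_eq bg)].
apply: bor_and; first exact: bor_cst.
apply: bor_and.
  by apply: bor_all => w; apply: bor_imp; [exact: bor_cst|exact: (bor_tkw bg N bf)].
apply: bor_and.
  apply: bor_sepr => // w; first by apply: bor_and => //; exact: bor_not.
  by apply: bor_and; exact: bor_not.
apply: bor_and.
  apply: bor_sepr => // w; first by apply: bor_and => //; exact: bor_not.
  by apply: bor_and; exact: bor_not.
apply: bor_and.
  apply: bor_sepr => // w; first by apply: bor_and; [exact: bor_br|exact: bor_not].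
  exact: bor_not.
apply: bor_and.
  by apply: bor_ex => p; apply: bor_and; [exact: bor_cst|exact: bor_br].
apply: bor_all => p; apply: bor_imp; first exact: bor_cst.
apply: bor_and.
  by apply: bor_all => i; apply: bor_imp; [exact: bor_cst|exact: (bor_T N i bf)].
apply: bor_and.
  exact: (dbor_pre (fun n => #|[pred i | p.2 i]| = n) (bk p.1)).
apply: bor_and.
  apply: bor_all => u; apply: bor_imp; last exact: bor_cst.
  exact: (dbor_fun (bact p.1) bc).
apply: bor_all => p'; apply: bor_imp; first exact: bor_cst.
apply: bor_and; first by apply: bor_imp; [exact: (bor_eq bg)|exact: bor_cst].
apply: bor_all => i; apply: bor_all => j; apply: bor_imp; first exact: (bor_T N i bf).
apply: bor_imp; first by apply: (bor_eq bg) => //; exact: (bfun_g bg).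
apply: bor_imp; last exact: bor_cst.
exact: (bor_comp (bact p.1) (bor_rv bg i j)).
Qed.

(** Centres of protected sets that meet are at distance at most [opm o + opm o], within which
    [U o.2] isolates the centre. *)
Let check_disj c o x x' y : check c o x -> check c o x' -> oQ' o x y -> oQ' o x' y -> x = x'.
Proof.
move=> [_ [_ [iso _]]] [_ [Ux' _]] [w [wW ew]] [w' [wW' ew']].
have [w2 [s2 e2]] := act_rev bg w' x'; rewrite ew' in e2.
have e : act (w ++ w2) x = x' by rewrite act_cat ew.
have sz v : v \in o.1.2 -> (size v <= opm o)%N.
  by move=> vW; rewrite /opm (big_rem v) //= leq_maxl.
rewrite -e; symmetry; apply: iso; first by rewrite size_cat s2 leq_add ?sz.
by rewrite e.
Qed.

Let cset_words S x : pclosed S -> (forall w, w \in S -> tkw x w) ->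
  cset g N f x (fun y => exists w, w \in S /\ act w x = y).
Proof.
move=> [S0 pS] tS; split; first by exists [::].
move=> a [w [wS <-]]; elim/last_ind: w wS => [|w i IH] wS; first by exists [::].
have [s [ps ls qs]] := IH (pS _ _ wS); have [_ Ti] := (tkw_rcons x w i).1 (tS _ wS).
exists (rcons s (act (rcons w i) x)); split; last 2 first.
- by rewrite last_rcons.
- by move=> t; rewrite mem_rcons inE => /orP[/eqP ->|/qs//]; exists (rcons w i).
by rewrite rcons_path ps ls; apply/eTP; exists i; rewrite act_rcons.
Qed.

Let check_cset c o x : check c o x -> cset g N f x (oQ o x) /\ cset g N f x (oQ' o x).
Proof.
move=> [_ [_ [_ [[p1 [p2 sb]] [tk _]]]]]; split; last exact: cset_words.
have := @cset_words (unzip1 o.1.1) x p1 (fun w wS => tk w (sb w wS)).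
congr cset; apply/funext => y; apply/propext; split => [[w [/mapP[p pW ->] e]]|[p [pW e]]].
  by exists p.
by exists p.1; split => //; apply: map_f.
Qed.

Let check_sub c o x y : check c o x -> oQ o x y -> oQ' o x y.
Proof.
move=> [_ [_ [_ [[_ [_ sb]] _]]]] [p [pW e]]; exists p.1; split => //; apply: sb; exact: map_f.
Qed.

Definition comm c o y v := exists u p, [/\ check c o (act u y), p \in o.1.1,
  act p.1 (act u y) = y & p.2 = v].

Definition commit c o y : option asg :=
  if pselect (exists v, comm c o y v) is left e then Some (sval (cid e)) else c y.

Let comm_of c o x p : check c o x -> p \in o.1.1 -> comm c o (act p.1 x) p.2.
Proof.
move=> cx pW; have [u [_ e]] := act_rev bg p.1 x.
by exists u, p; rewrite e.
Qed.

Let comm_x c o y v : comm c o y v -> exists x p, [/\ check c o x, p \in o.1.1, act p.1 x = y & p.2 = v].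
Proof. by move=> [u [p [h1 h2 h3 h4]]]; exists (act u y), p. Qed.

Let checkV c o x p : check c o x -> p \in o.1.1 -> (forall i, p.2 i -> T (act p.1 x) i) /\
    (#|[pred i | p.2 i]| = kp (act p.1 x) /\
    ((forall u, c (act p.1 x) = Some u -> p.2 = u) /\
    (forall p', p' \in o.1.1 -> (act p.1 x = act p'.1 x -> p.2 = p'.2) /\
      (forall i j, T (act p.1 x) i -> g i (act p.1 x) = act p'.1 x ->
         rv bg (act p.1 x) i = j -> p'.2 j = p.2 i)))).
Proof. by move=> [_ [_ [_ [_ [_ [_ [_ [_ [_ h]]]]]]]]]; exact: h. Qed.

Let comm_uniq c o y v v' : comm c o y v -> comm c o y v' -> v = v'.
Proof.
move=> /comm_x[x [p [cx pW e <-]]] /comm_x[x' [p' [cx' pW' e' <-]]].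
have xx : x = x'.
  by apply: (@check_disj c o x x' y cx cx'); [apply: (check_sub cx); exists p|apply: (check_sub cx'); exists p'].
subst x'; have [_ [_ [_ h]]] := checkV cx pW; have [h1 _] := h p' pW'.
by apply: h1; rewrite e e'.
Qed.

Let commitE c o y v : comm c o y v -> commit c o y = Some v.
Proof.
move=> h; rewrite /commit; case: pselect => [e|[]]; last by exists v.
by case: (cid e) => v' /= h'; rewrite (comm_uniq h' h).
Qed.

Let commitN c o y : ~ (exists v, comm c o y v) -> commit c o y = c y.
Proof. by rewrite /commit; case: pselect. Qed.

Lemma commit_ext c o y u : c y = Some u -> commit c o y = Some u.
Proof.
move=> e; have [[v h]|n] := pselect (exists v, comm c o y v); last by rewrite commitN.
rewrite (commitE h); have [x [p [cx pW ey <-]]] := comm_x h.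
by have [_ [_ [h3 _]]] := checkV cx pW; rewrite (h3 u) // ey.
Qed.

Definition wellset c := [/\ dbor c,
  (forall x u, V x -> c x = Some u -> (forall i, u i -> T x i) /\ #|[pred i | u i]| = kp x),
  (forall x u i u', V x -> T x i -> c x = Some u -> c (g i x) = Some u' -> u' (rv bg x i) = u i),
  gapped g N f V (fun x => c x) & absorbing g N f V (fun x => c x)].

Let commit_dom c o : (fun y => is_true (isSome (commit c o y))) =
  (fun y => c y \/ exists x, check c o x /\ oQ o x y).
Proof.
apply/funext => y; apply/propext; split.
  have [[v h]|n] := pselect (exists v, comm c o y v); last by rewrite commitN //; left.
  move=> _; right; have [x [p [cx pW ey _]]] := comm_x h; exists x; split => //; by exists p.
case=> [|[x [cx [p [pW <-]]]]]; last by rewrite (commitE (comm_of cx pW)).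
by case e : (c y) => [u|] // _; rewrite (commit_ext o e).
Qed.

Lemma wellset_commit c o : wellset c -> wellset (commit c o).
Proof.
move=> [bc wc sc gc ac].
have AV x : check c o x -> V x by case.
have cf x : check c o x -> cset g N f x (oQ o x) by move/check_cset => [].
have cp x : check c o x -> cset g N f x (oQ' o x) by move/check_cset => [].
have fp x y : check c o x -> oQ o x y -> oQ' o x y by exact: check_sub.
have kf x : check c o x -> closed_for g N f V (fun y => c y) (oQ o x).
  by move=> h; have [Vx [_ [_ [_ [_ [k _]]]]]] := h; exact: k.
have kq x : check c o x -> closed_for g N f V (fun y => c y) (oQ' o x).
  by move=> h; have [Vx [_ [_ [_ [_ [_ [k _]]]]]]] := h; exact: k.
have mt x : check c o x -> moat g N f V (oQ o x) (oQ' o x).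
  by move=> h; have [Vx [_ [_ [_ [_ [_ [_ [k _]]]]]]]] := h; exact: k.
have bq x : check c o x -> exists z, oQ o x z /\ br z.
  move=> h; have [_ [_ [_ [_ [_ [_ [_ [_ [[p [pW bp]] _]]]]]]]]] := h.
  by exists (act p.1 x); split => //; exists p.
have dj x x' y : check c o x -> check c o x' -> oQ' o x y -> oQ' o x' y -> x = x' by exact: check_disj.
have N2 : ~ (2 * N <= 0)%N by apply/negP; rewrite leqn0 muln_eq0 /= -lt0n.
(* An edge that leaves the new set is a walk with no inner vertices, so a commitment at its other
   end would give [2 * N <= 0]. *)
have nadj y i x v : V y -> T y i -> check c o x -> oQ o x y -> ~ oQ o x (g i y) ->
    commit c o (g i y) = Some v -> False.
  move=> Vy Ti cx Qy nQ cv.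
  have e1 : path eT y (rcons [::] (g i y)) by rewrite /= andbT; apply/eTP; exists i.
  have : c (g i y) \/ exists x', check c o x' /\ oQ o x' (g i y).
    have := commit_dom c o => /(congr1 (fun F => F (g i y))) <-; by rewrite cv.
  case=> [cy|[x' [cx' Qy']]].
    have h0 : (2 * N <= count br [::])%N by apply: (kf x cx y [::] (g i y)).
    exact: N2 h0.
  have xx : x <> x' by move=> e; apply: nQ; rewrite e.
  have [p [pp qp bp c1]] := first_branch sf (cf x' cx') Qy' (bq x' cx').
  suff h0 : (2 * N <= count br [::])%N by exact: N2 h0.
  have H1 : forall t : X, t \in [::] -> ~ oQ o x t by [].
  suff H2 : forall t, t \in g i y :: p -> ~ oQ o x t /\ ~ oQ' o x t.
    exact: (moat_use N0 Vy (mt x cx) Qy e1 H1 pp H2 bp c1).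
  move=> t tp.
  have Qt : oQ o x' t by move: tp; rewrite inE => /orP[/eqP ->//|/qp].
  have nP : ~ oQ' o x t by move=> h; apply: xx; exact: (dj x x' t cx cx' h (fp x' t cx' Qt)).
  by split => // /(fp x t cx).
split.
- move=> v; apply: (@bor_ext _ _ (fun y => (exists u, Some u = v /\ comm c o y u) \/
    (~ (exists u, comm c o y u) /\ c y = v))).
    move=> y; split => [[[u [<- h]]|[n <-]]|<-]; [exact: commitE|exact: commitN|].
    have [[u h]|n] := pselect (exists u, comm c o y u); last by right; rewrite commitN.
    by left; exists u; rewrite (commitE h).
  have bcm u : bor (fun y => comm c o y u).
    apply: bor_ex => w; apply: bor_ex => p.
    apply: (@bor_ext _ _ (fun y => check c o (act w y) /\ (p \in o.1.1 /\ (act p.1 (act w y) = y /\ p.2 = u)))).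
      by move=> y; split => [[? [? []]]|[]].
    apply: bor_and; first exact: (bor_comp (bact w) (bor_check o bc)).
    apply: bor_and; first exact: bor_cst.
    apply: bor_and; last exact: bor_cst.
    by apply: (bor_eq bg); [exact: (bfun_act bg)|exact: bfun_id].
  apply: bor_or; first by apply: bor_ex => u; apply: bor_and => //; exact: bor_cst.
  by apply: bor_and; [apply: bor_not; apply: bor_ex|exact: bc].
- move=> y v Vy; have [[u h]|n] := pselect (exists u, comm c o y u); last by rewrite commitN //; exact: wc.
  rewrite (commitE h) => -[<-]; have [x [p [cx pW <- <-]]] := comm_x h.
  by have [h1 [h2 _]] := checkV cx pW.
- move=> y v i v' Vy Ti; have [[u h]|n] := pselect (exists u, comm c o y u).
    rewrite (commitE h) => -[<-]; have [x [p [cx pW ey ep]]] := comm_x h.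
    have [[p' [pW' e']] e|nQ cv] := pselect (oQ o x (g i y)); last first.
      by exfalso; apply: (nadj y i x v') => //; exists p.
    move: e; rewrite -e' (commitE (comm_of cx pW')) => -[<-].
    have [_ [_ [_ h4]]] := checkV cx pW; have [_ h5] := h4 p' pW'.
    by rewrite -ep; apply: h5; rewrite ey.
  rewrite commitN // => cy; have Vz : V (g i y) by exact: (iV y i).1.
  have [[u h]|n'] := pselect (exists u, comm c o (g i y) u); last by rewrite commitN //; exact: sc.
  have [x [p [cx pW ez ep]]] := comm_x h => _; exfalso.
  have [_ sy _ _] := sf; apply: (nadj (g i y) (rv bg y i) x v) => //.
  + by rewrite T_sym.
  + by exists p.
  + by rewrite rvK => -[p' [pW' e']]; apply: n; exists p'.2; rewrite -e'; exact: comm_of.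
  + by rewrite rvK commitN.
- have := gapped_family N0 iV sf af cf fp kf mt bq dj gc.
  by rewrite (commit_dom c o).
- have := absorbing_family N0 iV sf cp fp kq mt dj _ ac; rewrite (commit_dom c o); apply.
  move=> x cx; exists [seq act w x | w <- o.1.2] => y; split => [[w [wW <-]]|/mapP[w wW ->]].
    exact: map_f.
  by exists w.
Qed.

(** [absorbing] around [y] and a branch vertex gives the set to be committed and [extension] its
    values. A second use of [absorbing], on that set with the nearby branch vertices, gives the
    protected set. *)
Lemma commit_at c y : wellset c -> V y -> (exists z, tc y z /\ br z) ->
  exists o, commit c o y.
Proof.
move=> [bc wc sc gc ac] Vy [z [tz bz]].
have [_ sy _ _] := sf.
have [Q [cQ kQ FQ]] : exists Q : seq X, [/\ cset g N f y (fun t => t \in Q),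
    closed_for g N f V (fun y => c y) (fun t => t \in Q) & forall t, t \in [:: z] -> t \in Q].
  apply: ac => //; first by move=> t; rewrite inE => /eqP ->.
  by exists z; rewrite mem_head.
have tcQ t : t \in Q -> tc y t by move=> /(cQ.2)[s [ps ls _]]; exists s.
have [v hv] : exists v : X -> asg, forall t, tc y t ->
  [/\ forall i, v t i -> T t i, #|[pred i | v t i]| = kp t,
      forall i, T t i -> v (g i t) (rv bg t i) = v t i & forall u, c t = Some u -> v t = u].
  apply: (extension N0 iV sf af) => //.
  - by move=> x u i Vx cx ui; have [h _] := wc x u Vx cx; exact: h.
  - by move=> x u Vx cx; have [_ h] := wc x u Vx cx.
  - move=> a s t Va pa ca ct al s0 at_; apply: (gc a s t) => //.
      by move=> t' /(allP al) /negP.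
    by apply/eqP.
have /choice[L hL] : forall a, exists l : seq X, V a -> forall s t, path eT a (rcons s t) -> br t ->
    (count br s < 2 * N)%N -> t \in l.
  by move=> a; have [Va|n] := pselect (V a); [have [l h] := near_branches N0 iV sf (2 * N) Va; exists l|exists [::]].
(* The filter keeps the vertices in the tree of [y], as [absorbing] demands; branch vertices fewer
   than [2 * N] branch vertices away from [Q] pass it. *)
pose F := [seq t <- z :: Q ++ flatten [seq L a | a <- Q] | `[< tc y t >]].
have [Q' [cQ' kQ' FQ']] : exists Q' : seq X, [/\ cset g N f y (fun t => t \in Q'),
    closed_for g N f V (fun y => c y) (fun t => t \in Q') & forall t, t \in F -> t \in Q'].
  apply: ac => //; first by move=> t; rewrite mem_filter => /andP[/asboolP].
  by exists z; rewrite mem_filter mem_head andbT; split => //; apply/asboolP.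
have QQ t : t \in Q -> t \in Q'.
  move=> tQ; apply: FQ'; rewrite mem_filter inE mem_cat tQ orbT andbT; apply/asboolP; exact: tcQ.
have /choice[wd hwd] : forall t, exists w, t \in Q' -> [/\ tkw y w, act w y = t
    & forall k, act (take k w) y \in Q'].
  move=> t; have [tQ|n] := boolP (t \in Q'); last by exists [::].
  have [_ /(_ t tQ)[s [ps ls qs]]] := cQ'; have [w [tw ew]] := trj_path ps.
  exists w => _; split => //; first by rewrite -last_trj ew.
  clear ls; elim: w (y) s (cQ'.1) ps qs tw ew => [|i w IH] y' s Qy' ps qs tw ew k; first by case: k.
  case: k => [//|k] /=; move: ps qs; rewrite -ew /= => /andP[_ ps] qs.
  apply: (IH (g i y') (trj (g i y') w)) => //; first by apply: qs; rewrite mem_head.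
    by move=> t' h; apply: qs; rewrite inE h orbT.
  by case: tw.
have /choice[wq hwq] : forall t, exists w, t \in Q -> [/\ tkw y w, act w y = t
    & forall k, act (take k w) y \in Q].
  move=> t; have [tQ|n] := boolP (t \in Q); last by exists [::].
  have [_ /(_ t tQ)[s [ps ls qs]]] := cQ; have [w [tw ew]] := trj_path ps.
  exists w => _; split => //; first by rewrite -last_trj ew.
  clear ls; elim: w (y) s (cQ.1) ps qs tw ew => [|i w IH] y' s Qy' ps qs tw ew k; first by case: k.
  case: k => [//|k] /=; move: ps qs; rewrite -ew /= => /andP[_ ps] qs.
  apply: (IH (g i y') (trj (g i y') w)) => //; first by apply: qs; rewrite mem_head.
    by move=> t' h; apply: qs; rewrite inE h orbT.
  by case: tw.
pose m := maxn (\max_(t <- Q) size (wq t)) (\max_(t <- Q') size (wd t)).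
pose S (Q0 : seq X) := [seq w <- words d m | `[< tkw y w /\ forall k, act (take k w) y \in Q0 >]].
have pS Q0 : y \in Q0 -> pclosed (S Q0).
  move=> y0; split.
    by rewrite mem_filter mem_words // andbT; apply/asboolP; split => // -[|k].
  move=> w i; rewrite !mem_filter => /andP[/asboolP[tw hw] /words_size sz].
  rewrite mem_words ?andbT; last by move: sz; rewrite size_rcons; exact: ltnW.
  apply/asboolP; have [tw' _] := (tkw_rcons y w i).1 tw; split => // k.
  have [kl|kl] := leqP k (size w); first by have := hw k; rewrite -cats1 takel_cat.
  rewrite take_oversize; last exact: ltnW.
  by have := hw (size w); rewrite -cats1 take_size_cat.
have imS : forall t, t \in Q -> exists w, w \in S Q /\ act w y = t.
  move=> t tQ; have [h1 h2 h3] := hwq t tQ; exists (wq t); split => //.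
  rewrite mem_filter mem_words ?andbT; first by apply/asboolP.
  by rewrite /m leq_max (big_rem t) //= leq_maxl.
have imS' : forall t, t \in Q' -> exists w, w \in S Q' /\ act w y = t.
  move=> t tQ; have [h1 h2 h3] := hwd t tQ; exists (wd t); split => //.
  rewrite mem_filter mem_words ?andbT; first by apply/asboolP.
  by rewrite /m leq_max orbC (big_rem t) //= leq_maxl.
have Sim Q0 w : w \in S Q0 -> act w y \in Q0.
  by rewrite mem_filter => /andP[/asboolP[_ /(_ (size w))]]; rewrite take_size.
pose W := [seq (w, v (act w y)) | w <- S Q].
have uW : unzip1 W = S Q by rewrite /W /unzip1 -map_comp map_id_in.
pose mm := (\max_(w <- S Q') size w)%N.
have [n [Un iso]] := isolate_ball bg y (mm + mm).
pose o : opT := (W, S Q', n); exists o.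
have oQE t : oQ o y t <-> t \in Q.
  split => [[p [/mapP[w wS ->] <-]]|/imS[w [wS <-]]]; first exact: Sim.
  by exists (w, v (act w y)); split => //; apply: map_f.
have oQ'E t : oQ' o y t <-> t \in Q'.
  by split => [[w [wS <-]]|/imS'[w [wS <-]]]; [exact: Sim|exists w].
have eQ : oQ o y = (fun t => is_true (t \in Q)) by apply/funext => t; apply/propext; exact: oQE.
have eQ' : oQ' o y = (fun t => is_true (t \in Q')) by apply/funext => t; apply/propext; exact: oQ'E.
have ck : check c o y.
  split => //; split => //; split => //; split.
    rewrite /= uW; split; first by apply: pS; exact: cQ.1.
    split; first by apply: pS; exact: cQ'.1.
    move=> w; rewrite !mem_filter => /andP[/asboolP[tw hw] ->]; rewrite andbT; apply/asboolP.
    by split => // k; exact: QQ.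
  split; first by move=> w; rewrite mem_filter => /andP[/asboolP[]].
  split; first by rewrite eQ.
  split; first by rewrite eQ'.
  split.
    rewrite eQ eQ' => _ a s t Va pa aQ [bt nt] ns; rewrite leqNgt; apply/negP => cs.
    apply: nt; apply: FQ'; rewrite mem_filter; apply/andP; split.
      apply/asboolP; apply: tc_trans (tcQ a aQ) _; exists (rcons s t); split => //.
      by rewrite last_rcons.
    rewrite inE mem_cat; apply/orP; right; apply/orP; right; apply/flatten_mapP; exists a => //.
    exact: (hL a Va s t).
  split.
    have [w [wS ew]] := imS z (FQ z (mem_head _ _)).
    by exists (w, v (act w y)); rewrite /= ew; split => //; rewrite -ew; apply: map_f.
  move=> p /mapP[w wS ->] /=; have tw : tc y (act w y) by apply: tcQ; exact: Sim.
  have [h1 h2 h3 h4] := hv _ tw; split => //; split => //; split; first by move=> u /h4.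
  move=> p' /mapP[w' wS' ->] /=; split; first by move=> ->.
  by move=> i j Ti <- <-; exact: h3.
have [w [wS ew]] := imS y cQ.1.
have pW : (w, v (act w y)) \in o.1.1 by apply: map_f.
by have := commitE (comm_of ck pW); rewrite /= ew => ->.
Qed.

End Commit.

(** * Rounding the forest on a comeager set *)

Section Pass2Baire.
Variables (R : realType) (disp : measure_display) (X : measurableType disp).
Variables (tau : topology_on X) (rho : X -> X -> R) (q : nat -> X).
Hypothesis pm : polish_metric tau rho q.
Hypothesis cmp : compatible tau.
Variables (d : nat) (g : 'I_d -> X -> X) (U : nat -> set X) (lt : X -> X -> Prop).
Hypothesis bg : bgraph g U lt.

Lemma pass2_baire (N kap : nat) f (V : X -> Prop) : (0 < N)%N -> bor V -> inv g V ->
  comeager tau V -> Sol bg N kap f V -> acyclic_on g N f V ->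
  exists V' f', [/\ bor V', inv g V', comeager tau V', (forall x, V' x -> V x)
    & Sol bg N kap f' V' /\ forall x, V' x -> (tdeg N f' x == 0%N) || (tdeg N f' x == 2%N)].
Proof.
move=> N0 bV iV cV sf af; have [bf sy rf _] := sf.
pose c0 (x : X) : option {ffun 'I_d -> bool} := None.
pose st s := foldl (commit bg N f V) c0 s.
have w0 : wellset bg N f V c0.
  split => //; first by move=> t; exact: (@bor_cst _ _ (None = t)).
  by apply: absorbing0.
have ws s : wellset bg N f V (st s).
  rewrite /st; elim/last_ind: s => [//|s o IH]; rewrite foldl_rcons.
  exact: (wellset_commit N0 bV iV sf af).
(* In a tree without branch vertices all degrees are 0 or 2 by [kp_bounds]; there [f] is kept. *)
pose nl x := exists z, tc g N f x z /\ br N f z.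
have bact w : bfun (act g w) by apply: (bfun_act bg); exact: bfun_id.
have bnl : bor nl.
  apply: (@bor_ext _ _ (fun x => exists w, tc g N f x (act g w x) /\ br N f (act g w x))).
    move=> x; split => [[w [t b]]|[z [t b]]]; first by exists (act g w x).
    by have [w e] := tc_act t; exists w; rewrite e.
  apply: bor_ex => w; apply: bor_and; last exact: (bor_br sf).
  by apply: (bor_tc bg N bf) => //; exact: bfun_id.
have dst s : dbor (st s) by have [] := ws s.
pose P (w : seq 'I_d) s := [set x | V x -> nl (act g w x) -> st s (act g w x)].
have [||a ha] := generic_sequence pm cmp ([::], [::], 0%N) (P := P).
- move=> w s; apply: bor_imp => //; apply: bor_imp; first exact: (bor_comp (bact w) bnl).
  exact: (dbor_pre (fun b : option {ffun 'I_d -> bool} => is_true (isSome b)) (dbor_fun (bact w) (dst s))).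
- move=> w s x; have [[Vx nx]|n] := pselect (V x /\ nl (act g w x)); last first.
    by exists [::] => Vx nx; case: n.
  have Vy : V (act g w x) by exact: (inv_act w x iV).1.
  have [op hop] := commit_at N0 iV sf af (ws s) Vy nx.
  by exists [:: op] => _ _; rewrite /st foldl_cat.
pose h n := st (mkseq a n).
have hS n x u : h n x = Some u -> h n.+1 x = Some u.
  by rewrite /h /st mkseqS foldl_rcons; exact: commit_ext.
have hle n m x u : (n <= m)%N -> h n x = Some u -> h m x = Some u.
  by move=> /subnKC <- e; elim: (m - n)%N => [|k IH]; rewrite ?addn0 // addnS; exact: hS.
pose cx x u := exists n, h n x = Some u.
have cxu x u u' : cx x u -> cx x u' -> u = u'.
  move=> [n e] [m e']; have := hle n (maxn n m) x u (leq_maxl _ _) e.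
  by rewrite (hle m (maxn n m) x u' (leq_maxr _ _) e') => -[].
pose V' x := V x /\ forall w, nl (act g w x) -> exists n, h n (act g w x).
have V'V x : V' x -> V x by case.
have iV' : inv g V'.
  by apply: inv_and => //; exact: (inv_forall bg (fun x => nl x -> exists n, h n x)).
have bh n w : bor (fun x => h n (act g w x)).
  exact: (dbor_pre (fun b : option {ffun 'I_d -> bool} => is_true (isSome b)) (dbor_fun (bact w) (dst _))).
have bV' : bor V'.
  apply: bor_and => //; apply: bor_all => w; apply: bor_imp; first exact: (bor_comp (bact w) bnl).
  by apply: bor_ex => n.
have cV' : comeager tau V'.
  apply: meager_sub (meagerU cV ha) => x nV.
  apply: contrapT => /not_orP[/contrapT Vx /contrapT hx]; apply: nV.
  by split => // w nw; have [n hn] := hx w; exists n; exact: hn.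
have cnl x : V' x -> nl x -> exists u, cx x u.
  by move=> [_ /(_ [::])] /= hx /hx[n]; case e : (h n x) => [u|] // _; exists u, n.
have wcx x u : V x -> cx x u -> (forall i, u i -> fractional N f x i) /\ #|[pred i | u i]| = kp N f x.
  by move=> Vx [n e]; have [_ wn _ _ _] := ws (mkseq a n); exact: wn e.
have scx x u i u' : V x -> fractional N f x i -> cx x u -> cx (g i x) u' -> u' (rv bg x i) = u i.
  move=> Vx Ti [n e] [m e']; have [_ _ sn _ _] := ws (mkseq a (maxn n m)).
  by apply: sn => //; [exact: hle (leq_maxl _ _) e|exact: hle (leq_maxr _ _) e'].
pose cf x i : int := if `[< nl x >] then
  (if `[< exists u, cx x u /\ u i >] then Posz N else 0%R) else f x i.
have cfE x u i : nl x -> cx x u -> cf x i = (if u i then Posz N else 0%R).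
  move=> nx cu; rewrite /cf asboolT //; congr (if _ then _ else _); apply/asboolP/idP => [[u' [cu' ui]]|ui].
    by rewrite (cxu _ _ _ cu cu').
  by exists u.
have nlg x i : fractional N f x i -> nl x <-> nl (g i x).
  move=> Ti; have xy : eT g N f x (g i x) by apply/eTP; exists i.
  split=> -[z [tz bz]]; exists z; split => //; apply: tc_trans tz; apply: tc1 => //.
  by rewrite (eT_sym sf).
have sfV' : Sol bg N kap f V' by exact: (Sol_sub V'V sf).
have SG : Sol bg N kap (glue N f V' cf) V'.
  apply: (Sol_glue N0 iV' sfV') => //.
  - move=> i; rewrite /cf; apply: dbor_if; first by apply: bor_ext bnl => x; split => /asboolP.
      apply: dbor_if; try by move=> t; exact: bor_cst.
      apply: (@bor_ext _ _ (fun x => exists u, cx x u /\ u i)); first by move=> x; split => /asboolP.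
      apply: bor_ex => u; apply: bor_and; last exact: bor_cst.
      by apply: bor_ex => n; exact: dst.
    exact: bf.
  - move=> x i Vx Ti; have [nx|nn] := pselect (nl x).
      have [u cu] := cnl x Vx nx; have Vy : V' (g i x) by exact: (iV' x i).1.
      have ny := (nlg x i Ti).1 nx; have [u' cu'] := cnl _ Vy ny.
      by rewrite (cfE _ _ _ nx cu) (cfE _ _ _ ny cu') (scx x u i u' (V'V x Vx)).
    have nn' : ~ nl (g i x) by move/(nlg x i Ti).2.
    by rewrite /cf !asboolF // sy.
  - move=> x i Vx Ti; rewrite /cf; case: ifP => // _; case: ifP => _; lia.
  - move=> x Vx; have [nx|nn] := pselect (nl x); last first.
      rewrite -(kpE N0 sf (V'V x Vx)); apply: eq_bigr => i Ti; by rewrite /cf asboolF.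
    have [u cu] := cnl x Vx nx; have [uT uk] := wcx x u (V'V x Vx) cu.
    rewrite (eq_bigr (fun i => if u i then Posz N else 0%R)); last by move=> i _; exact: cfE.
    rewrite -big_mkcondr /= -uk (eq_bigl (fun i => u i)); last first.
      by move=> i; case ui : (u i); rewrite ?andbF // (uT i ui).
    by rewrite sumr_const -mulr_natl natz PoszM.
exists V', (glue N f V' cf); split => //; split => // x Vx.
have [nx|nn] := pselect (nl x).
  have [u cu] := cnl x Vx nx.
  have -> // : tdeg N (glue N f V' cf) x = 0%N.
  apply: eq_card0 => i; rewrite !inE; apply/negbTE/negP => /(T_glue Vx)[Ti].
  by rewrite (cfE _ _ _ nx cu); case: (u i); lia.
have -> : tdeg N (glue N f V' cf) x = tdeg N f x.
  by apply: eq_card => i; rewrite !inE /fractional /glue /cf asboolT // (asboolF nn); case: ifP.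
have nb : ~~ br N f x by apply/negP => b; apply: nn; exists x; split => //; exact: tc_refl.
have [d0|d0] := posnP (tdeg N f x); first by rewrite d0.
have := kp_bounds N0 sf (V'V x Vx) d0; move: nb; rewrite /br; lia.
Qed.

End Pass2Baire.

(** * The factor *)

Section Rounding.
Local Open Scope ring_scope.
Variables (disp : measure_display) (X : measurableType disp) (d : nat).
Variables (g : 'I_d -> X -> X) (U : nat -> set X) (lt : X -> X -> Prop).
Hypothesis bg : bgraph g U lt.
(** Instantiated by comeagerness, and by being conull and contained in the set on which the graph is
    hyperfinite. *)
Variable Big : (X -> Prop) -> Prop.
Hypothesis round : forall N kap f V, (0 < N)%N -> bor V -> inv g V -> Big V ->
  Sol bg N kap f V -> exists V' f', [/\ bor V', inv g V', Big V', (forall x, V' x -> V x)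
    & Sol bg N kap f' V' /\ forall x, V' x -> (tdeg N f' x == 0%N) || (tdeg N f' x == 2%N)].

Definition slot_factor (V : X -> Prop) (F : X -> 'I_d -> bool) (k : nat) :=
  [/\ forall i, bor (fun x => F x i), symf bg F & forall x, V x -> #|F x| = k].

Lemma round_odd N k f V : odd N -> bor V -> inv g V -> Big V -> Sol bg N k f V ->
  exists V' F, [/\ bor V', inv g V', Big V' & slot_factor V' F k].
Proof.
move=> oN bV iV BV sf; have N0 : (0 < N)%N by case: (N) oN.
have [V' [f' [bV' iV' BV' _ [[bf sy rf zf] td]]]] := round N0 bV iV BV sf.
exists V', (fun x i => N%:Z < f' x i *+ 2); split => //; split.
- move=> i; exact: (dbor_pre (fun n : int => is_true (N%:Z < n *+ 2)) (bf i)).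
- by move=> x i; rewrite sy.
move=> x Vx; set F := fun i => N%:Z < f' x i *+ 2.
have d2 : (tdeg N f' x <= 2)%N by case/orP: (td x Vx) => /eqP ->.
have sF : \sum_i (N%:Z * (F i)%:Z - f' x i) = N%:Z * (#|F|%:Z - k%:Z).
  rewrite sumrB zf // -mulr_sumr mulrBr PoszM [k%:Z * _]mulrC; congr (_ * _ - _).
  rewrite -sum1_card [in RHS]big_mkcond -natz natr_sum; apply: eq_bigr => i _.
  by rewrite -topredE /=; case: (F i).
have nT i : ~~ fractional N f' x i -> N%:Z * (F i)%:Z - f' x i = 0.
  move=> nTi; have r := rf x i; have [e|e] : f' x i = 0 \/ f' x i = N%:Z.
      by move: nTi; rewrite /fractional; lia.
    by rewrite /F e mul0rn; have -> : (N%:Z < 0) = false by [lia]; rewrite mulr0 subr0.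
  by rewrite /F e mulr2n; have -> : (N%:Z < N%:Z + N%:Z) = true by [lia]; rewrite mulr1 subrr.
(* Since [N] is odd, an error is at most [(N - 1) / 2]; it is doubled to stay among the integers. *)
have yT i : fractional N f' x i -> - (N%:Z - 1) <= (N%:Z * (F i)%:Z - f' x i) *+ 2 <= N%:Z - 1.
  by rewrite /fractional /F; case: (ltP N%:Z (f' x i *+ 2)); rewrite /= !mulr2n; lia.
rewrite (bigID (fractional N f' x)) /= [X in _ + X]big1 ?addr0 // in sF.
have u : \sum_(i | fractional N f' x i) (N%:Z * (F i)%:Z - f' x i) *+ 2 <= (tdeg N f' x)%:Z * (N%:Z - 1).
  by apply: sum_le_card => i /= /yT /andP[].
have l : (tdeg N f' x)%:Z * (- (N%:Z - 1)) <= \sum_(i | fractional N f' x i) (N%:Z * (F i)%:Z - f' x i) *+ 2.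
  by apply: sum_ge_card => i /= /yT /andP[].
rewrite sumrMnl sF mulr2n in u l.
have u2 : (tdeg N f' x)%:Z * (N%:Z - 1) <= 2 * (N%:Z - 1) by nia.
have l2 : - (2 * (N%:Z - 1)) <= (tdeg N f' x)%:Z * (- (N%:Z - 1)) by nia.
suff : #|F|%:Z - k%:Z = 0 by lia.
set D := #|F|%:Z - k%:Z in u l *.
have : -1 < D < 1 by apply/andP; split; nia.
by lia.
Qed.

(** Twice the rounding of [f / N], where an edge that is still fractional counts as one half. *)
Let x2 N (f : X -> 'I_d -> int) x i : int := if fractional N f x i then 1 else if f x i == N%:Z then 2 else 0.

(** The sum is even because zero or two edges count 1, and the errors keep it at distance less than
    2 from the even number [k]. *)
Let half_sum N k f V x : (0 < N)%N -> ~~ odd k -> Sol bg N k./2 f V -> V x ->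
  (tdeg N f x == 0%N) || (tdeg N f x == 2%N) -> \sum_i x2 N f x i = k%:Z.
Proof.
move=> N0 ek [bf sy rf zf] Vx td.
have ev : exists m : int, \sum_i x2 N f x i = 2 * m.
  rewrite (bigID (fractional N f x)) /= (eq_bigr (fun=> 1)); last by move=> i Ti; rewrite /x2 Ti.
  have [m em] : exists m : int, \sum_(i | ~~ fractional N f x i) x2 N f x i = 2 * m.
    apply: (big_ind (fun v : int => exists m, v = 2 * m)).
    - by exists 0.
    - by move=> a b [m ->] [m' ->]; exists (m + m'); rewrite mulrDr.
    - move=> i /negbTE Ti; rewrite /x2 Ti; case: ifP => _; [exists 1|exists 0] => //.
  rewrite em sumr_const; have -> : #|[pred i | fractional N f x i]| = tdeg N f x by [].
  by case/orP: td => /eqP ->; [exists m|exists (1 + m)]; rewrite ?mulr0n ?add0r ?mulrDr.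
have [m em] := ev.
have sD : \sum_i (N%:Z * x2 N f x i - f x i *+ 2) = N%:Z * (\sum_i x2 N f x i - k%:Z).
  rewrite sumrB -mulr_sumr sumrMnl zf // mulrBr; congr (_ - _).
  by rewrite mulr2n; have := odd_double_half k; rewrite (negbTE ek) add0n -addnn; nia.
have nT i : ~~ fractional N f x i -> N%:Z * x2 N f x i - f x i *+ 2 = 0.
  move=> nTi; have r := rf x i; rewrite /x2 (negbTE nTi); case: eqP => [->|ne]; first by rewrite mulr2n; ring.
  have -> : f x i = 0 by move: nTi; rewrite /fractional; lia.
  by rewrite mulr0 mul0rn.
have yT i : fractional N f x i -> - (N%:Z - 1) <= N%:Z * x2 N f x i - f x i *+ 2 <= N%:Z - 1.
  by move=> Ti; rewrite /x2 Ti; move: Ti; rewrite /fractional mulr2n; lia.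
rewrite (bigID (fractional N f x)) /= [X in _ + X]big1 ?addr0 // in sD.
have u : \sum_(i | fractional N f x i) (N%:Z * x2 N f x i - f x i *+ 2) <= (tdeg N f x)%:Z * (N%:Z - 1).
  by apply: sum_le_card => i /= /yT /andP[].
have l : (tdeg N f x)%:Z * (- (N%:Z - 1)) <= \sum_(i | fractional N f x i) (N%:Z * x2 N f x i - f x i *+ 2).
  by apply: sum_ge_card => i /= /yT /andP[].
rewrite sD em in u l; rewrite em.
have d2 : (tdeg N f x <= 2)%N by case/orP: td => /eqP ->.
have u2 : (tdeg N f x)%:Z * (N%:Z - 1) <= 2 * (N%:Z - 1) by nia.
have l2 : - (2 * (N%:Z - 1)) <= (tdeg N f x)%:Z * (- (N%:Z - 1)) by nia.
have ke : k%:Z = 2 * (k./2)%:Z.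
  by have := odd_double_half k; rewrite (negbTE ek) add0n -addnn; lia.
rewrite ke in u l *; set D := m - (k./2)%:Z.
have e : 2 * m - 2 * (k./2)%:Z = 2 * D by rewrite /D; ring.
rewrite e in u l.
have : -1 < D < 1 by apply/andP; split; nia.
by rewrite /D; lia.
Qed.

Lemma factor_of_rounds k V : (k <= d)%N -> ~~ odd k \/ odd d -> bor V -> inv g V -> Big V ->
  exists V' F, [/\ bor V', inv g V', Big V' & slot_factor V' F k].
Proof.
(* The case [k = d] is set apart because the last rounding needs [2 * k + 2 <= 2 * d + 1]. *)
move=> kd par bV iV BV; have [e|ne] := eqVneq k d.
  exists V, (fun _ _ => true); split => //; split => //; first by move=> i; exact: bor_cst.
  by move=> x _; rewrite e -[RHS]card_ord; apply: eq_card.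
have {}kd : (k < d)%N by rewrite ltn_neqAle ne.
have [od|ed] := boolP (odd d).
  apply: (@round_odd d k (fun _ _ => k%:Z) V) => //; split => //.
  - by move=> i t; exact: bor_cst.
  - by move=> x i; lia.
  - by move=> x _; rewrite sumr_const card_ord -mulr_natl natz PoszM mulrC.
have ek : ~~ odd k by case: par => // od; rewrite od in ed.
have d2 : (0 < 2 * d)%N by lia.
(* The constant [k] over the denominator [2 * d]: its vertex sum [d * k] is [k / 2] times
   [2 * d]. *)
have s1 : Sol bg (2 * d) k./2 (fun _ _ => k%:Z) V.
  split => //; [by move=> i t; exact: bor_cst|by move=> x i; lia|].
  move=> x _; rewrite sumr_const card_ord -mulr_natl natz.
  by have := odd_double_half k; rewrite (negbTE ek) add0n -addnn; nia.
have [V1 [f1 [bV1 iV1 BV1 _ [sf1 td1]]]] := round d2 bV iV BV s1.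
have [bf sy rf zf] := sf1.
(* The vertex sums are [2 * k * d + k = k * (2 * d + 1)]. *)
apply: (@round_odd (2 * d).+1 k (fun x i => (2 * k)%:Z + x2 (2 * d) f1 x i) V1) => //.
  by rewrite /= oddM.
split.
- move=> i; apply: (dbor_comp (fun n : int => (2 * k)%:Z +
    (if (0 < n) && (n < (2 * d)%:Z) then 1 else if n == (2 * d)%:Z then 2 else 0)) (bf i)).
- by move=> x i; rewrite /x2 T_sym // sy.
- by move=> x i; rewrite /x2; case: ifP => _; [|case: ifP => _]; lia.
- move=> x Vx; rewrite big_split /= (half_sum d2 ek sf1 Vx (td1 x Vx)).
  by rewrite sumr_const card_ord -mulr_natl natz; nia.
Qed.

End Rounding.

(** * Translation between the graph and its slots *)

Section Translate.
Local Open Scope ring_scope.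
Variables (R : realType) (disp : measure_display) (X : measurableType disp).
Variables (tau : topology_on X) (rho : X -> X -> R) (q : nat -> X).
Hypothesis pm : polish_metric tau rho q.
Hypothesis cmp : compatible tau.
Variables (d : nat) (G : set (X * X)).
Hypothesis bG : borel_graph G.
Hypothesis bip : bipartite G.
Variable g : 'I_d -> X -> X.
Hypothesis gb : forall i, bfun (g i).
Hypothesis gi : forall x, injective (g^~ x).
Hypothesis gG : forall x y, G (x, y) <-> exists i, g i x = y.

Lemma bgraph_of_graph : bgraph g (obase rho q) (ltX rho q).
Proof.
have [[sG iG] mG] := bG; have mU := obase_measurable pm cmp.
split => //.
- by move=> x i; apply/gG; apply: sG; apply/gG; exists i.
- by have [S hS] := bip; exists S => x i; apply: hS; apply/gG; exists i.
- move=> x s; have [n [nx hn]] := obase_isolate pm x s; exists n; split => // y ys.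
  apply: hn; elim: s ys => [//|a s IH]; rewrite inE => /orP[/eqP ->|/IH]; [by left|by right].
- move=> h h' bh bh'; apply: bor_ex => n.
  have bU m h0 : bfun h0 -> bor (fun x => obase rho q m (h0 x)).
    by move=> b0; apply: (bor_comp (P := obase rho q m)) => //; exact: mU.
  apply: (@bor_ext _ _ (fun x => obase rho q n (h x) /\ (~ obase rho q n (h' x) /\
    forall m, (m < n)%N -> obase rho q m (h x) <-> obase rho q m (h' x)))).
    by move=> x; split => [[? []]|[]].
  apply: bor_and; first exact: bU.
  apply: bor_and; first by apply: bor_not; exact: bU.
  apply: bor_all => m; apply: bor_imp; first exact: bor_cst.
  by apply: bor_iff; exact: bU.
- exact: ltX_irr.
- exact: ltX_trans.
- exact: (ltX_total pm).
Qed.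

Hypothesis bg : bgraph g (obase rho q) (ltX rho q).

Lemma inv_of_invariant (B : set X) : invariant G B -> inv g (fun x => B x).
Proof.
move=> [S ->] x i; have Gx : G (x, g i x) by apply/gG; exists i.
split=> -[z Sz cz]; exists z => //; apply: rst_trans cz _; last apply: rst_sym; exact: rst_step.
Qed.

Lemma invariant_of_inv (V : X -> Prop) : inv g V -> invariant G (~` [set x | V x]).
Proof.
move=> iV; exists (~` [set x | V x]); apply/seteqP; split => [x nV|x [z nV cz]].
  by exists x => //; exact: rst_refl.
have iG : forall u v, component G u v -> V u <-> V v.
  move=> u v; elim => {u v} [u v /gG[i <-]|u|u v _ IH|u v w _ IH1 _ IH2]; [exact: iV|by []| |].
    by rewrite IH.
  by rewrite IH1.
by move=> Vx; apply: nV; apply/(iG z x cz).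
Qed.

Lemma borel_factor_of_slots (V : X -> Prop) F k : bor V -> inv g V -> slot_factor bg V F k ->
  admits_borel_factor k [set x | V x] (restrict_graph G [set x | V x]).
Proof.
move=> bV iV [bF sF cF]; have mU := obase_measurable pm cmp.
pose FF := [set p : X * X | V p.1 /\ exists i, F p.1 i /\ g i p.1 = p.2].
exists FF; split; last first.
  have p1 (Q : X -> Prop) : bor Q -> bor (fun p : X * X => Q p.1).
    by move=> bQ; have := @measurable_fst _ _ X X measurableT _ bQ; rewrite setTI.
  have p2 (Q : X -> Prop) : bor Q -> bor (fun p : X * X => Q p.2).
    by move=> bQ; have := @measurable_snd _ _ X X measurableT _ bQ; rewrite setTI.
  apply: (@bor_and _ (X * X)%type); first exact: p1.
  apply: (@bor_ex _ (X * X)%type) => i; apply: (@bor_and _ (X * X)%type); first exact: (p1 (fun x => F x i)).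
  apply: (@bor_ext _ (X * X)%type (fun p : X * X => forall n, obase rho q n (g i p.1) <-> obase rho q n p.2)).
    by move=> p; split => [/(obase_sep pm)|->].
  apply: (@bor_all _ (X * X)%type) => n; apply: (@bor_iff _ (X * X)%type).
    apply: (p1 (fun x => obase rho q n (g i x))).
    by apply: (bor_comp (P := obase rho q n)) => //; exact: mU.
  by apply: (p2 (obase rho q n)); exact: mU.
split.
- split => [x y [/= Vx [i [Fi <-]]]|x [_ [i [_ /= e]]]]; last exact: (g_neq bg e).
  split => /=; first exact: (iV x i).1.
  by exists (rv bg x i); rewrite rvK sF.
- move=> [x y] [/= Vx [i [Fi <-]]]; split; first by apply/gG; exists i.
  by split => //=; exact: (iV x i).1.
move=> x Vx; pose l := [seq g i x | i <- enum (F x)].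
have sl : size l = k by rewrite size_map -cardE cF.
have ul : uniq l by rewrite map_inj_uniq ?enum_uniq //; exact: gi.
have -> : neighbors FF x = [set nth x l n | n in `I_k].
  apply/seteqP; split => [y [/= _ [i [Fi <-]]]|_ [n /= nk <-]].
    have gl : g i x \in l by apply: map_f; rewrite mem_enum.
    by exists (index (g i x) l); rewrite /= ?nth_index // -sl index_mem.
  have : nth x l n \in l by rewrite mem_nth // sl.
  by case/mapP => i; rewrite mem_enum => Fi ->; split => //; exists i.
apply: inj_card_eq => n m; rewrite !inE /= => nk mk /eqP.
by rewrite nth_uniq ?sl // => /eqP.
Qed.

Lemma hyperfinite_classes (B : set X) : hyperfinite (restrict_graph G B) ->
  exists E : nat -> X -> X -> Prop,
  (forall n h h', bfun h -> bfun h' -> bor (fun x => E n (h x) (h' x))) /\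
  [/\ forall n x, E n x x, forall n x y, E n x y -> E n y x,
      forall n x y z, E n x y -> E n y z -> E n x z,
      forall n x, exists s : seq X, forall y, E n x y -> y \in s
    & forall x i, B x -> B (g i x) -> exists n0, forall n, (n0 <= n)%N -> E n x (g i x)].
Proof.
move=> [F [bF fF mF uF]].
exists (fun n x y => component (F n) x y); split.
  move=> n h h' bh bh'.
  (* Edges of [F n] are edges of [G], so its components can be explored by words of slots, of which
     there are countably many. *)
  pose wk := fix wk y (w : seq 'I_d) : Prop := if w is i :: w' then F n (y, g i y) /\ wk (g i y) w' else True.
  have [[sFn _] mFn] := bF n.
  have FG x y : F n (x, y) -> exists i, g i x = y.
    move=> h0; apply/gG; have : restrict_graph G B (x, y) by rewrite uF; exists n.
    by case.
  have wk_cat w w' y : wk y (w ++ w') <-> wk y w /\ wk (act g w y) w'.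
    elim: w y => [|i w IH] y /=; first by split=> [|[]].
    by rewrite IH; split => [[? []]|[[]]].
  have wk_rev w y : wk y w -> exists w', wk (act g w y) w' /\ act g w' (act g w y) = y.
    elim: w y => [|i w IH] y /=; first by exists [::].
    move=> [Fi /IH[w' [h1 h2]]]; exists (rcons w' (rv bg y i)); rewrite -cats1 act_cat h2 /= rvK; split => //.
    by apply/wk_cat; split => //=; rewrite h2 rvK; split => //; exact: sFn.
  have cE x y : component (F n) x y <-> exists w, wk x w /\ act g w x = y.
    split.
      elim => {x y} [x y Fxy|x|x y _ [w [h1 <-]]|x y z _ [w [h1 <-]] _ [w' [h1' <-]]].
      - by have [i e] := FG x y Fxy; exists [:: i]; rewrite /= e.
      - by exists [::].
      - exact: wk_rev.
      - by exists (w ++ w'); rewrite act_cat; split => //; apply/wk_cat.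
    move=> [w [h1 <-]]; elim: w x h1 => [|i w IH] x /=; first by move=> _; exact: rst_refl.
    by move=> [Fi /IH h2]; apply: rst_trans h2; exact: rst_step.
  apply: (@bor_ext _ _ (fun x => exists w, wk (h x) w /\ act g w (h x) = h' x)).
    by move=> x; rewrite cE.
  apply: bor_ex => w; apply: bor_and; last by apply: (bor_eq bg) => //; exact: (bfun_act bg).
  elim: w (h) (bh) => [|i w IH] h0 bh0 /=; first exact: bor_cst.
  apply: bor_and; last by apply: (IH (fun x => g i (h0 x))); exact: (bfun_g bg).
  have mp : measurable_fun [set: X] (fun x => (h0 x, g i (h0 x))).
    by apply: measurable_fun_pair => //; exact: (bfun_g bg).
  by have := mp measurableT _ mFn; rewrite setTI.
split.
- by move=> n x; exact: rst_refl.
- by move=> n x y; exact: rst_sym.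
- by move=> n x y z; exact: rst_trans.
- by move=> n x; have /finite_seqP[s e] := fF n x; exists s => y; rewrite e.
- move=> x i Bx By; have : restrict_graph G B (x, g i x) by split => //; apply/gG; exists i.
  rewrite uF => -[n0 _ Fn0]; exists n0 => n nn; apply: rst_step.
  by move: nn => /subnKC <-; elim: (n - n0)%N => [|m IH]; rewrite ?addn0 // addnS; exact: mF.
Qed.

End Translate.

Theorem theorem1p1 (R : realType) (disp : measure_display)
    (X : measurableType disp) (k d : nat) (G : set (X * X)) :
  standard_borel R X ->
  (0 <= k <= d)%N ->
  ~~ odd k \/ odd d ->
  borel_graph G ->
  regular_on [set: X] d G ->
  bipartite G ->
  (forall tau : topology_on X, polish R (space tau) -> compatible tau ->
     exists A : set X,
       [/\ measurable A, invariant G A, @meager (space tau) A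
         & admits_borel_factor k (~` A) (restrict_graph G (~` A))])
  /\
  (forall mu : probability X R, mu_hyperfinite mu G ->
     exists A : set X,
       [/\ measurable A, invariant G A, mu A = 0%E
         & admits_borel_factor k (~` A) (restrict_graph G (~` A))]).
Proof.
move=> [tau0 [pol0 cmp0]] /andP[_ kd] par bG rG bip; have [_ mG] := bG.
split.
  move=> tau pol cmp; have [rho [q pm]] := polish_metric_exists pol.
  have [g [gb gi gG]] := borel_enumeration pm cmp mG rG.
  have bg := bgraph_of_graph pm cmp bG bip gb gi gG.
  have [||||V [F [bV iV cV sl]]] := @factor_of_rounds _ _ _ _ _ _ bg (comeager tau) _ k (fun=> True) kd par.
  - move=> N kap f V N0 bV iV cV sf.
    have [V1 [f1 [b1 i1 c1 s1 [sf1 af1]]]] := pass1_baire pm cmp bV iV cV sf.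
    have [V2 [f2 [b2 i2 c2 s2 h2]]] := pass2_baire pm cmp N0 b1 i1 c1 sf1 af1.
    by exists V2, f2; split => // x /s2 /s1.
  - exact: bor_cst.
  - by [].
  - rewrite /comeager; have -> : ~` [set _ | True] = set0 :> set X by rewrite setCT.
    exact: meager0.
  exists (~` [set x | V x]); split => //.
  - exact: measurableC.
  - exact: (invariant_of_inv gG).
  - by rewrite setCK; exact: (borel_factor_of_slots pm cmp gb gi gG bV iV sl).
move=> mu [B [mB iB nB hB]]; have [rho [q pm]] := polish_metric_exists pol0.
have [g [gb gi gG]] := borel_enumeration pm cmp0 mG rG.
have bg := bgraph_of_graph pm cmp0 bG bip gb gi gG.
have iB' := inv_of_invariant gG iB.
have [E [bE [E1 E2 E3 E4 E5]]] := hyperfinite_classes gG bg hB.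
have [||||V [F [bV iV [cV _] sl]]] := @factor_of_rounds _ _ _ _ _ _ bg
  (fun V => conull mu V /\ forall x, V x -> B x) _ k (fun x => B x) kd par.
- move=> N kap f V N0 bV iV [cV VB] sf.
  have [V1 [f1 [b1 i1 c1 s1 [sf1 af1]]]] := pass1_measure bV iV cV sf.
  have [|V2 [f2 [b2 i2 c2 s2 h2]]] := pass2_measure N0 b1 i1 c1 sf1 af1 bE E1 E2 E3 E4.
    move=> x i Vx; apply: E5; first by apply: VB; exact: s1.
    by apply: VB; apply: s1; exact: (i1 x i).1.
  exists V2, f2; split => //; first by split => // x /s2 /s1 /VB.
  by move=> x /s2 /s1.
- exact: mB.
- exact: iB'.
- by [].
exists (~` [set x | V x]); split => //.
- exact: measurableC.
- exact: (invariant_of_inv gG).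
- by rewrite setCK; exact: (borel_factor_of_slots pm cmp0 gb gi gG bV iV sl).
Qed.
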